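(* Let $e>1$, $n\ge1$, let $\mathbb{K}$ be an algebraically closed field of characteristic $p\neq2$ with $p\nmid(e+1)$, let $I=\{0,1,\ldots,e\}$ be the vertex set of the quiver of type $A^{(1)}_e$, and let $\Lambda=\sum_{s=1}^m\Lambda_{i_s}$ with $m\ge1$ and $i_1,\ldots,i_m\in I$. Then the cyclotomic quiver Hecke algebra $R^\Lambda_n(I)$ over $\mathbb{K}$ is semisimple if and only if $e\geq n$ and, for any $1\le s_1\ne s_2\le m$, $n\le|i_{s_1}-i_{s_2}|\le e+1-n$.
   Context: The characteristic $p$ may be $0$ (then $p\nmid(e+1)$ holds). The quiver $A^{(1)}_e$ is the cycle on vertices $0,1,\ldots,e$ (edges between $i$ and $i+1$ modulo $e+1$), each edge oriented arbitrarily. Put $Q_{i,j}(u,v)=u-v$ if $i\to j$, $v-u$ if $i\leftarrow j$, $0$ if $i=j$, $1$ otherwise. (All vertices are even, so the quiver Hecke superalgebra is the ordinary quiver Hecke algebra.) $R_n=R_n(I)$ is the $\mathbb{K}$-algebra generated by $e(\mathbf{i})$ ($\mathbf{i}=(\mathbf i_1,\ldots,\mathbf i_n)\in I^n$), $x_1,\ldots,x_n$, $\tau_1,\ldots,\tau_{n-1}$ with relations: $e(\mathbf{j})e(\mathbf{i})=\delta_{\mathbf{i},\mathbf{j}}e(\mathbf{i})$, $\sum_{\mathbf{i}}e(\mathbf{i})=1$; $x_px_q=x_qx_p$; $x_pe(\mathbf{i})=e(\mathbf{i})x_p$; $\tau_ae(\mathbf{i})=e(s_a\mathbf{i})\tau_a$,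 $s_a=(a,a+1)$; $\tau_ax_p=x_p\tau_a$ ($p\ne a,a+1$); $(\tau_ax_{a+1}-x_a\tau_a)e(\mathbf{i})=(x_{a+1}\tau_a-\tau_ax_a)e(\mathbf{i})=\delta_{\mathbf{i}_a,\mathbf{i}_{a+1}}e(\mathbf{i})$; $\tau_a^2e(\mathbf{i})=Q_{\mathbf{i}_a,\mathbf{i}_{a+1}}(x_a,x_{a+1})e(\mathbf{i})$; $\tau_a\tau_b=\tau_b\tau_a$ ($|a-b|>1$); $(\tau_{a+1}\tau_a\tau_{a+1}-\tau_a\tau_{a+1}\tau_a)e(\mathbf{i})=\frac{Q_{\mathbf{i}_a,\mathbf{i}_{a+1}}(x_{a+2},x_{a+1})-Q_{\mathbf{i}_a,\mathbf{i}_{a+1}}(x_a,x_{a+1})}{x_{a+2}-x_a}e(\mathbf{i})$ if $\mathbf{i}_a=\mathbf{i}_{a+2}$, and $0$ otherwise. $\Lambda_i$ are the fundamental weights, $\langle h_j,\Lambda_i\rangle=\delta_{ij}$, so $\langle h_i,\Lambda\rangle=\sharp\{s:i_s=i\}$. $R^\Lambda_n(I)$ is the quotient of $R_n$ by the two-sided ideal generated by $\sum_{\mathbf{i}\in I^n}x_1^{\langle h_{\mathbf{i}_1},\Lambda\rangle}e(\mathbf{i})$. *)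

(* Defs.v *)
From HB Require Import structures.
From mathcomp Require Import all_boot all_order perm all_algebra.
From mathcomp Require Import boolp.
From mathcomp Require Import finmap monalg mpoly.
Set Implicit Arguments.
Unset Strict Implicit.
Unset Printing Implicit Defensive.
Import GRing.Theory.
Local Open Scope ring_scope.

Section FreeAlgebra.
Variables (K : comNzRingType) (G : choiceType).

Lemma malg_scalerAr (c : K) (x y : {malg K[{fmonom G}]}) :
  c *: (x * y) = x * (c *: y).
Proof.
apply/malgP => k; rewrite monalg.mcoeffZ.
rewrite (@mcoeffMlw _ _ (monalg.msupp x) (monalg.msupp y) x y) //.
rewrite (@mcoeffMlw _ _ (monalg.msupp x) (monalg.msupp y) x (c *: y)) //; last exact: monalg.msuppZ_le.
rewrite mulr_sumr; apply: eq_bigr => a _; rewrite mulr_sumr.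
by apply: eq_bigr => b _; rewrite monalg.mcoeffZ mulrnAr mulrCA.
Qed.

Definition free_alg : Type := {malg K[{fmonom G}]}.

HB.instance Definition _ := GRing.Lalgebra.on free_alg.
HB.instance Definition _ :=
  GRing.Lalgebra_isAlgebra.Build K free_alg malg_scalerAr.

Definition free_gen (g : G) : free_alg := mkmalgU (fmu g) 1.

End FreeAlgebra.

(* The quotient of a ring by the two-sided ideal generated by S.  The rings here
   are [pzRingType]s because 1 != 0 is not known for a ring given by generators
   and relations. *)
Section IdealQuotient.
Variables (F : pzRingType) (S : F -> Prop).

Inductive in_ideal : F -> Prop :=
| in_ideal_gen x of S x : in_ideal x
| in_ideal0 : in_ideal 0
| in_idealB x y of in_ideal x & in_ideal y : in_ideal (x - y)
| in_idealMl a x of in_ideal x : in_ideal (a * x)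
| in_idealMr a x of in_ideal x : in_ideal (x * a).

Definition ideal : {pred F} := fun x => `[< in_ideal x >].

Lemma idealP x : reflect (in_ideal x) (x \in ideal).
Proof. exact: asboolP. Qed.

Lemma ideal_zmod_closed : zmod_closed ideal.
Proof.
split=> [|x y /idealP Ix /idealP Iy]; apply/idealP; first exact: in_ideal0.
exact: in_idealB.
Qed.

HB.instance Definition _ := GRing.isZmodClosed.Build F ideal ideal_zmod_closed.

Definition ring_quot : Type := Quotient.quot ideal.

HB.instance Definition _ := GRing.Zmodule.on ring_quot.
HB.instance Definition _ : EqQuotient F (Quotient.equiv ideal) ring_quot :=
  EqQuotient.on ring_quot.

Local Open Scope quotient_scope.

Definition ring_pi (x : F) : ring_quot := \pi_ring_quot x.

Lemma ring_pi_eq x y : ring_pi x = ring_pi y <-> x - y \in ideal.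
Proof. by rewrite Quotient.idealrBE; split=> [/eqP|/eqP]. Qed.

Lemma ring_piB : {morph ring_pi : x y / x - y}.
Proof. by move=> x y; rewrite /ring_pi !piE. Qed.

Lemma ring_piD : {morph ring_pi : x y / x + y}.
Proof. by move=> x y; rewrite /ring_pi !piE. Qed.

Lemma ring_piK (x : ring_quot) : ring_pi (repr x) = x.
Proof. exact: reprK. Qed.

Lemma repr_ring_pi x : repr (ring_pi x) - x \in ideal.
Proof. by apply/ring_pi_eq; rewrite ring_piK. Qed.

Definition quot_one : ring_quot := ring_pi 1.
Definition quot_mul (x y : ring_quot) : ring_quot := ring_pi (repr x * repr y).

Lemma pi_quot_mul x y : quot_mul (ring_pi x) (ring_pi y) = ring_pi (x * y).
Proof.
apply/ring_pi_eq; set x' := repr _; set y' := repr _.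
have -> : x' * y' - x * y = (x' - x) * y' - x * (y - y').
  by rewrite mulrBl mulrBr opprB addrA subrK.
apply/idealP/in_idealB; [apply: in_idealMr|apply: in_idealMl]; apply/idealP.
  exact: repr_ring_pi.
by rewrite -opprB rpredN; exact: repr_ring_pi.
Qed.

Lemma quot_mulA : associative quot_mul.
Proof.
move=> x y z; rewrite -[x]ring_piK -[y]ring_piK -[z]ring_piK.
by rewrite !pi_quot_mul mulrA.
Qed.
Lemma quot_mul1 : left_id quot_one quot_mul.
Proof. by move=> x; rewrite -[x]ring_piK pi_quot_mul mul1r. Qed.
Lemma quot_1mul : right_id quot_one quot_mul.
Proof. by move=> x; rewrite -[x]ring_piK pi_quot_mul mulr1. Qed.
Lemma quot_mulDl : left_distributive quot_mul +%R.
Proof.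
move=> x y z; rewrite -[x]ring_piK -[y]ring_piK -[z]ring_piK.
by rewrite -ring_piD !pi_quot_mul -ring_piD mulrDl.
Qed.
Lemma quot_mulDr : right_distributive quot_mul +%R.
Proof.
move=> x y z; rewrite -[x]ring_piK -[y]ring_piK -[z]ring_piK.
by rewrite -ring_piD !pi_quot_mul -ring_piD mulrDr.
Qed.

HB.instance Definition _ := GRing.Zmodule_isPzRing.Build ring_quot
  quot_mulA quot_mul1 quot_1mul quot_mulDl quot_mulDr.

Fact ring_pi_zmod_morphism : zmod_morphism ring_pi.
Proof. exact: ring_piB. Qed.

HB.instance Definition _ :=
  GRing.isZmodMorphism.Build F ring_quot ring_pi ring_pi_zmod_morphism.

Fact ring_pi_monoid_morphism : monoid_morphism ring_pi.
Proof. by split=> // x y; rewrite -pi_quot_mul. Qed.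

HB.instance Definition _ :=
  GRing.isMonoidMorphism.Build F ring_quot ring_pi ring_pi_monoid_morphism.

End IdealQuotient.

(* A ring is semisimple when its left regular module is a direct sum of simple
   submodules.  As the ring is unital, such a sum is automatically finite. *)
Section Semisimple.
Variable A : pzRingType.

Definition simple_submod (M : lmodType A) (L : {pred M}) : Prop :=
  [/\ submod_closed L,
      exists2 x, x \in L & x != 0 &
      forall N : {pred M}, submod_closed N -> {subset N <= L} ->
        (forall x, x \in N -> x = 0) \/ {subset L <= N}].

Definition semisimple : Prop :=
  exists (k : nat) (L : 'I_k -> {pred A^o}),
    (forall j, simple_submod (L j)) /\
    (forall x : A^o, exists! f : {ffun 'I_k -> A^o},
       (forall j, f j \in L j) /\ x = \sum_j f j).

End Semisimple.

Section QuiverHecke.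
Variables (K : fieldType) (I : finType) (arr : rel I) (n : nat).

Definition Q (R : pzRingType) (i j : I) (u v : R) : R :=
  if arr i j then u - v
  else if arr j i then v - u
  else if i == j then 0 else 1.

Lemma Q_divided_difference (R : pzRingType) (i j : I) (u u' v : R) :
  exists D : R, D * (u' - u) = Q i j u' v - Q i j u v.
Proof.
rewrite /Q; case: ifP => _.
  by exists 1; rewrite mul1r opprB addrA subrK.
case: ifP => _; last by exists 0; case: ifP; rewrite mul0r subrr.
exists (-1); rewrite mulN1r !opprB [v - u']addrC -[RHS]addrA.
by rewrite [v + _]addrC subrK addrC.
Qed.

(* Positions are numbered from 0: for a : 'I_n.-1, the generator tau a acts on
   the adjacent positions [lpos a] and [rpos a]. *)
Definition lpos (a : 'I_n.-1) : 'I_n := widen_ord (leq_pred n) a.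

Lemma rpos_subproof (a : 'I_n.-1) : (a.+1 < n)%N.
Proof. by rewrite -ltn_predRL. Qed.

Definition rpos (a : 'I_n.-1) : 'I_n := Ordinal (rpos_subproof a).

Definition word : finType := {ffun 'I_n -> I}.

Definition sact (a : 'I_n.-1) (i : word) : word :=
  [ffun k => i (tperm (lpos a) (rpos a) k)].

Definition qh_gen : finType := (word + 'I_n + 'I_n.-1)%type.

Local Notation F := (free_alg K qh_gen).

Definition ge (i : word) : F := free_gen K (inl (inl i) : qh_gen).
Definition gx (p : 'I_n) : F := free_gen K (inl (inr p) : qh_gen).
Definition gt (a : 'I_n.-1) : F := free_gen K (inr a : qh_gen).

(* A polynomial in x_1, ..., x_n as an element of the free algebra; the order
   of the factors is immaterial since the x_p commute in the quotient. *)
Definition polyx (D : mpoly n K) : F :=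
  \sum_(m <- msupp D) D@_m *: \prod_(p < n) gx p ^+ m p.

(* In [qh_braid_eq], D is the quotient of the polynomials appearing in the
   braid relation; it exists by [Q_divided_difference] and is unique because
   [mpoly n K] is a domain. *)
Inductive qh_rel : F -> F -> Prop :=
| qh_ee (i j : word) : qh_rel (ge j * ge i) (if i == j then ge i else 0)
| qh_sum_e : qh_rel (\sum_i ge i) 1
| qh_xx p q : qh_rel (gx p * gx q) (gx q * gx p)
| qh_xe p (i : word) : qh_rel (gx p * ge i) (ge i * gx p)
| qh_te a (i : word) : qh_rel (gt a * ge i) (ge (sact a i) * gt a)
| qh_tx a p of p != lpos a & p != rpos a : qh_rel (gt a * gx p) (gx p * gt a)
| qh_tx_r a (i : word) :
    qh_rel ((gt a * gx (rpos a) - gx (lpos a) * gt a) * ge i)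
           (if i (lpos a) == i (rpos a) then ge i else 0)
| qh_tx_l a (i : word) :
    qh_rel ((gx (rpos a) * gt a - gt a * gx (lpos a)) * ge i)
           (if i (lpos a) == i (rpos a) then ge i else 0)
| qh_tt a (i : word) :
    qh_rel (gt a ^+ 2 * ge i)
           (Q (i (lpos a)) (i (rpos a)) (gx (lpos a)) (gx (rpos a)) * ge i)
| qh_tt_comm (a b : 'I_n.-1) of (a.+1 < b)%N || (b.+1 < a)%N :
    qh_rel (gt a * gt b) (gt b * gt a)
| qh_braid_eq (a b : 'I_n.-1) (i : word) (D : mpoly n K) of
      b = a.+1 :> nat & i (lpos a) = i (rpos b) &
      D * ('X_(rpos b) - 'X_(lpos a)) =
        Q (i (lpos a)) (i (rpos a)) 'X_(rpos b) 'X_(rpos a)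
        - Q (i (lpos a)) (i (rpos a)) 'X_(lpos a) 'X_(rpos a) :
    qh_rel ((gt b * gt a * gt b - gt a * gt b * gt a) * ge i) (polyx D * ge i)
| qh_braid_neq (a b : 'I_n.-1) (i : word) of
      b = a.+1 :> nat & i (lpos a) != i (rpos b) :
    qh_rel ((gt b * gt a * gt b - gt a * gt b * gt a) * ge i) 0.

Definition quiver_hecke : pzRingType :=
  @ring_quot F (fun z => exists l r, qh_rel l r /\ z = l - r).

Definition qh_e (i : word) : quiver_hecke := ring_pi _ (ge i).
Definition qh_x (p : 'I_n) : quiver_hecke := ring_pi _ (gx p).
Definition qh_t (a : 'I_n.-1) : quiver_hecke := ring_pi _ (gt a).

(* A weight Lambda is represented by its values j |-> <h_j, Lambda>. *)
Definition weight : nmodType := {ffun I -> nat}.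

Definition fund_weight (i : I) : weight := [ffun j => (j == i) : nat].

Definition cyclotomic_elt (n_gt0 : (0 < n)%N) (Lambda : weight) : quiver_hecke :=
  let p1 := Ordinal n_gt0 in
  \sum_(i : word) qh_x p1 ^+ Lambda (i p1) * qh_e i.

Definition cyclotomic_quiver_hecke (n_gt0 : (0 < n)%N) (Lambda : weight) :
    pzRingType :=
  ring_quot (fun z => z = cyclotomic_elt n_gt0 Lambda).

(* The K-algebra structure, as a ring morphism from K with central image. *)
Definition cqh_scalar (n_gt0 : (0 < n)%N) (Lambda : weight) (c : K) :
    cyclotomic_quiver_hecke n_gt0 Lambda :=
  ring_pi _ (ring_pi _ (c%:A : F)).

Lemma cqh_scalar_zmod_morphism n_gt0 Lambda :
  zmod_morphism (@cqh_scalar n_gt0 Lambda).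
Proof. by move=> c d; rewrite /cqh_scalar scalerBl !rmorphB. Qed.

HB.instance Definition _ n_gt0 Lambda := GRing.isZmodMorphism.Build K _
  (@cqh_scalar n_gt0 Lambda) (cqh_scalar_zmod_morphism n_gt0 Lambda).

Lemma cqh_scalar_monoid_morphism n_gt0 Lambda :
  monoid_morphism (@cqh_scalar n_gt0 Lambda).
Proof.
split=> [|c d]; first by rewrite /cqh_scalar scale1r !rmorph1.
by rewrite /cqh_scalar -!rmorphM -scalerAl mul1r scalerA.
Qed.

HB.instance Definition _ n_gt0 Lambda := GRing.isMonoidMorphism.Build K _
  (@cqh_scalar n_gt0 Lambda) (cqh_scalar_monoid_morphism n_gt0 Lambda).

Lemma cqh_scalar_central n_gt0 Lambda c
    (x : cyclotomic_quiver_hecke n_gt0 Lambda) :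
  cqh_scalar n_gt0 Lambda c * x = x * cqh_scalar n_gt0 Lambda c.
Proof.
rewrite -[x]ring_piK -[repr x]ring_piK /cqh_scalar -!rmorphM.
by rewrite -scalerAl mul1r -scalerAr mulr1.
Qed.

End QuiverHecke.

Definition A1_edge (e : nat) (i j : 'I_e.+1) : bool :=
  (j == ordS i) || (i == ordS j).

(* [arr] is the arrow relation of a quiver of type A^(1)_e, for e > 1. *)
Definition A1_quiver (e : nat) (arr : rel 'I_e.+1) : Prop :=
  (forall i j, arr i j -> A1_edge i j) /\
  (forall i j, A1_edge i j -> arr i j (+) arr j i).

(* Main.v *)
Require Import Defs.
From HB Require Import structures.
From mathcomp Require Import all_boot all_order perm all_algebra.
From mathcomp Require Import boolp finmap monalg mpoly zify ring.
Set Implicit Arguments.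
Unset Strict Implicit.
Unset Printing Implicit Defensive.
Import Order.TTheory GRing.Theory Num.Theory.
Local Open Scope ring_scope.

(** The dots x_p are nilpotent in the cyclotomic algebra, so the question is whether
    they vanish.  Write R_n^L for the algebra of rank n and weight L, and e(w) for
    the idempotent of a word w.

    If the numerical condition holds, all dots vanish ([killed_all]).  Words are
    extended letter by letter.  As long as the dots vanish on shorter words, the
    relations force e(w) = 0 when w contains cc or cdc with c, d adjacent, and
    distant letters can be exchanged.  The only obstacle is a pair of adjacent
    letters that can be appended to a word in both orders; then the word connects two
    points of the support of L by a string ([no_exchange]), which is impossible
    because these points are far apart and the string cannot go around the cycle.
    With the dots gone, the crossings satisfy the braid relations and each is zero or
    invertible on a given word; two words are joined by at most one element up to a
    scalar ([uniqueness]), so the ideals generated by the nonzero e(w) are simple and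
    the algebra is semisimple ([semisimple_words]).

    If the condition fails, some dot is nonzero on a word i, i + 1, ..., i + d with
    d < n, beginning in the support of L and ending in a letter c that lies again
    in the support or closes the cycle.  A semisimple ring is von Neumann regular
    ([semisimple_regular]).  In R_(d+1)^L the sum of the dots of colour c is
    central and acts on the word as its last dot, which is nilpotent; in a regular
    ring it would have to be 0 ([not_regular]).  Two facts are needed: the dot is
    nonzero, and regularity descends from R_n^L to R_(d+1)^L.

    Both come from the residue map ([residue_map]), an R_N-bilinear map from R_(N+1)
    to R_N^L for each colour c, which vanishes on the cyclotomic ideal and sends
    x_(N+1)^(k-1) e(w c) to e(w) whenever
      k = L(c) + (number of neighbours of c in w) - 2 (number of letters c in w)
    is positive.  It shows that x_(N+1)^(k-1) e(w c) is nonzero if e(w) is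
    ([nonvanishing]).  Moreover, on the cycle the numbers k add up, over all colours
    c, to the sum of the values of L, which is positive; so the residue maps together split the
    inclusion of R_N^L, and regularity descends ([regular_descent]).

    The residue map is constructed from a representation of R_(N+1) by matrices over
    Laurent series in y with coefficients in R_N^L ([strand_klr]): a new strand of
    colour c and dot y is inserted at each of the N + 1 possible positions, and
    crosses the old strands by the formulas of the polynomial representation, in
    which the y - x_p are invertible because the x_p are nilpotent.  To see that an
    element of the cyclotomic ideal has residue 0, follow the new strand from the
    right end to the left end, where the cyclotomic element contributes y^L(c), and
    back.  The factors collected on the way ([rising_image], [falling_image]) are
    cancelled by the series used to define the residue ([trace_cancel]). *)

(** * Right-linear endomorphisms of function modules *)

Section RightLinearEndomorphisms.
Variables (T : Type) (R : pzRingType).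

Definition right_linear (f : (T -> R) -> T -> R) : Prop :=
  (forall u v, f (fun s => u s - v s) = fun t => f u t - f v t) /\
  (forall u b, f (fun s => u s * b) = fun t => f u t * b).

(** Matrices over R indexed by T, acting from the left on columns; for infinite T
    the action is kept instead of the entries, so no finiteness of rows or
    columns has to be imposed.  Linearity on the right makes the operators
    commute with right multiplication by R, which is what turns the residue below
    into a map linear on both sides. *)
Record rend := Rend { rend_fun :> (T -> R) -> T -> R; rendP : right_linear rend_fun }.

Lemma rend_ext (f g : rend) : (forall u t, f u t = g u t) -> f = g.
Proof.
case: f g => [f fP] [g gP] /= fg; have E : f = g.
  by apply: funext => u; apply: funext => t; rewrite fg.
by subst g; congr Rend; exact: Prop_irrelevance.
Qed.

Lemma rendB (f : rend) u v : f (fun s => u s - v s) = fun t => f u t - f v t.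
Proof. by case: (rendP f). Qed.
Lemma rendMr (f : rend) u b : f (fun s => u s * b) = fun t => f u t * b.
Proof. by case: (rendP f). Qed.
Lemma rend0 (f : rend) : f (fun=> 0) = fun=> 0.
Proof.
have -> : (fun=> 0) = (fun s : T => 0 * 0 : R) by apply: funext => t; rewrite mulr0.
by rewrite rendMr; apply: funext => t; rewrite !mulr0.
Qed.
Lemma rendN (f : rend) u : f (fun s => - u s) = fun t => - f u t.
Proof.
have -> : (fun s => - u s) = (fun s => 0 - u s) by apply: funext => s; rewrite sub0r.
by rewrite rendB rend0; apply: funext => t; rewrite sub0r.
Qed.
Lemma rendD (f : rend) u v : f (fun s => u s + v s) = fun t => f u t + f v t.
Proof.
have -> : (fun s => u s + v s) = (fun s => u s - (- v s)).
  by apply: funext => s; rewrite opprK.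
by rewrite rendB rendN; apply: funext => t; rewrite opprK.
Qed.

HB.instance Definition _ := gen_eqMixin rend.
HB.instance Definition _ := gen_choiceMixin rend.

Local Ltac rl := split => [u v|u b]; apply: funext => t /=.

Fact rend_zero_subproof : right_linear (fun _ _ => 0).
Proof. by rl; rewrite ?subrr ?mul0r. Qed.
Fact rend_opp_subproof (f : rend) : right_linear (fun u t => - f u t).
Proof. by rl; rewrite ?rendB ?rendMr ?mulNr // opprB opprK addrC. Qed.
Fact rend_add_subproof (f g : rend) : right_linear (fun u t => f u t + g u t).
Proof. by rl; rewrite ?rendB ?rendMr ?mulrDl // opprD addrACA. Qed.
Fact rend_one_subproof : right_linear id.
Proof. by rl. Qed.
Fact rend_mul_subproof (f g : rend) : right_linear (fun u => f (g u)).
Proof. by rl; rewrite ?rendB ?rendMr. Qed.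

Definition rend_zero := Rend rend_zero_subproof.
Definition rend_opp f := Rend (rend_opp_subproof f).
Definition rend_add f g := Rend (rend_add_subproof f g).
Definition rend_one := Rend rend_one_subproof.
Definition rend_mul f g := Rend (rend_mul_subproof f g).

Fact rend_addA : associative rend_add.
Proof. by move=> f g h; apply: rend_ext => u t /=; rewrite addrA. Qed.
Fact rend_addC : commutative rend_add.
Proof. by move=> f g; apply: rend_ext => u t /=; rewrite addrC. Qed.
Fact rend_add0 : left_id rend_zero rend_add.
Proof. by move=> f; apply: rend_ext => u t /=; rewrite add0r. Qed.
Fact rend_addN : left_inverse rend_zero rend_opp rend_add.
Proof. by move=> f; apply: rend_ext => u t /=; rewrite addNr. Qed.

HB.instance Definition _ :=
  GRing.isZmodule.Build rend rend_addA rend_addC rend_add0 rend_addN.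

Fact rend_mulA : associative rend_mul.
Proof. by move=> f g h; apply: rend_ext. Qed.
Fact rend_mul1 : left_id rend_one rend_mul.
Proof. by move=> f; apply: rend_ext. Qed.
Fact rend_1mul : right_id rend_one rend_mul.
Proof. by move=> f; apply: rend_ext. Qed.
Fact rend_mulDl : left_distributive rend_mul +%R.
Proof. by move=> f g h; apply: rend_ext. Qed.
Fact rend_mulDr : right_distributive rend_mul +%R.
Proof. by move=> f g h; apply: rend_ext => u t; rewrite /= rendD. Qed.

HB.instance Definition _ := GRing.Zmodule_isPzRing.Build rend
  rend_mulA rend_mul1 rend_1mul rend_mulDl rend_mulDr.

Lemma rendE_add (f g : rend) u t : (f + g) u t = f u t + g u t.
Proof. by []. Qed.
Lemma rendE_opp (f : rend) u t : (- f) u t = - f u t.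
Proof. by []. Qed.
Lemma rendE_sub (f g : rend) u t : (f - g) u t = f u t - g u t.
Proof. by []. Qed.
Lemma rendE_mul (f g : rend) u : (f * g) u = f (g u).
Proof. by []. Qed.
Lemma rendE_one u : (1 : rend) u = u.
Proof. by []. Qed.
Lemma rendE_sum (J : Type) (r : seq J) (P : pred J) (F : J -> rend) u t :
  (\sum_(j <- r | P j) F j) u t = \sum_(j <- r | P j) F j u t.
Proof. by elim/big_rec2: _ => [//|j y1 y2 _ <-]; rewrite rendE_add. Qed.

Fact rend_diag_subproof (a : T -> R) : right_linear (fun u t => a t * u t).
Proof. by rl; rewrite ?mulrBr ?mulrA. Qed.
Definition rend_diag a := Rend (rend_diag_subproof a).

Lemma rend_diag_ext a b : (forall t, a t = b t) -> rend_diag a = rend_diag b.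
Proof. by move=> ab; apply: rend_ext => u t /=; rewrite ab. Qed.
Lemma rend_diagM a b : rend_diag a * rend_diag b = rend_diag (fun t => a t * b t).
Proof. by apply: rend_ext => u t; rewrite rendE_mul /= mulrA. Qed.
Lemma rend_diagB a b : rend_diag a - rend_diag b = rend_diag (fun t => a t - b t).
Proof. by apply: rend_ext => u t; rewrite rendE_sub /= mulrBl. Qed.
Lemma rend_diag0 : rend_diag (fun=> 0) = 0.
Proof. by apply: rend_ext => u t; rewrite /= mul0r. Qed.
Lemma rend_diag1 : rend_diag (fun=> 1) = 1.
Proof. by apply: rend_ext => u t; rewrite /= mul1r. Qed.
Lemma rend_diag_nat b : (b%:R : rend) = rend_diag (fun=> b%:R).
Proof.
elim: b => [|b IH]; first by rewrite rend_diag0.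
rewrite -[b.+1]addn1 natrD IH; apply: rend_ext => u t.
by rewrite rendE_add /= natrD mulrDl mul1r.
Qed.
Lemma rend_diag_sum (J : Type) (r : seq J) (P : pred J) (F : J -> T -> R) :
  \sum_(j <- r | P j) rend_diag (F j) = rend_diag (fun t => \sum_(j <- r | P j) F j t).
Proof. by apply: rend_ext => u t; rewrite rendE_sum /= mulr_suml. Qed.

End RightLinearEndomorphisms.

(** * Morphisms out of free algebras and quotient rings *)

Section FreeAlgebraMorphism.
Variables (K : fieldType) (G : choiceType) (B : pzRingType).
Variables (kappa : {rmorphism K -> B}) (h : G -> B).
Hypothesis kappaC : forall c g, kappa c * h g = h g * kappa c.

(** The evaluation at h extending the scalars kappa.  The scalars need not be
    central in B: it is enough that they commute with the images of the
    generators. *)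
Definition fmon_ev (m : {fmonom G}) : B := \prod_(g <- (m : seq G)) h g.

Definition free_ev (f : free_alg K G) : B :=
  \sum_(m <- monalg.msupp f) kappa (monalg.mcoeff m f) * fmon_ev m.

Lemma free_evEw (d : {fset {fmonom G}}) (f : free_alg K G) :
  (monalg.msupp f `<=` d)%fset ->
  free_ev f = \sum_(m <- d) kappa (monalg.mcoeff m f) * fmon_ev m.
Proof.
move=> le; rewrite [LHS](big_fset_incl _ le) => //= x xd /monalg.mcoeff_outdom ->.
by rewrite rmorph0 mul0r.
Qed.

Lemma free_evU c m : free_ev (monalg.mkmalgU m c) = kappa c * fmon_ev m.
Proof. by rewrite (free_evEw msuppU_le) big_seq_fset1 mcoeffUU. Qed.

Fact free_ev_zmod : zmod_morphism free_ev.
Proof.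
move=> g1 g2 /=; pose d := (monalg.msupp g1 `|` monalg.msupp g2)%fset.
have s1 : (monalg.msupp g1 `<=` d)%fset by exact: fsubsetUl.
have s2 : (monalg.msupp g2 `<=` d)%fset by exact: fsubsetUr.
have s12 : (monalg.msupp (g1 - g2) `<=` d)%fset.
  apply/fsubsetP => k; rewrite -monalg.mcoeff_neq0 monalg.mcoeffB => nz.
  rewrite in_fsetU -!monalg.mcoeff_neq0; apply: contraNT nz.
  by rewrite negb_or !negbK => /andP[/eqP-> /eqP->]; rewrite subr0.
rewrite (free_evEw s1) (free_evEw s2) (free_evEw s12) -sumrB.
by apply: eq_bigr => k _; rewrite monalg.mcoeffB rmorphB mulrBl.
Qed.
HB.instance Definition _ :=
  GRing.isZmodMorphism.Build (free_alg K G) B free_ev free_ev_zmod.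

Lemma kappa_fmonC c m : kappa c * fmon_ev m = fmon_ev m * kappa c.
Proof.
rewrite /fmon_ev; elim: (m : seq G) => [|g s IH]; first by rewrite big_nil mulr1 mul1r.
by rewrite big_cons mulrA kappaC -!mulrA IH.
Qed.

Lemma fmon_evM m1 m2 : fmon_ev (monalg.mmul m1 m2) = fmon_ev m1 * fmon_ev m2.
Proof. by rewrite /fmon_ev fmM big_cat. Qed.

Fact free_ev_monoid : monoid_morphism free_ev.
Proof.
split.
  rewrite -[1 in LHS](_ : monalg.mkmalgU (@monalg.mone _) 1 = _) //.
  by rewrite free_evU rmorph1 mul1r /fmon_ev fm1 big_nil.
move=> g1 g2; rewrite monalg.malgME (raddf_sum free_ev) mulr_suml /=.
apply: eq_bigr => i _; rewrite (raddf_sum free_ev) mulr_sumr /=.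
apply: eq_bigr => j _.
rewrite free_evU fmon_evM rmorphM -!mulrA; congr (_ * _).
by rewrite !mulrA kappa_fmonC.
Qed.
HB.instance Definition _ :=
  GRing.isMonoidMorphism.Build (free_alg K G) B free_ev free_ev_monoid.

Lemma free_ev_gen g : free_ev (free_gen K g) = h g.
Proof. by rewrite free_evU rmorph1 mul1r /fmon_ev fmuE big_seq1. Qed.

Lemma free_ev_scalar c : free_ev (c%:A) = kappa c.
Proof.
rewrite -[c%:A](_ : monalg.mkmalgU (@monalg.mone _) c = _).
  by rewrite free_evU /fmon_ev fm1 big_nil mulr1.
by rewrite -[LHS]mulr1 mul_malgC.
Qed.

Lemma free_evZ c f : free_ev (c *: f) = kappa c * free_ev f.
Proof. by rewrite -[c *: f]mul1r -scalerAr scalerAl rmorphM /= free_ev_scalar. Qed.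

Lemma free_alg_morphism : exists f : {rmorphism free_alg K G -> B},
  (forall g, f (free_gen K g) = h g) /\ (forall c z, f (c *: z) = kappa c * f z).
Proof.
by exists (free_ev : {rmorphism _ -> _}); split; [exact: free_ev_gen|exact: free_evZ].
Qed.

End FreeAlgebraMorphism.

Lemma free_alg_ind (K : fieldType) (G : choiceType) (P : free_alg K G -> Prop) :
  (forall g, P (free_gen K g)) -> (forall c, P (c%:A)) ->
  (forall f g, P f -> P g -> P (f + g)) -> (forall f g, P f -> P g -> P (f * g)) ->
  forall f, P f.
Proof.
move=> Pg Pc PD PM f; have P0 : P 0 by rewrite -(scale0r 1).
rewrite [f]monalgE; apply: (big_ind P) => // m _.
have -> : monalg.mkmalgU m (monalg.mcoeff m f)
        = ((monalg.mcoeff m f)%:A : free_alg K G) * monalg.mkmalgU m 1.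
  by rewrite -scalerAl mul1r -[RHS](mul_malgC) [RHS]fgmulUU mul1m mulr1.
apply: (PM) => //; case: m => s; elim: s => [|g s IH].
  by rewrite -fmoneE -[X in P X](scale1r (1 : free_alg K G)).
have -> : monalg.mkmalgU (FMonom (g :: s)) 1
        = (free_gen K g : free_alg K G) * monalg.mkmalgU (FMonom s) 1.
  rewrite [RHS]fgmulUU mulr1; congr monalg.mkmalgU.
  by apply/eqP; rewrite fmP fmM fmuE.
exact: PM.
Qed.

Section QuotientMorphism.
Variables (F : pzRingType) (S : F -> Prop) (B : pzRingType) (f : {rmorphism F -> B}).
Hypothesis fS : forall z, S z -> f z = 0.

Lemma in_ideal_ker z : in_ideal S z -> f z = 0.
Proof.
elim=> [x /fS // | | x y _ fx _ fy | a x _ fx | a x _ fx].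
- exact: rmorph0.
- by rewrite rmorphB fx fy subrr.
- by rewrite rmorphM fx mulr0.
- by rewrite rmorphM fx mul0r.
Qed.

Definition quot_ev (x : ring_quot S) : B := f (repr x).

Lemma quot_evE z : quot_ev (ring_pi S z) = f z.
Proof.
apply/eqP; rewrite -subr_eq0 /quot_ev -rmorphB; apply/eqP/in_ideal_ker.
exact/idealP/repr_ring_pi.
Qed.

Fact quot_ev_zmod : zmod_morphism quot_ev.
Proof.
move=> x y; rewrite -[x]ring_piK -[y]ring_piK -rmorphB !quot_evE.
exact: rmorphB.
Qed.
HB.instance Definition _ :=
  GRing.isZmodMorphism.Build (ring_quot S) B quot_ev quot_ev_zmod.
Fact quot_ev_monoid : monoid_morphism quot_ev.
Proof.
split=> [|x y]; first by rewrite -(rmorph1 (ring_pi S)) quot_evE rmorph1.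
rewrite -[x]ring_piK -[y]ring_piK -rmorphM !quot_evE.
exact: rmorphM.
Qed.
HB.instance Definition _ :=
  GRing.isMonoidMorphism.Build (ring_quot S) B quot_ev quot_ev_monoid.

Lemma quot_morphism :
  exists g : {rmorphism ring_quot S -> B}, forall z, g (ring_pi S z) = f z.
Proof. by exists (quot_ev : {rmorphism _ -> _}); exact: quot_evE. Qed.

End QuotientMorphism.

(** * Local form of the quiver Hecke relations *)

Definition swp (a p : nat) : nat :=
  if p == a then a.+1 else if p == a.+1 then a else p.

Lemma swpK a : involutive (swp a).
Proof. rewrite /swp => p; do !case: ifP => //; lia. Qed.
Lemma swp_l a : swp a a = a.+1. Proof. by rewrite /swp eqxx. Qed.
Lemma swp_r a : swp a a.+1 = a.
Proof. by rewrite /swp eqxx; case: ifP => //; lia. Qed.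
Lemma swp_id a p : p != a -> p != a.+1 -> swp a p = p.
Proof. by rewrite /swp => /negPf-> /negPf->. Qed.

Section LocalRelations.
Variables (I : finType) (arr : rel I).

Definition adj (c d : I) : bool := arr c d || arr d c.

(** The divided difference in the braid relation of R_n is a constant, since Q is
    affine in its first argument: it is the slope of Q, equal to 1, -1 or 0. *)
Definition slope (B : pzRingType) (c d : I) : B := (arr c d)%:R - (arr d c)%:R.

(** The relations of R_n rewritten without words.  The idempotent [eps p d] says
    that the letter at position p is d; the idempotent of a word is the product
    of those of its letters, and each word-by-word relation becomes a sum over
    the letters at two or three positions.  In this form one strand can be added
    or forgotten without reindexing words.  Positions run over all natural
    numbers, so that systems of different ranks n live on the same functions. *)
Record klr (B : pzRingType) (n : nat) (eps : nat -> I -> B) (x t : nat -> B) : Prop := {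
  klr_ee : forall p c d, (p < n)%N ->
    eps p c * eps p d = if c == d then eps p c else 0;
  klr_sum : forall p, (p < n)%N -> \sum_d eps p d = 1;
  klr_eC : forall p q c d, (p < n)%N -> (q < n)%N ->
    eps p c * eps q d = eps q d * eps p c;
  klr_xC : forall p q, (p < n)%N -> (q < n)%N -> x p * x q = x q * x p;
  klr_xe : forall p q d, (p < n)%N -> (q < n)%N -> x p * eps q d = eps q d * x p;
  klr_te : forall a p d, (a.+1 < n)%N -> (p < n)%N ->
    t a * eps p d = eps (swp a p) d * t a;
  klr_tx : forall a p, (a.+1 < n)%N -> (p < n)%N -> p != a -> p != a.+1 ->
    t a * x p = x p * t a;
  klr_txr : forall a, (a.+1 < n)%N ->
    t a * x a.+1 - x a * t a = \sum_d eps a d * eps a.+1 d;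
  klr_txl : forall a, (a.+1 < n)%N ->
    x a.+1 * t a - t a * x a = \sum_d eps a d * eps a.+1 d;
  klr_tt : forall a, (a.+1 < n)%N ->
    t a * t a = \sum_c \sum_d Q arr c d (x a) (x a.+1) * (eps a c * eps a.+1 d);
  klr_tC : forall a b, (a.+1 < b)%N -> (b.+1 < n)%N -> t a * t b = t b * t a;
  klr_braid : forall a, (a.+2 < n)%N ->
    t a.+1 * t a * t a.+1 - t a * t a.+1 * t a
    = \sum_c \sum_d slope B c d * (eps a c * eps a.+1 d * eps a.+2 c) }.

End LocalRelations.

Section PrefixIdempotents.
Variables (I : finType) (arr : rel I) (B : pzRingType) (n : nat).
Variables (eps : nat -> I -> B) (x t : nat -> B).
Hypothesis R : klr arr n eps x t.

(** The idempotent of the first k letters of the word w. *)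
Definition pre (k : nat) (w : nat -> I) : B := \prod_(p < k) eps p (w p).

Lemma preS k w : pre k.+1 w = pre k w * eps k (w k).
Proof. by rewrite /pre big_ord_recr. Qed.

Lemma pre0 w : pre 0 w = 1. Proof. by rewrite /pre big_ord0. Qed.

Lemma eq_pre k w w' : (forall p, (p < k)%N -> w p = w' p) -> pre k w = pre k w'.
Proof. by move=> E; apply: eq_bigr => p _; rewrite E. Qed.

Lemma pre_comm k w z : (forall p, (p < k)%N -> z * eps p (w p) = eps p (w p) * z) ->
  z * pre k w = pre k w * z.
Proof.
elim: k => [|k IH] zC; first by rewrite pre0 mulr1 mul1r.
by rewrite preS mulrA IH ?zC -?mulrA ?zC // => p pk; apply: zC; lia.
Qed.

Lemma eps_preC p d k w : (p < n)%N -> (k <= n)%N ->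
  eps p d * pre k w = pre k w * eps p d.
Proof. by move=> pn kn; apply: pre_comm => q qk; apply: (klr_eC R) => //; lia. Qed.

Lemma x_preC p k w : (p < n)%N -> (k <= n)%N -> x p * pre k w = pre k w * x p.
Proof. by move=> pn kn; apply: pre_comm => q qk; apply: (klr_xe R) => //; lia. Qed.

Lemma eps_pre p d k w : (p < k)%N -> (k <= n)%N ->
  eps p d * pre k w = if w p == d then pre k w else 0.
Proof.
elim: k => // k IH; rewrite ltnS leq_eqVlt => /orP[/eqP->|pk] kn; rewrite preS mulrA.
  rewrite eps_preC -?mulrA ?(klr_ee R) //; try lia.
  by rewrite eq_sym; case: eqP => [->|_] //; rewrite mulr0.
by rewrite IH //; try lia; case: eqP => //; rewrite mul0r.
Qed.

Lemma pre_eps p d k w : (p < k)%N -> (k <= n)%N ->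
  pre k w * eps p d = if w p == d then pre k w else 0.
Proof. by move=> pk kn; rewrite -eps_preC ?eps_pre //; lia. Qed.

Lemma pre_id k w : (k <= n)%N -> pre k w * pre k w = pre k w.
Proof.
move=> kn; suff H j : (j <= k)%N -> pre j w * pre k w = pre k w by exact: H.
elim: j => [|j IH] jk; first by rewrite pre0 mul1r.
by rewrite preS -mulrA eps_pre // eqxx IH //; lia.
Qed.

Lemma pre_orth k w p v : (k <= n)%N -> (p < k)%N -> w p != v p -> pre k w * pre k v = 0.
Proof.
move=> kn pk /negPf wv; have := pre_eps (w p) w pk kn; rewrite eqxx => <-.
by rewrite -mulrA eps_pre // eq_sym wv mulr0.
Qed.

Lemma t_pre a k w : (a.+1 < n)%N -> (a.+1 < k)%N || (k <= a)%N -> (k <= n)%N ->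
  t a * pre k w = pre k (w \o swp a) * t a.
Proof.
move=> an; have step j v : (j <= a)%N -> t a * pre j v = pre j (v \o swp a) * t a.
  elim: j => [|j IH] ja; first by rewrite !pre0 mulr1 mul1r.
  rewrite !preS mulrA IH; last by lia.
  rewrite -!mulrA (klr_te R) //; try lia.
  by rewrite /= swp_id //; lia.
case/orP => [ak|/step//]; elim: k ak => // k IH; rewrite ltnS leq_eqVlt => /orP[/eqP<-|ak] kn.
  rewrite !preS 2!mulrA step // /= -!mulrA; congr (_ * _).
  rewrite !mulrA (klr_te R) //; last by lia.
  rewrite -[in LHS]mulrA (klr_te R) // swp_l swp_r mulrA.
  by rewrite (klr_eC R) //; lia.
rewrite !preS mulrA IH //; last by lia.
rewrite -!mulrA (klr_te R) //.
by rewrite /= swp_id //; lia.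
Qed.

(** Expanding the product over all positions of the decompositions of 1 into
    letter idempotents gives the decomposition of 1 into word idempotents. *)
Lemma pre_sum (i0 : I) : \sum_(i : {ffun 'I_n -> I})
    pre n (fun p => if insub p is Some k then i k else i0) = 1.
Proof.
rewrite -[RHS](@big1_eq B 1 *%R _ (index_enum 'I_n) xpredT).
rewrite -(eq_bigr _ (fun (p : 'I_n) _ => klr_sum R (ltn_ord p))).
rewrite bigA_distr_bigA; apply: eq_bigr => i _; apply: eq_bigr => p _.
by rewrite valK.
Qed.

(** On a vector whose letters at a and a+1 are known, the double sum in the
    quadratic relation reduces to one term. *)
Lemma klr_ttE a c d z : (a.+1 < n)%N -> z = eps a c * eps a.+1 d * z ->
  t a * (t a * z) = Q arr c d (x a) (x a.+1) * z.
Proof.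
move=> an zE; rewrite mulrA (klr_tt R) // mulr_suml (bigD1 c) //= mulr_suml (bigD1 d) //=.
rewrite -mulrA -zE big1 ?addr0 => [|d' /negPf dd]; last first.
  rewrite zE !mulrA -[_ * eps a c](_ : Q arr c d' (x a) (x a.+1) * eps a c * (eps a c * eps a.+1 d') = _); last first.
    by rewrite (klr_eC R) // ?mulrA; try lia.
  rewrite -!mulrA [eps a.+1 d' * (eps a.+1 d * z)]mulrA (klr_ee R) // dd.
  by rewrite mul0r !mulr0.
rewrite big1 ?addr0 // => c' /negPf cc; rewrite mulr_suml big1 // => d' _.
rewrite zE -!mulrA [eps a.+1 d' * (eps a c * _)]mulrA [eps a.+1 d' * eps a c](klr_eC R) //; try lia.
by rewrite !mulrA -[_ * eps a c' * eps a c]mulrA (klr_ee R) ?cc ?mulr0 ?mul0r //; lia.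
Qed.

End PrefixIdempotents.

(** * Morphisms out of the quiver Hecke algebra *)

Section QuiverHeckeMorphism.
Variables (K : fieldType) (I : finType) (arr : rel I) (i0 : I) (n : nat) (B : pzRingType).
Variables (kappa : {rmorphism K -> B}) (eps : nat -> I -> B) (x t : nat -> B).
Hypothesis arrN : forall i j, arr i j -> ~~ arr j i.
Hypothesis R : klr arr n eps x t.
Hypothesis kappa_eps : forall c p d, (p < n)%N -> kappa c * eps p d = eps p d * kappa c.
Hypothesis kappa_x : forall c p, (p < n)%N -> kappa c * x p = x p * kappa c.
Hypothesis kappa_t : forall c a, (a.+1 < n)%N -> kappa c * t a = t a * kappa c.

Definition letters (i : word I n) (p : nat) : I := if insub p is Some k then i k else i0.

Lemma letters_ord i (p : 'I_n) : letters i p = i p.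
Proof. by rewrite /letters valK. Qed.

Lemma letters_sact i a p : letters (sact a i) p = (letters i \o swp a) p.
Proof.
rewrite /letters /=; have an : (a.+1 < n)%N by rewrite -ltn_predRL.
case: insubP => [k _ <-|pn]; last first.
  by rewrite swp_id ?insubN //; apply: contraNneq pn => ->; lia.
rewrite ffunE; have -> : swp a k = tperm (lpos a) (rpos a) k.
  case: tpermP => [->|->|] /=; rewrite ?swp_l ?swp_r // => /eqP kl /eqP kr.
  by rewrite swp_id.
by rewrite valK.
Qed.

Definition qh_gen_ev (g : qh_gen I n) : B :=
  match g with
  | inl (inl i) => pre eps n (letters i)
  | inl (inr p) => x p
  | inr a => t a
  end.

Lemma qh_gen_evC c g : kappa c * qh_gen_ev g = qh_gen_ev g * kappa c.
Proof.
case: g => [[i|p]|a] /=; last by apply: kappa_t; rewrite -ltn_predRL.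
  by apply: pre_comm => p pn; apply: kappa_eps.
exact: kappa_x.
Qed.

(** The polynomial D in the braid relation can only be the constant slope,
    because polynomials over a field have no zero divisors. *)
Lemma braid_slope (c d : I) (p q r : 'I_n) (D : mpoly n K) : p != r ->
  D * ('X_r - 'X_p) = Q arr c d 'X_r 'X_q - Q arr c d 'X_p 'X_q ->
  D = (slope arr K c d)%:MP_[n].
Proof.
move=> pr HD; apply: (@mulIf _ ('X_r - 'X_p)).
  rewrite subr_eq0; apply/eqP => E.
  have := congr1 (fun f : mpoly n K => mcoeff U_(r)%MM f) E.
  by rewrite !mcoeffXU eqxx (negPf pr) => /eqP; rewrite oner_eq0.
rewrite HD /Q /slope; case: (boolP (arr c d)) => cd.
  rewrite (negPf (arrN cd)) subr0 mpolyC1 mul1r; ring.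
case: (boolP (arr d c)) => dc /=.
  rewrite sub0r mpolyCN mpolyC1; ring.
by rewrite !subrr (raddf0 (@mpolyC n K)) mul0r.
Qed.

Lemma polyxC (c : K) : polyx I c%:MP_[n] = c *: 1.
Proof.
rewrite /polyx msuppC; case: eqP => [->|_]; first by rewrite big_nil scale0r.
rewrite big_seq1 mcoeffC eqxx mulr1 big1 // => p _.
by rewrite mnm0E expr0.
Qed.

Lemma rmorph_Q (A : pzRingType) (f : {rmorphism A -> B}) c d u v :
  f (Q arr c d u v) = Q arr c d (f u) (f v).
Proof.
rewrite /Q; case: ifP => _; first exact: rmorphB.
case: ifP => _; first exact: rmorphB.
by case: ifP; rewrite ?rmorph0 ?rmorph1.
Qed.

Lemma rmorph_slope (A : pzRingType) (f : {rmorphism A -> B}) c d :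
  f (slope arr A c d) = slope arr B c d.
Proof. by rewrite rmorphB !rmorph_nat. Qed.

Let e (i : word I n) := pre eps n (letters i).

Lemma pre_letters_orth i j : i != j -> e i * e j = 0.
Proof.
move=> ij; case: (pickP (fun p => i p != j p)) => [p ijp|E].
  by apply: (pre_orth R (p := p)) => //; rewrite !letters_ord.
by case/eqP: ij; apply/ffunP => p; apply/eqP; move/negbFE: (E p).
Qed.

Lemma sum_eps_pre a i : (a.+1 < n)%N ->
  (\sum_d eps a d * eps a.+1 d) * e i = if letters i a == letters i a.+1 then e i else 0.
Proof.
move=> an; have an' : (a < n)%N by lia.
have E d : eps a d * eps a.+1 d * e i
    = if (letters i a == d) && (letters i a.+1 == d) then e i else 0.
  rewrite -mulrA (eps_pre R) //; case: (letters i a.+1 == d); rewrite ?andbF ?mulr0 //.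
  by rewrite (eps_pre R) // andbT.
rewrite mulr_suml (bigD1 (letters i a)) //= E eqxx [_ == letters i a]eq_sym.
rewrite big1 ?addr0 // => d da.
by rewrite E [_ == d]eq_sym (negPf da).
Qed.

Lemma braid_pre a i : (a.+2 < n)%N ->
  (\sum_c \sum_d slope arr B c d * (eps a c * eps a.+1 d * eps a.+2 c)) * e i
  = if letters i a == letters i a.+2 then slope arr B (letters i a) (letters i a.+1) * e i
    else 0.
Proof.
move=> an; have an' : (a < n)%N by lia. have an'' : (a.+1 < n)%N by lia.
have E c d : (slope arr B c d * (eps a c * eps a.+1 d * eps a.+2 c)) * e i
  = if [&& letters i a == c, letters i a.+1 == d & letters i a.+2 == c]
    then slope arr B c d * e i else 0.
  rewrite -!mulrA (eps_pre R) //; case: (letters i a.+2 =P c); rewrite ?andbF ?mulr0 // => _.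
  rewrite (eps_pre R) //.
  case: (letters i a.+1 =P d); rewrite ?andbF ?mulr0 // => _.
  by rewrite (eps_pre R) //; case: eqP; rewrite ?mulr0.
rewrite mulr_suml (bigD1 (letters i a)) //= mulr_suml (bigD1 (letters i a.+1)) //=.
rewrite E !eqxx [_ == letters i a]eq_sym !big1 ?addr0 //.
  move=> c ca; rewrite mulr_suml big1 // => d _.
  by rewrite E [_ == c]eq_sym (negPf ca).
by move=> d da; rewrite E [_ == d]eq_sym (negPf da) andbF.
Qed.

(** Every system satisfying the local relations in a ring B, with scalars that
    commute with it, is a representation of R_n in B. *)
Lemma quiver_hecke_morphism : exists phi : {rmorphism quiver_hecke K arr n -> B},
  [/\ forall i, phi (qh_e K arr i) = pre eps n (letters i),
      forall p, phi (qh_x K arr p) = x p,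
      forall a, phi (qh_t K arr a) = t a &
      forall c z, phi (ring_pi _ (c *: z)) = kappa c * phi (ring_pi _ z)].
Proof.
have [f [fg fZ]] := free_alg_morphism qh_gen_evC.
have fM u v : f (u * v) = f u * f v by exact: rmorphM.
have fB u v : f (u - v) = f u - f v by exact: rmorphB.
have f0 : f 0 = 0 by exact: rmorph0.
have fe i : f (ge K i) = e i by exact: fg.
have fx p : f (gx K I p) = x p by exact: fg.
have ft a : f (gt K I a) = t a by exact: fg.
suff frel z : (exists l r, qh_rel arr l r /\ z = l - r) -> f z = 0.
  have [phi phiE] := quot_morphism frel.
  by exists phi; split=> [i|p|a|c z]; rewrite phiE // phiE.
have lt_a (a : 'I_n.-1) : (a.+1 < n)%N by rewrite -ltn_predRL.
case=> l [r [lr ->]]; apply/eqP; rewrite fB subr_eq0; apply/eqP.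
have f3 u v w : f (u * v * w) = f u * f v * f w by rewrite fM [in LHS]fM.
have fD u v u' v' w : f ((u * v - u' * v') * w) = (f u * f v - f u' * f v') * f w.
  by rewrite fM fB; congr ((_ - _) * _); exact: fM.
have fT u v w : f ((u * v * u - v * u * v) * w)
    = (f u * f v * f u - f v * f u * f v) * f w.
  by rewrite fM fB; congr ((_ - _) * _); exact: f3.
have la i a : letters i (lpos a) = i (lpos a) := letters_ord i (lpos a).
have ra i a : letters i (rpos a) = i (rpos a) := letters_ord i (rpos a).
rewrite /= in la ra.
case: lr => {l r} [i j||p q|p i|a i|a p pl pr|a i|a i|a i|a b ab|a b i D ba il HD|a b i ba il].
- rewrite fM 2!fe; case: eqP => [->|/eqP ij]; first by rewrite fe (pre_id R).
  by rewrite pre_letters_orth ?f0 // eq_sym.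
- rewrite rmorph_sum rmorph1 -[RHS](pre_sum R i0).
  by apply: eq_bigr => i _; rewrite fe.
- by rewrite [LHS]fM [RHS]fM 2!fx (klr_xC R).
- by rewrite [LHS]fM [RHS]fM fx fe (x_preC R).
- rewrite [LHS]fM [RHS]fM ft 2!fe (t_pre R) ?lt_a //; congr (_ * _).
  by apply: eq_pre => p _; rewrite letters_sact.
- by rewrite [LHS]fM [RHS]fM ft fx (klr_tx R).
- rewrite fD ft 2!fx fe (klr_txr R) // sum_eps_pre // la ra.
  by case: ifP => _; rewrite ?fe ?f0.
- rewrite fD ft 2!fx fe (klr_txl R) // sum_eps_pre // la ra.
  by case: ifP => _; rewrite ?fe ?f0.
- rewrite expr2 [LHS]f3 [RHS]fM (rmorph_Q f) ft fe 2!fx -mulrA -la -ra.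
  apply: (klr_ttE R) => //.
  by rewrite -mulrA (eps_pre R) // eqxx (eps_pre R) ?eqxx //; apply: ltnW.
- rewrite [LHS]fM [RHS]fM 2!ft; case/orP: ab => ab; first exact: (klr_tC R).
  by symmetry; apply: (klr_tC R).
- have bn := lt_a b; rewrite ba in bn.
  have ab : lpos a != rpos b by rewrite -val_eqE /= ba; lia.
  rewrite (braid_slope ab HD) polyxC [LHS]fT [RHS]fM [in RHS]fZ (rmorph1 f) mulr1 2!ft fe ba (klr_braid R) //.
  rewrite braid_pre // rmorph_slope la ra.
  by have := ra i b; rewrite ba => ->; rewrite il eqxx.
- have bn := lt_a b; rewrite ba in bn.
  rewrite [LHS]fT f0 2!ft fe ba (klr_braid R) // braid_pre // la.
  by have := ra i b; rewrite ba => ->; rewrite (negPf il).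
Qed.

End QuiverHeckeMorphism.

(** * The local relations inside the quiver Hecke algebra *)

Section KlrOfQuiverHecke.
Variables (K : fieldType) (I : finType) (arr : rel I) (i0 : I) (n : nat) (B : pzRingType).
Hypothesis arrN : forall i j, arr i j -> ~~ arr j i.
Variable psi : {rmorphism quiver_hecke K arr n -> B}.

Local Notation letters := (letters i0).
Let e i := psi (qh_e K arr i).

(** Extended beyond the range of the positions, where the values never occur in a
    relation, so that the systems need no ordinals. *)
Definition qeps (p : nat) (d : I) : B := \sum_(i | letters i p == d) e i.
Definition qx (p : nat) : B := if insub p is Some k then psi (qh_x K arr k) else 0.
Definition qt (a : nat) : B := if insub a is Some k then psi (qh_t K arr k) else 0.

Lemma qh_rel_pi (l r : free_alg K (qh_gen I n)) : qh_rel arr l r ->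
  psi (ring_pi _ l) = psi (ring_pi _ r).
Proof.
move=> lr; congr (psi _); apply/ring_pi_eq/idealP/in_ideal_gen.
by exists l, r.
Qed.

Lemma psiM u v : psi (ring_pi _ (u * v)) = psi (ring_pi _ u) * psi (ring_pi _ v).
Proof. by rewrite [ring_pi _ _]rmorphM rmorphM. Qed.
Lemma psiB u v : psi (ring_pi _ (u - v)) = psi (ring_pi _ u) - psi (ring_pi _ v).
Proof. by rewrite [ring_pi _ _]rmorphB rmorphB. Qed.
Lemma psi0 : psi (ring_pi _ 0) = 0.
Proof. by rewrite [ring_pi _ _]rmorph0 rmorph0. Qed.

Lemma relMM u v u' v' : qh_rel arr (u * v) (u' * v') ->
  psi (ring_pi _ u) * psi (ring_pi _ v) = psi (ring_pi _ u') * psi (ring_pi _ v').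
Proof. by move=> h; rewrite -(psiM u v) -(psiM u' v'); apply: qh_rel_pi. Qed.

Lemma relDM u v u' v' w r : qh_rel arr ((u * v - u' * v') * w) r ->
  (psi (ring_pi _ u) * psi (ring_pi _ v) - psi (ring_pi _ u') * psi (ring_pi _ v'))
    * psi (ring_pi _ w) = psi (ring_pi _ r).
Proof.
move=> h; rewrite -(psiM u v) -(psiM u' v') -(psiB (u * v)) -(psiM (u * v - _)).
exact: qh_rel_pi.
Qed.

Lemma relT u v w r : qh_rel arr ((u * v * u - v * u * v) * w) r ->
  (psi (ring_pi _ u) * psi (ring_pi _ v) * psi (ring_pi _ u)
   - psi (ring_pi _ v) * psi (ring_pi _ u) * psi (ring_pi _ v))
    * psi (ring_pi _ w) = psi (ring_pi _ r).
Proof. by rewrite -(psiM u v) -(psiM v u); apply: relDM. Qed.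

Lemma rel2 u w r : qh_rel arr (u ^+ 2 * w) r ->
  psi (ring_pi _ u) * psi (ring_pi _ u) * psi (ring_pi _ w) = psi (ring_pi _ r).
Proof. by move=> h; rewrite -(psiM u u) -(psiM (u * u)); apply: qh_rel_pi. Qed.

Lemma qxE (p : 'I_n) : qx p = psi (qh_x K arr p). Proof. by rewrite /qx valK. Qed.
Lemma qtE (a : 'I_n.-1) : qt a = psi (qh_t K arr a). Proof. by rewrite /qt valK. Qed.

Lemma ee i j : e i * e j = if i == j then e i else 0.
Proof.
rewrite /e /qh_e -(psiM (ge K i)) (qh_rel_pi (qh_ee _ _ j i)) eq_sym.
by case: eqP => [->|_] //; rewrite psi0.
Qed.

Lemma sum_e : \sum_i e i = 1.
Proof.
have := qh_rel_pi (qh_sum_e K arr n).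
by rewrite [ring_pi _ (\sum_i _)]rmorph_sum rmorph_sum [ring_pi _ 1]rmorph1 rmorph1.
Qed.

Lemma eq_on_e u v : (forall i, u * e i = v * e i) -> u = v.
Proof.
by move=> uv; rewrite -[u]mulr1 -[v]mulr1 -sum_e !mulr_sumr; apply: eq_bigr => i _.
Qed.

Lemma qeps_e p d i : qeps p d * e i = if letters i p == d then e i else 0.
Proof.
rewrite /qeps mulr_suml; case: ifP => id.
  rewrite (bigD1 i) //= ee eqxx big1 ?addr0 // => j /andP[_ /negPf ji].
  by rewrite ee ji.
rewrite big1 // => j jd; rewrite ee; case: eqP => // ji.
by rewrite -ji jd in id.
Qed.

Lemma qx_e (p : 'I_n) i : qx p * e i = e i * qx p.
Proof. by rewrite qxE; exact: relMM (qh_xe _ _ p i). Qed.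

Lemma qt_e (a : 'I_n.-1) i : qt a * e i = e (sact a i) * qt a.
Proof. by rewrite qtE; exact: relMM (qh_te _ _ a i). Qed.

Lemma letters_l i (a : 'I_n.-1) : letters i a = i (lpos a).
Proof. by rewrite -(letters_ord i0 i (lpos a)). Qed.
Lemma letters_r i (a : 'I_n.-1) : letters i a.+1 = i (rpos a).
Proof. by rewrite -(letters_ord i0 i (rpos a)). Qed.
Lemma qxl (a : 'I_n.-1) : qx a = psi (qh_x K arr (lpos a)).
Proof. by rewrite -(qxE (lpos a)). Qed.
Lemma qxr (a : 'I_n.-1) : qx a.+1 = psi (qh_x K arr (rpos a)).
Proof. by rewrite -(qxE (rpos a)). Qed.

Lemma rmorph_ring_pi_if (b : bool) (z : free_alg K (qh_gen I n)) :
  psi (ring_pi _ (if b then z else 0)) = if b then psi (ring_pi _ z) else 0.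
Proof. by case: b; rewrite ?psi0. Qed.

(** Converse of the construction of morphisms: any image of R_n satisfies the
    local relations, since each can be tested against the word idempotents. *)
Lemma quiver_hecke_klr : klr arr n qeps qx qt.
Proof.
have ord_a a : (a.+1 < n)%N -> {b : 'I_n.-1 | b = a :> nat}.
  by move=> an; have an' : (a < n.-1)%N; [lia|exists (Ordinal an')].
have lep p q c d i : qeps p c * (qeps q d * e i)
   = if (letters i p == c) && (letters i q == d) then e i else 0.
  by rewrite qeps_e; case: ifP; rewrite ?andbF ?mulr0 // qeps_e andbT.
have lee p q c d i : (qeps p c * qeps q d) * e i
   = if (letters i p == c) && (letters i q == d) then e i else 0.
  by rewrite -mulrA.
have eq_sum p q i : (\sum_d qeps p d * qeps q d) * e i
    = if letters i p == letters i q then e i else 0.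
  rewrite mulr_suml (bigD1 (letters i p)) //= lee eqxx eq_sym big1 ?addr0 // => d da.
  by rewrite lee [_ == d]eq_sym (negPf da).
split.
- move=> p c d pn; apply: eq_on_e => i; rewrite lee.
  case: (c =P d) => [<-|cd]; first by rewrite andbb qeps_e.
  by rewrite mul0r; case: andP => // -[/eqP-> /eqP].
- move=> p pn; apply: eq_on_e => i; rewrite mul1r mulr_suml (bigD1 (letters i p)) //=.
  rewrite qeps_e eqxx big1 ?addr0 // => d da.
  by rewrite qeps_e [_ == d]eq_sym (negPf da).
- by move=> p q c d pn qn; apply: eq_on_e => i; rewrite !lee andbC.
- move=> p q pn qn; rewrite (qxE (Ordinal pn)) (qxE (Ordinal qn)).
  exact: relMM (qh_xx _ _ _ _).
- move=> p q d pn qn; apply: eq_on_e => i.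
  rewrite -mulrA qeps_e -mulrA (qx_e (Ordinal pn)) mulrA qeps_e.
  by case: ifP; rewrite ?mulr0 ?mul0r ?(qx_e (Ordinal pn)).
- move=> a p d /ord_a[b <-] pn; apply: eq_on_e => i.
  rewrite -mulrA qeps_e -mulrA qt_e mulrA qeps_e letters_sact /= swpK.
  by case: ifP; rewrite ?mulr0 ?mul0r ?qt_e.
- move=> a p /ord_a[b <-] pn pl pr.
  rewrite qtE (qxE (Ordinal pn)).
  by apply: relMM; apply: qh_tx; rewrite -val_eqE.
- move=> a /ord_a[b <-]; apply: eq_on_e => i.
  rewrite eq_sum qtE qxl qxr letters_l letters_r -rmorph_ring_pi_if.
  exact: relDM (qh_tx_r _ _ _ _).
- move=> a /ord_a[b <-]; apply: eq_on_e => i.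
  rewrite eq_sum qtE qxl qxr letters_l letters_r -rmorph_ring_pi_if.
  exact: relDM (qh_tx_l _ _ _ _).
- move=> a /ord_a[b <-]; apply: eq_on_e => i.
  have E c d : Q arr c d (qx b) (qx b.+1) * (qeps b c * qeps b.+1 d) * e i
    = if (letters i b == c) && (letters i b.+1 == d)
      then Q arr c d (qx b) (qx b.+1) * e i else 0.
    by rewrite -mulrA lee; case: ifP; rewrite ?mulr0.
  rewrite mulr_suml (bigD1 (letters i b)) //= mulr_suml (bigD1 (letters i b.+1)) //=.
  rewrite E !eqxx !big1 ?addr0 /=; first last.
  + by move=> d da; rewrite E [_ == d]eq_sym (negPf da) andbF.
  + move=> c ca; rewrite mulr_suml big1 // => d _.
    by rewrite E [_ == c]eq_sym (negPf ca).
  rewrite qtE; apply: (etrans (rel2 (qh_tt _ _ b i))); rewrite psiM.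
  rewrite qxl qxr letters_l letters_r; congr (_ * _).
  rewrite /Q; case: ifP => _; first by rewrite psiB.
  case: ifP => _; first by rewrite psiB.
  by case: ifP; rewrite ?psi0 // [ring_pi _ 1]rmorph1 rmorph1.
- move=> a b ab bn; have an : (a.+1 < n)%N by lia.
  have [a' a'E] := ord_a a an; rewrite -a'E in ab *; have [b' b'E] := ord_a b bn.
  rewrite -b'E 2!qtE.
  have ab' : (a'.+1 < b')%N || (b'.+1 < a')%N by rewrite b'E; lia.
  exact: relMM (qh_tt_comm _ _ ab').
- move=> a an; have an' : (a.+1 < n)%N by lia.
  have [b' b'E] := ord_a a.+1 an; have [a' a'E] := ord_a a an'.
  apply: eq_on_e => i.
  have E c d : slope arr B c d * (qeps a c * qeps a.+1 d * qeps a.+2 c) * e i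
    = if [&& letters i a == c, letters i a.+1 == d & letters i a.+2 == c]
      then slope arr B c d * e i else 0.
    rewrite -!mulrA qeps_e; case: (letters i a.+2 =P c); rewrite ?andbF ?mulr0 // => _.
    by rewrite lep andbT; case: ifP; rewrite ?mulr0.
  rewrite mulr_suml (bigD1 (letters i a)) //= mulr_suml (bigD1 (letters i a.+1)) //=.
  rewrite E !eqxx [_ == letters i a]eq_sym !big1 ?addr0 /=; first last.
  + by move=> d da; rewrite E [_ == d]eq_sym (negPf da) andbF.
  + move=> c ca; rewrite mulr_suml big1 // => d _.
    by rewrite E [_ == c]eq_sym (negPf ca).
  have ba : b' = a'.+1 :> nat by rewrite b'E a'E.
  have El : letters i a = i (lpos a') by rewrite -letters_l a'E.
  have Er : letters i a.+1 = i (rpos a') by rewrite -letters_r a'E.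
  have Err : letters i a.+2 = i (rpos b') by rewrite -letters_r b'E.
  have -> : qt a.+1 = psi (qh_t K arr b') by rewrite -qtE b'E.
  have -> : qt a = psi (qh_t K arr a') by rewrite -qtE a'E.
  rewrite El Er Err; case: eqP => [il|/eqP il]; last first.
    by rewrite -psi0; exact: relT (qh_braid_neq _ _ ba il).
  have HD : (slope arr K (i (lpos a')) (i (rpos a')))%:MP_[n] * ('X_(rpos b') - 'X_(lpos a'))
     = Q arr (i (lpos a')) (i (rpos a')) 'X_(rpos b') 'X_(rpos a')
       - Q arr (i (lpos a')) (i (rpos a')) 'X_(lpos a') 'X_(rpos a').
    rewrite /Q /slope; case: (boolP (arr _ _)) => cd.
      rewrite (negPf (arrN cd)) subr0 mpolyC1 mul1r; ring.
    case: (boolP (arr _ _)) => dc /=.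
      rewrite sub0r mpolyCN mpolyC1; ring.
    by rewrite !subrr (raddf0 (@mpolyC n K)) mul0r.
  apply: (etrans (relT (qh_braid_eq ba il HD))); rewrite polyxC psiM; congr (_ * _).
  rewrite /slope scalerBl psiB !scaler_nat.
  by congr (_ - _); rewrite [ring_pi _ _]rmorph_nat rmorph_nat.
Qed.

End KlrOfQuiverHecke.

(** * Nilpotency of the dots in the cyclotomic quotient *)

(** Locked, because the calculations below rewrite with products of two letter
    idempotents and must not confuse them with other products. *)
HB.lock Definition two (I : finType) (B : pzRingType) (eps : nat -> I -> B) (a : nat)
  (c d : I) : B := eps a c * eps a.+1 d.

Section TwoLetters.
Variables (I : finType) (arr : rel I) (B : pzRingType) (n : nat).
Variables (eps : nat -> I -> B) (x t : nat -> B).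
Hypothesis R : klr arr n eps x t.
Variable a : nat.
Hypothesis an : (a.+1 < n)%N.

Local Notation two := (two eps a).

Let an' : (a < n)%N. Proof. lia. Qed.

Lemma two_mul c d c' d' : two c d * two c' d' =
  if (c == c') && (d == d') then two c d else 0.
Proof.
rewrite two.unlock -mulrA [eps a.+1 d * _]mulrA (klr_eC R _ _ an an') -mulrA mulrA.
rewrite (klr_ee R) // (klr_ee R) //.
by do 2!case: ifP; rewrite /= ?mulr0 ?mul0r.
Qed.

Lemma two_id c d : two c d * two c d = two c d.
Proof. by rewrite two_mul !eqxx. Qed.

Lemma two_sum : \sum_c \sum_d two c d = 1.
Proof.
rewrite two.unlock -(klr_sum R an'); apply: eq_bigr => c _; rewrite -[RHS]mulr1 -(klr_sum R an).
by rewrite mulr_sumr.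
Qed.

Lemma eq_on_two u v : (forall c d, u * two c d = v * two c d) -> u = v.
Proof.
move=> uv; rewrite -[u]mulr1 -[v]mulr1 -two_sum !mulr_sumr.
by apply: eq_bigr => c _; rewrite !mulr_sumr; apply: eq_bigr => d _.
Qed.

Lemma eps_two_l b c d : eps a b * two c d = if b == c then two c d else 0.
Proof.
rewrite two.unlock mulrA (klr_ee R) //; case: ifP; rewrite ?mul0r //.
by move=> /eqP->.
Qed.

Lemma eps_two_r b c d : eps a.+1 b * two c d = if b == d then two c d else 0.
Proof.
rewrite two.unlock mulrA (klr_eC R _ _ an an') -mulrA (klr_ee R) //; case: ifP; rewrite ?mulr0 //.
by move=> /eqP->.
Qed.

Lemma x_two p c d : (p < n)%N -> x p * two c d = two c d * x p.
Proof. by move=> pn; rewrite two.unlock mulrA (klr_xe R) // -!mulrA (klr_xe R). Qed.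

Lemma t_two c d : t a * two c d = two d c * t a.
Proof.
rewrite two.unlock mulrA (klr_te R) // -[LHS]mulrA (klr_te R) // swp_l swp_r mulrA.
by rewrite (klr_eC R).
Qed.

Lemma sum_two c d : (\sum_b eps a b * eps a.+1 b) * two c d
  = if c == d then two c d else 0.
Proof.
rewrite mulr_suml (bigD1 c) //= -[X in X + _]mulrA eps_two_r big1 ?addr0 => [|b /negPf bc].
  by case: ifP; rewrite ?mulr0 // eps_two_l eqxx.
by rewrite -mulrA eps_two_r; case: ifP; rewrite ?mulr0 // eps_two_l bc.
Qed.

Lemma txl_two c d : x a.+1 * (t a * two c d) =
  t a * (x a * two c d) + (if c == d then two c d else 0).
Proof.
by rewrite -sum_two -(klr_txl R an) mulrBl !mulrA addrC subrK.
Qed.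

Lemma tt_two c d : t a * (t a * two c d) = Q arr c d (x a) (x a.+1) * two c d.
Proof. by rewrite (klr_ttE R an (c := c) (d := d)) //; rewrite -[LHS]two_id {1}two.unlock. Qed.

Lemma xC : x a * x a.+1 = x a.+1 * x a. Proof. exact: (klr_xC R an' an). Qed.

End TwoLetters.

Section Nilpotency.
Variables (I : finType) (arr : rel I) (B : pzRingType) (n : nat).
Variables (eps : nat -> I -> B) (x t : nat -> B).
Hypothesis arrI : forall i, ~~ arr i i.
Hypothesis R : klr arr n eps x t.

Section Step.
Variables (a M : nat).
Hypothesis an : (a.+1 < n)%N.
Hypothesis xM : x a ^+ M = 0.
Local Notation two := (two eps a).

Let an' : (a < n)%N. Proof. lia. Qed.

Lemma exp_two p m c d : (p < n)%N -> x p ^+ m * two c d = two c d * x p ^+ m.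
Proof.
by move=> pn; apply/commr_sym/commrX; apply/commr_sym; apply: (x_two R).
Qed.

Lemma expC p m : x a ^+ m * x a.+1 ^+ p = x a.+1 ^+ p * x a ^+ m.
Proof. by apply: commrX; apply/commr_sym/commrX/commr_sym; apply: (xC R). Qed.

Lemma xrexp j : x a.+1 * x a ^+ j = x a ^+ j * x a.+1.
Proof. by have := expC 1 j; rewrite expr1 => ->. Qed.

Lemma xlexp j : x a * x a.+1 ^+ j = x a.+1 ^+ j * x a.
Proof. by have := expC j 1; rewrite expr1 => ->. Qed.

(** The relation between a dot and a crossing, iterated: for equal letters the
    correction is the complete symmetric polynomial of degree m - 1. *)
Lemma exp_t_two m c d : x a.+1 ^+ m * (t a * two c d) =
  t a * (x a ^+ m * two c d)
  + (if c == d then \sum_(i < m) x a.+1 ^+ (m.-1 - i) * x a ^+ i else 0) * two c d.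
Proof.
elim: m => [|m IH].
  by rewrite !expr0 !mul1r big_ord0; case: ifP; rewrite mul0r addr0.
have xf : x a * two c d = two c d * x a by apply: (x_two R).
rewrite exprSr -mulrA (txl_two R) // mulrDr.
have -> : x a.+1 ^+ m * (t a * (x a * two c d)) = x a.+1 ^+ m * (t a * two c d) * x a.
  by rewrite xf !mulrA.
rewrite IH mulrDl -!mulrA -xf -addrA; congr (_ + _).
  by rewrite exprSr -mulrA.
case: eqP => _; last by rewrite !mul0r mulr0 addr0.
rewrite !mulrA -mulrDl; congr (_ * _); rewrite big_ord_recl /= subn0 expr0 mulr1 addrC.
congr (_ + _); rewrite mulr_suml; apply: eq_bigr => i _ /=.
by rewrite -mulrA -exprSr /bump /= add1n; congr (_ ^+ _ * _); have := ltn_ord i; lia.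
Qed.

(** For distinct letters x_(a+1)^M t^2 = t x_a^M t = 0, and t^2 is 1 or, up to
    sign, x_a - x_(a+1).  In the second case one factor x_(a+1) after another may
    be traded for x_a. *)
Lemma nil_neq c d : c != d -> x a.+1 ^+ (M + M) * two c d = 0.
Proof.
move=> cd; have nz : x a.+1 ^+ M * (t a * (t a * two c d)) = 0.
  rewrite (t_two R) // [t a * (_ * t a)]mulrA mulrA exp_t_two.
  by rewrite eq_sym (negPf cd) mul0r addr0 xM mul0r mulr0 mul0r.
move: nz; rewrite (tt_two R) // /Q; have step : (x a.+1 ^+ M * (x a * two c d) =
    x a.+1 ^+ M * (x a.+1 * two c d)) -> x a.+1 ^+ (M + M) * two c d = 0.
  move=> E; suff H j : x a.+1 ^+ (M + j) * two c d = x a ^+ j * (x a.+1 ^+ M * two c d).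
    by rewrite H xM mul0r.
  elim: j => [|j IH]; first by rewrite addn0 expr0 mul1r.
  rewrite addnS exprS -mulrA IH mulrA xrexp -mulrA exprSr -mulrA.
  congr (_ * _); rewrite mulrA -exprS exprSr -mulrA -E mulrA -xlexp.
  by rewrite -mulrA.
case: ifP => _ ; first by rewrite mulrBl mulrBr => /eqP; rewrite subr_eq0 => /eqP/step.
case: ifP => _; first by rewrite mulrBl mulrBr => /eqP; rewrite subr_eq0 eq_sym => /eqP/step.
by rewrite (negPf cd) mul1r exprD -mulrA => ->; rewrite mulr0.
Qed.

(** For equal letters t^2 = 0, and the exponent of x_a is lowered one step at a
    time.  If x_a^(j+1) x_(a+1)^N kills the idempotent f, then moving x_(a+1)^M
    through t shows that P = x_a^j x_(a+1)^(N+M-1) satisfies P f = P x_(a+1) t f;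
    multiplying by t on the right gives P t f = 0, hence P f = 0. *)
Lemma nil_eq c : x a.+1 ^+ (M * M) * two c c = 0.
Proof.
have [M0|M0] := posnP M; first by rewrite -[two c c]mul1r -(expr0 (x a)) -M0 xM mul0r mulr0.
suff H j : (j <= M)%N -> x a ^+ j * (x a.+1 ^+ ((M - j) * M) * two c c) = 0.
  by have := H 0 isT; rewrite expr0 mul1r subn0.
move=> jM; have [k ->] : {k | j = (M - k)%N} by exists (M - j)%N; lia.
elim: k => [|k IH]; first by rewrite subn0 xM mul0r.
have [Mk|kM] := leqP M k.
  by move: IH; rewrite (_ : (M - k.+1 = M - k)%N) //; lia.
pose j' := (M - k.+1)%N; have jE : (M - k)%N = j'.+1 by rewrite /j'; lia.
rewrite -/j'; set N := ((M - (M - k)) * M)%N in IH *.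
pose P := x a ^+ j' * x a.+1 ^+ (N + M.-1).
have P_exp : x a ^+ j' * x a.+1 ^+ N * (x a.+1 ^+ M * (t a * two c c)) = P * two c c.
  rewrite exp_t_two xM mul0r mulr0 add0r eqxx (bigD1 (Ordinal M0)) //= subn0 expr0 mulr1.
  rewrite mulrDl mulrDr [X in _ + X](_ : _ = 0) ?addr0; first by rewrite /P exprD !mulrA.
  rewrite mulr_suml mulr_sumr big1 // => -[[|i] /= iM] //= _.
  suff -> : x a ^+ j' * x a.+1 ^+ N * (x a.+1 ^+ (M.-1 - i.+1) * x a ^+ i.+1 * two c c)
      = x a.+1 ^+ (M.-1 - i.+1) * x a ^+ i * (x a ^+ j'.+1 * (x a.+1 ^+ N * two c c)).
    by rewrite -jE IH mulr0.
  rewrite !mulrA; congr (_ * _).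
  rewrite -[x a ^+ j' * _ * _]mulrA -exprD -mulrA -expC mulrA -exprD.
  rewrite -[X in X * x a.+1 ^+ N]mulrA -exprD -expC -mulrA -exprD addnC [in RHS]addnC.
  by congr (_ ^+ _ * _ ^+ _); rewrite ?addSnnS addnC // addSnnS.
have tf : t a * two c c = two c c * t a by apply: (t_two R).
have Pf : P * two c c = two c c * P.
  by rewrite /P -mulrA exp_two // mulrA exp_two // -!mulrA.
have Px : P * two c c = P * (x a.+1 * (t a * two c c)).
  rewrite -P_exp /P exprD -!mulrA; do 2 congr (_ * _).
  by rewrite [RHS]mulrA -exprSr; case: {+}M M0.
have Ptf : P * (t a * two c c) = 0.
  have := congr1 (fun z => z * t a) Px; rewrite -!mulrA -tf => ->.
  rewrite (tt_two R) // /Q (negPf (arrI c)) eqxx mul0r !mulr0 //.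
have P0 : P * two c c = 0.
  rewrite Px mulrA.
  have -> : P * x a.+1 = x a.+1 * P by rewrite /P mulrA xrexp -!mulrA -exprSr -exprS.
  by rewrite -mulrA Ptf mulr0.
have -> : ((M - j') * M = (N + M.-1).+1)%N.
  have -> : (M - j' = k.+1)%N by rewrite /j'; lia.
  by rewrite /N (_ : (M - (M - k) = k)%N) ?mulSn; lia.
rewrite exprS mulrA -mulrA -[x a.+1 * _ * _]mulrA mulrA -xrexp -mulrA.
by rewrite [x a ^+ j' * _]mulrA P0 mulr0.
Qed.

Lemma x_nilpotent_step : exists M', x a.+1 ^+ M' = 0.
Proof.
exists (M * M + (M + M))%N; apply: (eq_on_two R an) => c d; rewrite mul0r.
have [<-|cd] := eqVneq c d; first by rewrite addnC exprD -mulrA nil_eq mulr0.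
by rewrite exprD -mulrA nil_neq ?mulr0.
Qed.

End Step.

Variables (L : I -> nat).
Hypothesis cyc : (0 < n)%N -> \sum_d x 0 ^+ L d * eps 0 d = 0.

Lemma cyc_eps d : (0 < n)%N -> x 0 ^+ L d * eps 0 d = 0.
Proof.
move=> n0; have := congr1 (fun z => z * eps 0 d) (cyc n0); rewrite mul0r => <-.
rewrite mulr_suml (bigD1 d) //= -mulrA (klr_ee R) // eqxx big1 ?addr0 // => c /negPf cd.
by rewrite -mulrA (klr_ee R) // cd mulr0.
Qed.

(** The cyclotomic relation makes the first dot nilpotent, and nilpotency passes
    through each crossing. *)
Lemma x_nilpotent p : (p < n)%N -> exists M, x p ^+ M = 0.
Proof.
elim: p => [|p IH] pn; last first.
  by have [|M xM] := IH; [lia|exact: x_nilpotent_step pn xM].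
exists (\max_d L d)%N; rewrite -[LHS]mulr1 -(klr_sum R pn) mulr_sumr big1 // => d _.
have le : (L d <= \max_d L d)%N by exact: leq_bigmax.
by rewrite -(subnK le) exprD -mulrA cyc_eps ?mulr0.
Qed.

End Nilpotency.

(** * Insertion of a strand *)

(** Given a system of rank N in B and an element y that commutes with it, with all
    y - x_p invertible, a system of rank N + 1 acts on N + 1 copies of B: in copy k
    a new strand of colour c with dot y sits at position k, and the old strands
    keep their order.  The crossing t_a preserves copy k as the crossing of two old
    strands unless k is a or a + 1; on copies a and a + 1, where the new strand
    crosses the old strand at position a, it is the matrix
      [ - P    P + B ]
      [ A - P    P   ]
    made of the following three elements.  If the old strand has colour c this is
    the divided difference with denominator y - x_a; if it has colour d <> c, it
    is the exchange of the two copies, multiplied by Q_cd(y, x_a) in one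
    direction.  These are the formulas of the polynomial representation, with the
    other variables replaced by an arbitrary representation. *)
HB.lock Definition strand_P (I : finType) (B : pzRingType) (eps : nat -> I -> B) (c : I)
  (g : nat -> B) (p : nat) : B := g p * eps p c.
HB.lock Definition strand_B (I : finType) (arr : rel I) (B : pzRingType)
  (eps : nat -> I -> B) (x : nat -> B) (c : I) (y : B) (p : nat) : B :=
  \sum_d Q arr c d y (x p) * eps p d.
HB.lock Definition strand_A (I : finType) (B : pzRingType) (eps : nat -> I -> B) (c : I)
  (p : nat) : B := 1 - eps p c.

Section Strand.
Variables (I : finType) (arr : rel I) (B : pzRingType) (N : nat).
Variables (eps : nat -> I -> B) (x t : nat -> B).
Hypothesis arrI : forall i, ~~ arr i i.
Hypothesis arrN : forall i j, arr i j -> ~~ arr j i.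
Hypothesis R : klr arr N eps x t.
Variables (c : I) (y : B) (g : nat -> B).
Hypothesis y_eps : forall p d, (p < N)%N -> y * eps p d = eps p d * y.
Hypothesis y_x : forall p, (p < N)%N -> y * x p = x p * y.
Hypothesis y_t : forall a, (a.+1 < N)%N -> y * t a = t a * y.
Hypothesis gl : forall p, (p < N)%N -> g p * (y - x p) = 1.
Hypothesis gr : forall p, (p < N)%N -> (y - x p) * g p = 1.

Lemma Q_sym i j (u v : B) : Q arr j i v u = Q arr i j u v.
Proof.
rewrite /Q; case: (boolP (arr i j)) => ij; first by rewrite (negPf (arrN ij)).
by case: ifP => // _; rewrite eq_sym.
Qed.

Lemma Q_comm i j (u v z : B) : u * z = z * u -> v * z = z * v ->
  Q arr i j u v * z = z * Q arr i j u v.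
Proof.
move=> uz vz; rewrite /Q; case: ifP => _; first by rewrite mulrBl mulrBr uz vz.
case: ifP => _; first by rewrite mulrBl mulrBr uz vz.
by case: ifP; rewrite ?mulr0 ?mul0r ?mulr1 ?mul1r.
Qed.

Lemma g_comm p u : (p < N)%N -> (y - x p) * u = u * (y - x p) -> g p * u = u * g p.
Proof.
move=> pN uC; rewrite -[LHS]mulr1 -(gr pN) mulrA -[g p * u * _]mulrA -uC.
by rewrite [g p * _]mulrA gl // mul1r.
Qed.

Lemma g_eps p q d : (p < N)%N -> (q < N)%N -> g p * eps q d = eps q d * g p.
Proof. by move=> pN qN; apply: g_comm => //; rewrite mulrBl mulrBr y_eps // (klr_xe R). Qed.

Lemma g_x p q : (p < N)%N -> (q < N)%N -> g p * x q = x q * g p.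
Proof. by move=> pN qN; apply: g_comm => //; rewrite mulrBl mulrBr y_x // (klr_xC R pN qN). Qed.

Lemma g_y p : (p < N)%N -> g p * y = y * g p.
Proof. by move=> pN; apply: g_comm => //; rewrite mulrBl mulrBr y_x. Qed.

Lemma g_g p q : (p < N)%N -> (q < N)%N -> g p * g q = g q * g p.
Proof. by move=> pN qN; apply: g_comm => //; rewrite mulrBl mulrBr -g_y // g_x. Qed.

Lemma g_t p a : (p < N)%N -> (a.+1 < N)%N -> p != a -> p != a.+1 -> g p * t a = t a * g p.
Proof. by move=> pN aN pa pa'; apply: g_comm => //; rewrite mulrBl mulrBr y_t // (klr_tx R). Qed.

Section Crossing.
Variable a : nat.
Hypothesis aN : (a.+1 < N)%N.
Let aN' : (a < N)%N. Proof. lia. Qed.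
Local Notation delta := (\sum_d eps a d * eps a.+1 d).

Lemma g_delta p : (p < N)%N -> g p * delta = delta * g p.
Proof.
move=> pN; rewrite mulr_sumr mulr_suml; apply: eq_bigr => d _.
by rewrite mulrA g_eps // -!mulrA g_eps.
Qed.

(** Multiplying the relation between t_a and y - x_a by the inverses on both sides
    gives the relation between t_a and the inverses. *)
Lemma t_g_l : t a * g a = g a.+1 * t a - delta * (g a.+1 * g a).
Proof.
have E : t a * (y - x a) = (y - x a.+1) * t a + delta.
  by rewrite -(klr_txl R aN) mulrBl mulrBr y_t // addrA subrK.
have := congr1 (fun z => g a.+1 * z * g a) E.
rewrite /= [g a.+1 * (t a * _)]mulrA -[_ * _ * g a]mulrA gr // mulr1 mulrDr mulrDl.
rewrite [g a.+1 * (_ * t a)]mulrA gl // mul1r g_delta // -!mulrA => ->.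
by rewrite addrK.
Qed.

Lemma t_g_r : t a * g a.+1 = g a * t a + delta * (g a.+1 * g a).
Proof.
have E : t a * (y - x a.+1) = (y - x a) * t a - delta.
  by rewrite -(klr_txr R aN) mulrBl mulrBr y_t // opprB addrA subrK.
have := congr1 (fun z => g a * z * g a.+1) E.
rewrite /= [g a * (t a * _)]mulrA -[_ * _ * g a.+1]mulrA gr // mulr1 mulrBr [(_ - _) * g a.+1]mulrBl.
rewrite [g a * (_ * t a)]mulrA gl // mul1r g_delta // -!mulrA => ->.
by rewrite [g a.+1 * g a]g_g // subrK.
Qed.

End Crossing.

Local Notation sP := (strand_P eps c g).
Local Notation sB := (strand_B arr eps x c y).
Local Notation sA := (strand_A eps c).

Lemma y_two a d d' : (a.+1 < N)%N -> y * two eps a d d' = two eps a d d' * y.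
Proof. by move=> aN; rewrite two.unlock mulrA y_eps ?(ltnW aN) // -!mulrA y_eps. Qed.

Lemma g_two p a d d' : (p < N)%N -> (a.+1 < N)%N ->
  g p * two eps a d d' = two eps a d d' * g p.
Proof.
by move=> pN aN; rewrite two.unlock mulrA g_eps ?(ltnW aN) // -!mulrA g_eps.
Qed.

Section Braid.
Variable a : nat.
Hypothesis aN : (a.+1 < N)%N.
Let aN' : (a < N)%N. Proof. lia. Qed.
Local Notation f := (two eps a).

Lemma sP_l d d' z : sP a * (f d d' * z) = if d == c then f d d' * (g a * z) else 0.
Proof.
rewrite strand_P.unlock mulrA -[g a * _ * _]mulrA (eps_two_l R) // eq_sym; case: ifP => _.
  by rewrite g_two // -mulrA.
by rewrite mulr0 mul0r.
Qed.

Lemma sP_r d d' z : sP a.+1 * (f d d' * z) = if d' == c then f d d' * (g a.+1 * z) else 0.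
Proof.
rewrite strand_P.unlock mulrA -[g _ * _ * _]mulrA (eps_two_r R) // eq_sym; case: ifP => _.
  by rewrite g_two // -mulrA.
by rewrite mulr0 mul0r.
Qed.

Lemma Q_two p d d' i j : (p < N)%N ->
  Q arr i j y (x p) * f d d' = f d d' * Q arr i j y (x p).
Proof.
by move=> pN; apply: Q_comm; [apply: y_two|apply: (x_two R)].
Qed.

Lemma sB_l d d' z : sB a * (f d d' * z) = f d d' * (Q arr c d y (x a) * z).
Proof.
rewrite strand_B.unlock mulrA mulr_suml (bigD1 d) //= -mulrA (eps_two_l R) // eqxx big1 ?addr0.
  by rewrite Q_two // -mulrA.
by move=> b /negPf bd; rewrite -mulrA (eps_two_l R) // bd mulr0.
Qed.

Lemma sB_r d d' z : sB a.+1 * (f d d' * z) = f d d' * (Q arr c d' y (x a.+1) * z).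
Proof.
rewrite strand_B.unlock mulrA mulr_suml (bigD1 d') //= -mulrA (eps_two_r R) // eqxx big1 ?addr0.
  by rewrite Q_two // -mulrA.
by move=> b /negPf bd; rewrite -mulrA (eps_two_r R) // bd mulr0.
Qed.

Lemma sA_l d d' z : sA a * (f d d' * z) = if d == c then 0 else f d d' * z.
Proof.
rewrite strand_A.unlock mulrBl mul1r mulrA (eps_two_l R) // eq_sym; case: ifP => _.
  by rewrite subrr.
by rewrite mul0r subr0.
Qed.

Lemma sA_r d d' z : sA a.+1 * (f d d' * z) = if d' == c then 0 else f d d' * z.
Proof.
rewrite strand_A.unlock mulrBl mul1r mulrA (eps_two_r R) // eq_sym; case: ifP => _.
  by rewrite subrr.
by rewrite mul0r subr0.
Qed.

Lemma t_f d d' z : t a * (f d d' * z) = f d' d * (t a * z).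
Proof. by rewrite mulrA (t_two R) // -mulrA. Qed.

Lemma f_delta d d' z : f d d' * ((\sum_b eps a b * eps a.+1 b) * z)
  = if d == d' then f d d' * z else 0.
Proof.
rewrite mulrA; have -> : f d d' * (\sum_b eps a b * eps a.+1 b)
    = (\sum_b eps a b * eps a.+1 b) * f d d'.
  have C p b : (p < N)%N -> f d d' * eps p b = eps p b * f d d'.
    move=> pN; rewrite two.unlock -mulrA (klr_eC R d' b) // mulrA (klr_eC R d b) //.
    by rewrite -mulrA.
  by rewrite mulr_sumr mulr_suml; apply: eq_bigr => b _; rewrite mulrA C // -!mulrA C.
by rewrite (sum_two R) //; case: ifP; rewrite ?mul0r.
Qed.

Lemma f_tgl d d' z : f d d' * (t a * (g a * z)) =
  f d d' * (g a.+1 * (t a * z)) - (if d == d' then f d d' * (g a.+1 * (g a * z)) else 0).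
Proof.
rewrite [t a * (g a * z)]mulrA t_g_l // mulrBl mulrBr -!mulrA; congr (_ - _).
exact: f_delta.
Qed.

Lemma f_tgr d d' z : f d d' * (t a * (g a.+1 * z)) =
  f d d' * (g a * (t a * z)) + (if d == d' then f d d' * (g a.+1 * (g a * z)) else 0).
Proof.
rewrite [t a * (g a.+1 * z)]mulrA t_g_r // mulrDl mulrDr -!mulrA; congr (_ + _).
exact: f_delta.
Qed.

Lemma f_tt d d' z : f d d' * (t a * (t a * z)) = f d d' * (Q arr d d' (x a) (x a.+1) * z).
Proof.
have Qf : Q arr d d' (x a) (x a.+1) * f d d' = f d d' * Q arr d d' (x a) (x a.+1).
  by apply: Q_comm; apply: (x_two R).
by rewrite -(t_f d' d) -(t_f d d') [t a * (_ * z)]mulrA [t a * (_ * z)]mulrA (tt_two R) // Qf -mulrA.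
Qed.

Lemma f_g p d d' z : (p < N)%N -> f d d' * (g p * z) = g p * (f d d' * z).
Proof. by move=> pN; rewrite mulrA -g_two // -mulrA. Qed.

Lemma f_Q p d d' i z : (p < N)%N ->
  f d d' * (Q arr c i y (x p) * z) = Q arr c i y (x p) * (f d d' * z).
Proof. by move=> pN; rewrite mulrA -Q_two // -mulrA. Qed.

Lemma Q_g p q i z : (p < N)%N -> (q < N)%N ->
  Q arr c i y (x p) * (g q * z) = g q * (Q arr c i y (x p) * z).
Proof.
move=> pN qN; rewrite !mulrA; congr (_ * _); symmetry; apply: g_comm => //.
by apply/esym/Q_comm; rewrite mulrBl mulrBr ?y_x ?(klr_xC R pN qN).
Qed.

(** Crossing t_a past Q_ci(y, x_a) produces the slope of Q as a correction, just
    as crossing it past x_a produces 1. *)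
Lemma f_tQl d d' i z : f d d' * (t a * (Q arr c i y (x a) * z)) =
  Q arr c i y (x a.+1) * (f d d' * (t a * z))
  + (if d == d' then slope arr B c i * (f d d' * z) else 0).
Proof.
have E : f d d' * (t a * (x a * z)) = f d d' * (x a.+1 * (t a * z)) - (if d == d' then f d d' * z else 0).
  by rewrite -f_delta -(klr_txl R aN) mulrBl mulrBr -!mulrA opprB addrC subrK.
have yE : f d d' * (t a * (y * z)) = f d d' * (y * (t a * z)) by rewrite !mulrA -[f d d' * y * _]mulrA y_t // !mulrA.
rewrite -f_Q // /Q /slope; case: (boolP (arr c i)) => ci.
  rewrite (negPf (arrN ci)) subr0 mul1r !mulrBl !mulrBr E yE opprB addrA addrAC.
  by case: ifP; rewrite ?addr0 // addrAC.
case: ifP => _; last first.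
  by rewrite subrr mul0r if_same addr0; case: ifP => _; rewrite ?mul0r ?mulr0 ?mul1r.
rewrite sub0r mulN1r !mulrBl !mulrBr E yE addrAC; congr (_ + _).
by case: ifP; rewrite ?oppr0.
Qed.

Lemma f_tQr d d' i z : f d d' * (t a * (Q arr c i y (x a.+1) * z)) =
  Q arr c i y (x a) * (f d d' * (t a * z))
  - (if d == d' then slope arr B c i * (f d d' * z) else 0).
Proof.
have E : f d d' * (t a * (x a.+1 * z)) = f d d' * (x a * (t a * z)) + (if d == d' then f d d' * z else 0).
  by rewrite -f_delta -(klr_txr R aN) mulrBl mulrBr -!mulrA addrC subrK.
have yE : f d d' * (t a * (y * z)) = f d d' * (y * (t a * z)) by rewrite !mulrA -[f d d' * y * _]mulrA y_t // !mulrA.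
rewrite -f_Q // /Q /slope; case: (boolP (arr c i)) => ci.
  rewrite (negPf (arrN ci)) subr0 mul1r !mulrBl !mulrBr E yE opprD addrA.
  by [].
case: ifP => _; last first.
  by rewrite subrr mul0r if_same subr0; case: ifP => _; rewrite ?mul0r ?mulr0 ?mul1r.
rewrite sub0r mulN1r !mulrBl !mulrBr E yE addrAC; congr (_ + _).
by case: ifP; rewrite ?oppr0 // opprK.
Qed.

(** Q_cd is affine in its first argument, so its values at y and at a dot x differ
    by the slope times y - x.  Multiplying by the inverse of y - x leaves the slope
    alone, which is how the correction term of the braid relation appears. *)
Lemma slope_g_l d : d != c -> Q arr c d y (x a) - Q arr d c (x a) (x a.+1)
  = slope arr B c d * (y - x a.+1).
Proof.
move=> dc; rewrite /Q /slope; case: (boolP (arr c d)) => cd.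
  by rewrite (negPf (arrN cd)) subr0 mul1r opprB addrA subrK.
case: ifP => _; last by rewrite eq_sym (negPf dc) !subrr mul0r.
by rewrite sub0r mulN1r 2!opprB [LHS]addrC addrA subrK.
Qed.

Lemma slope_g_r d : Q arr c d y (x a.+1) - Q arr c d (x a) (x a.+1)
  = slope arr B c d * (y - x a).
Proof.
rewrite /Q /slope; case: (boolP (arr c d)) => cd.
  by rewrite (negPf (arrN cd)) subr0 mul1r opprB addrA subrK.
case: ifP => _; last by rewrite !subrr mul0r.
by rewrite sub0r mulN1r 2!opprB [LHS]addrC addrA subrK.
Qed.

End Braid.

(** The position among the old strands of the strand at position q, when the new
    strand is at position k. *)
Definition unb (k q : nat) := if (q < k)%N then q else q.-1.
Definition ecomp q d k : B := if q == k then (d == c)%:R else eps (unb k q) d.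
Definition xcomp q k : B := if q == k then y else x (unb k q).
(** The diagonal part of the crossing t_a at copy k, and its only possible
    off-diagonal part, from copy [swp a k] to copy k. *)
Definition Dcomp a k : B :=
  if k == a then - sP a else if k == a.+1 then sP a else t (unb k a).
Definition Ocomp a k : B :=
  if k == a then sP a + sB a else if k == a.+1 then sA a - sP a else 0.

Fact sT_subproof a : @right_linear 'I_N.+1 B
  (fun v k => Dcomp a k * v k + Ocomp a k * v (inord (swp a k))).
Proof.
split=> [u v|u b]; apply: funext => k /=.
  by rewrite !mulrBr addrACA -opprD.
by rewrite !mulrA mulrDl.
Qed.

Definition sT a := Rend (sT_subproof a).
Definition sE q d := @rend_diag 'I_N.+1 B (fun k => ecomp q d k).
Definition sX q := @rend_diag 'I_N.+1 B (fun k => xcomp q k).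

Lemma swp_le a k : (a < N)%N -> (k <= N)%N -> (swp a k <= N)%N.
Proof. by rewrite /swp => *; case: ifP => ?; [|case: ifP => ?]; lia. Qed.

Section At.
Variable v : 'I_N.+1 -> B.
Let w j := v (inord j).
Lemma sT_at a (k : 'I_N.+1) : sT a v k = Dcomp a k * w k + Ocomp a k * w (swp a k).
Proof. by rewrite /= /w inord_val. Qed.
Lemma sT_in a k : (k <= N)%N -> sT a v (inord k) = Dcomp a k * w k + Ocomp a k * w (swp a k).
Proof. by move=> kN; rewrite sT_at inordK. Qed.
End At.

Lemma unb_lt k q : (k <= N)%N -> (q <= N)%N -> q != k -> (unb k q < N)%N.
Proof. by rewrite /unb; case: ifP; lia. Qed.

Lemma unb_swp k a p : k != a -> k != a.+1 -> p != k -> swp (unb k a) (unb k p) = unb k (swp a p).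
Proof.
move=> ka ka' pk; rewrite [in RHS]/swp.
case: (p =P a) => [->|?]; [|case: (p =P a.+1) => [->|?]]; rewrite /unb;
  case: (ltnP a k) => ?; case: (ltnP p k) => ?; case: (ltnP a.+1 k) => ? //=;
  rewrite /swp; repeat (case: eqP => ? //=); lia.
Qed.

Lemma ecomp_ee p d d' (k : 'I_N.+1) : (p <= N)%N ->
  ecomp p d k * ecomp p d' k = if d == d' then ecomp p d k else 0.
Proof.
move=> pN; have kN := ltn_ord k; rewrite /ecomp; case: ifP => [_|/negbT pk].
  case: (eqVneq d d') => [->|dd]; first by case: (d' == c); rewrite ?mulr0 ?mulr1.
  case: (d =P c) => [E|_]; last by rewrite mul0r.
  by rewrite -E eq_sym (negPf dd) mulr0.
by rewrite (klr_ee R) // unb_lt.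
Qed.

Lemma ecomp_sum p (k : 'I_N.+1) : (p <= N)%N -> \sum_d ecomp p d k = 1.
Proof.
move=> pN; have kN := ltn_ord k; rewrite /ecomp; case: (boolP (p == k)) => [_|pk].
  by rewrite (bigD1 c) //= eqxx big1 ?addr0 // => d /negPf->.
by rewrite (klr_sum R) // unb_lt.
Qed.

Lemma natr_comm (b : nat) (u : B) : b%:R * u = u * b%:R.
Proof. by rewrite mulr_natl mulr_natr. Qed.

Lemma ecomp_eC p q d d' (k : 'I_N.+1) : (p <= N)%N -> (q <= N)%N ->
  ecomp p d k * ecomp q d' k = ecomp q d' k * ecomp p d k.
Proof.
move=> pN qN; have kN := ltn_ord k; rewrite /ecomp; case: ifP => [_|/negbT pk].
  exact: natr_comm.
case: ifP => [_|/negbT qk]; first by rewrite natr_comm.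
by rewrite (klr_eC R) // unb_lt.
Qed.

Lemma xcomp_xC p q (k : 'I_N.+1) : (p <= N)%N -> (q <= N)%N ->
  xcomp p k * xcomp q k = xcomp q k * xcomp p k.
Proof.
move=> pN qN; have kN := ltn_ord k; rewrite /xcomp; case: ifP => [_|/negbT pk].
  by case: ifP => // /negbT qk; rewrite y_x // unb_lt.
case: ifP => [_|/negbT qk]; first by rewrite y_x // unb_lt.
by rewrite (klr_xC R) // unb_lt.
Qed.

Lemma xcomp_ecomp p q d (k : 'I_N.+1) : (p <= N)%N -> (q <= N)%N ->
  xcomp p k * ecomp q d k = ecomp q d k * xcomp p k.
Proof.
move=> pN qN; have kN := ltn_ord k; rewrite /xcomp /ecomp; case: (q =P k) => [_|/eqP qk].
  by rewrite natr_comm.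
case: ifP => [_|/negbT pk]; first by rewrite y_eps // unb_lt.
by rewrite (klr_xe R) // unb_lt.
Qed.

Lemma sT_diag a (u u' : nat -> B) : (a < N)%N ->
  (forall k, (k <= N)%N -> Dcomp a k * u k = u' k * Dcomp a k) ->
  (forall k, (k <= N)%N -> Ocomp a k * u (swp a k) = u' k * Ocomp a k) ->
  sT a * @rend_diag 'I_N.+1 B (fun k => u k) = @rend_diag 'I_N.+1 B (fun k => u' k) * sT a.
Proof.
move=> aN HD HO; apply: rend_ext => v k; have kN : (k <= N)%N by rewrite -ltnS.
rewrite 2!rendE_mul sT_at /= inordK // inordK ?ltnS ?swp_le // inord_val mulrDr !mulrA.
by rewrite HD // HO.
Qed.

Lemma sP_comm p u : (p < N)%N -> g p * u = u * g p -> eps p c * u = u * eps p c ->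
  sP p * u = u * sP p.
Proof. by move=> pN gu eu; rewrite strand_P.unlock -mulrA eu mulrA gu -mulrA. Qed.

Lemma sB_comm p u : (p < N)%N -> y * u = u * y -> x p * u = u * x p ->
  (forall d, eps p d * u = u * eps p d) -> sB p * u = u * sB p.
Proof.
move=> pN yu xu eu; rewrite strand_B.unlock mulr_suml mulr_sumr; apply: eq_bigr => d _.
rewrite -mulrA eu !mulrA; congr (_ * _); exact: Q_comm.
Qed.

Lemma sA_comm p u : (p < N)%N -> eps p c * u = u * eps p c -> sA p * u = u * sA p.
Proof. by move=> pN eu; rewrite strand_A.unlock mulrBl mulrBr eu mul1r mulr1. Qed.

Lemma unb_succ a : unb a a.+1 = a.
Proof. by rewrite /unb; case: ifP => //; lia. Qed.
Lemma unb_self a : unb a.+1 a = a.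
Proof. by rewrite /unb leqnn. Qed.
Lemma unb_far a p : p != a -> p != a.+1 -> unb a.+1 p = unb a p.
Proof. by rewrite /unb => ? ?; case: ifP => ?; case: ifP => ?; lia. Qed.
Lemma unb_S k a : k != a -> k != a.+1 -> unb k a.+1 = (unb k a).+1.
Proof. by rewrite /unb => ? ?; case: ifP => ?; case: ifP => ?; lia. Qed.
Lemma unb_S_lt k a : (a < N)%N -> (k <= N)%N -> k != a -> k != a.+1 -> ((unb k a).+1 < N)%N.
Proof. by rewrite /unb => ? ? ? ?; case: ifP => ?; lia. Qed.

Lemma ecomp_self k d : ecomp k d k = (d == c)%:R.
Proof. by rewrite /ecomp eqxx. Qed.
Lemma ecomp_succ a d : ecomp a.+1 d a = eps a d.
Proof. by rewrite /ecomp unb_succ; case: eqP => //; lia. Qed.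
Lemma ecomp_pred a d : ecomp a d a.+1 = eps a d.
Proof. by rewrite /ecomp unb_self; case: eqP => //; lia. Qed.
Lemma ecomp_neq p d k : p != k -> ecomp p d k = eps (unb k p) d.
Proof. by rewrite /ecomp => /negPf->. Qed.
Lemma xcomp_self k : xcomp k k = y.
Proof. by rewrite /xcomp eqxx. Qed.
Lemma xcomp_succ a : xcomp a.+1 a = x a.
Proof. by rewrite /xcomp unb_succ; case: eqP => //; lia. Qed.
Lemma xcomp_pred a : xcomp a a.+1 = x a.
Proof. by rewrite /xcomp unb_self; case: eqP => //; lia. Qed.
Lemma xcomp_neq p k : p != k -> xcomp p k = x (unb k p).
Proof. by rewrite /xcomp => /negPf->. Qed.

Lemma Dcomp_l a : Dcomp a a = - sP a. Proof. by rewrite /Dcomp eqxx. Qed.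
Lemma Dcomp_r a : Dcomp a a.+1 = sP a.
Proof. by rewrite /Dcomp eqxx; case: eqP => //; lia. Qed.
Lemma Dcomp_far a k : k != a -> k != a.+1 -> Dcomp a k = t (unb k a).
Proof. by rewrite /Dcomp => /negPf-> /negPf->. Qed.
Lemma Ocomp_l a : Ocomp a a = sP a + sB a. Proof. by rewrite /Ocomp eqxx. Qed.
Lemma Ocomp_r a : Ocomp a a.+1 = sA a - sP a.
Proof. by rewrite /Ocomp eqxx; case: eqP => //; lia. Qed.
Lemma Ocomp_far a k : k != a -> k != a.+1 -> Ocomp a k = 0.
Proof. by rewrite /Ocomp => /negPf-> /negPf->. Qed.

Lemma sP_eps p d : (p < N)%N -> sP p * eps p d = (d == c)%:R * sP p.
Proof.
move=> pN; rewrite strand_P.unlock -mulrA (klr_ee R) // eq_sym.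
by case: eqP; rewrite ?mul1r ?mul0r ?mulr0.
Qed.
Lemma eps_sP p d : (p < N)%N -> eps p d * sP p = (d == c)%:R * sP p.
Proof.
move=> pN; rewrite -sP_eps //; symmetry; apply: sP_comm => //; first exact: g_eps.
exact: (klr_eC R).
Qed.
Lemma comm_eps_sP p q d : (p < N)%N -> (q < N)%N -> sP p * eps q d = eps q d * sP p.
Proof. by move=> pN qN; apply: sP_comm => //; [apply: g_eps|apply: (klr_eC R)]. Qed.
Lemma comm_eps_sB p q d : (p < N)%N -> (q < N)%N -> sB p * eps q d = eps q d * sB p.
Proof.
move=> pN qN; apply: sB_comm => // [||d']; [exact: y_eps|exact: (klr_xe R)|].
exact: (klr_eC R).
Qed.
Lemma comm_eps_sA p q d : (p < N)%N -> (q < N)%N -> sA p * eps q d = eps q d * sA p.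
Proof. by move=> pN qN; apply: sA_comm => //; apply: (klr_eC R). Qed.
Lemma comm_x_sP p q : (p < N)%N -> (q < N)%N -> sP p * x q = x q * sP p.
Proof. by move=> pN qN; apply: sP_comm => //; [apply: g_x|symmetry; apply: (klr_xe R)]. Qed.
Lemma comm_x_sB p q : (p < N)%N -> (q < N)%N -> sB p * x q = x q * sB p.
Proof.
move=> pN qN; apply: sB_comm => // [||d']; [exact: y_x|exact: (klr_xC R)|].
by symmetry; apply: (klr_xe R).
Qed.
Lemma comm_x_sA p q : (p < N)%N -> (q < N)%N -> sA p * x q = x q * sA p.
Proof. by move=> pN qN; apply: sA_comm => //; symmetry; apply: (klr_xe R). Qed.

Lemma sT_te a p d : (a < N)%N -> (p <= N)%N -> sT a * sE p d = sE (swp a p) d * sT a.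
Proof.
move=> aN pN; apply: (sT_diag aN) => k kN.
- case: (eqVneq k a) => [->|ka]; [rewrite Dcomp_l|case: (eqVneq k a.+1) => [->|ka']].
  + rewrite mulNr mulrN; congr (- _).
    case: (eqVneq p a) => [->|pa]; first by rewrite swp_l ecomp_self ecomp_succ eps_sP // natr_comm.
    case: (eqVneq p a.+1) => [->|pa'].
      by rewrite swp_r ecomp_self ecomp_succ sP_eps.
    rewrite swp_id // ecomp_neq //; apply: comm_eps_sP => //; apply: unb_lt => //; lia.
  + rewrite Dcomp_r.
    case: (eqVneq p a) => [->|pa].
      by rewrite swp_l ecomp_self ecomp_pred sP_eps.
    case: (eqVneq p a.+1) => [->|pa']; first by rewrite swp_r ecomp_self ecomp_pred eps_sP // natr_comm.
    rewrite swp_id // ecomp_neq //; apply: comm_eps_sP => //; apply: unb_lt => //; lia.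
  rewrite Dcomp_far //; case: (eqVneq p k) => [->|pk].
    by rewrite swp_id // ecomp_self natr_comm.
  rewrite ecomp_neq // (klr_te R) ?unb_S_lt ?unb_lt // unb_swp // ecomp_neq //.
  by apply: contra_neq pk => E; rewrite -(swpK a p) E swp_id.
- case: (eqVneq k a) => [->|ka]; [rewrite Ocomp_l swp_l|case: (eqVneq k a.+1) => [->|ka']].
  + have C q d' : (q < N)%N -> (sP a + sB a) * eps q d' = eps q d' * (sP a + sB a).
      by move=> qN; rewrite mulrDl mulrDr comm_eps_sP // comm_eps_sB.
    case: (eqVneq p a) => [->|pa]; first by rewrite swp_l ecomp_pred ecomp_succ C.
    case: (eqVneq p a.+1) => [->|pa']; first by rewrite swp_r !ecomp_self natr_comm.
    by rewrite swp_id // 2?ecomp_neq // unb_far // C //; apply: unb_lt => //; lia.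
  + rewrite Ocomp_r swp_r.
    have C q d' : (q < N)%N -> (sA a - sP a) * eps q d' = eps q d' * (sA a - sP a).
      by move=> qN; rewrite mulrBl mulrBr comm_eps_sP // comm_eps_sA.
    case: (eqVneq p a) => [->|pa]; first by rewrite swp_l !ecomp_self natr_comm.
    case: (eqVneq p a.+1) => [->|pa']; first by rewrite swp_r ecomp_pred ecomp_succ C.
    by rewrite swp_id // 2?ecomp_neq // unb_far // C //; apply: unb_lt => //; lia.
  by rewrite Ocomp_far // mul0r mulr0.
Qed.

Lemma sT_tx a p : (a < N)%N -> (p <= N)%N -> p != a -> p != a.+1 ->
  sT a * sX p = sX p * sT a.
Proof.
move=> aN pN pa pa'; apply: (sT_diag aN) => k kN.
- case: (eqVneq k a) => [->|ka]; [rewrite Dcomp_l|case: (eqVneq k a.+1) => [->|ka']].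
  + rewrite mulNr mulrN; congr (- _); rewrite xcomp_neq //; apply: comm_x_sP => //.
    by apply: unb_lt => //; lia.
  + rewrite Dcomp_r xcomp_neq //; apply: comm_x_sP => //.
    by apply: unb_lt => //; lia.
  rewrite Dcomp_far //; case: (eqVneq p k) => [->|pk].
    by rewrite xcomp_self y_t // unb_S_lt.
  rewrite !xcomp_neq // (klr_tx R) ?unb_S_lt ?unb_lt //.
    by move: pa pk ka ka'; rewrite /unb; do 2!(case: ifP => ?); lia.
  by move: pa pa' pk ka ka'; rewrite /unb; do 2!(case: ifP => ?); lia.
- case: (eqVneq k a) => [->|ka]; [rewrite Ocomp_l swp_l|case: (eqVneq k a.+1) => [->|ka']].
  + rewrite 2?xcomp_neq // unb_far // mulrDl mulrDr comm_x_sP ?comm_x_sB //;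
      by apply: unb_lt => //; lia.
  + rewrite Ocomp_r swp_r 2?xcomp_neq // unb_far // mulrBl mulrBr comm_x_sP ?comm_x_sA //;
      by apply: unb_lt => //; lia.
  by rewrite Ocomp_far // mul0r mulr0.
Qed.

Lemma sE_sum_pair p q : \sum_d sE p d * sE q d
  = @rend_diag 'I_N.+1 B (fun k => \sum_d ecomp p d k * ecomp q d k).
Proof. by rewrite -rend_diag_sum; apply: eq_bigr => d _; rewrite -rend_diagM. Qed.

Lemma delta_comp a k : (a < N)%N -> (k <= N)%N ->
  \sum_d ecomp a d k * ecomp a.+1 d k =
  if (k == a) || (k == a.+1) then eps a c
  else \sum_d eps (unb k a) d * eps (unb k a).+1 d.
Proof.
move=> aN kN; case: (eqVneq k a) => [->|ka]; last case: (eqVneq k a.+1) => [->|ka'] /=.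
- rewrite (bigD1 c) //= ecomp_self ecomp_succ eqxx mul1r big1 ?addr0 // => d /negPf dc.
  by rewrite ecomp_self dc mul0r.
- rewrite (bigD1 c) //= ecomp_self ecomp_pred eqxx mulr1 big1 ?addr0 // => d /negPf dc.
  by rewrite ecomp_self dc mulr0.
by apply: eq_bigr => d _; rewrite !ecomp_neq ?unb_S // eq_sym.
Qed.

Lemma sP_g a : (a < N)%N -> sP a * (y - x a) = eps a c.
Proof. by move=> aN; rewrite strand_P.unlock g_eps // -mulrA gl // mulr1. Qed.

Lemma g_sP a : (a < N)%N -> (y - x a) * sP a = eps a c.
Proof. by move=> aN; rewrite strand_P.unlock mulrA gr // mul1r. Qed.

Lemma sT_diagB a (u u' r : nat -> B) : (a < N)%N ->
  (forall k, (k <= N)%N -> Dcomp a k * u k - u' k * Dcomp a k = r k) ->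
  (forall k, (k <= N)%N -> Ocomp a k * u (swp a k) = u' k * Ocomp a k) ->
  sT a * @rend_diag 'I_N.+1 B (fun k => u k) - @rend_diag 'I_N.+1 B (fun k => u' k) * sT a
  = @rend_diag 'I_N.+1 B (fun k => r k).
Proof.
move=> aN HD HO; apply: rend_ext => v k; have kN : (k <= N)%N by rewrite -ltnS.
rewrite rendE_sub 2!rendE_mul sT_at /= inordK // inordK ?ltnS ?swp_le //.
rewrite inord_val mulrDr !mulrA HO // opprD addrACA subrr addr0.
by rewrite -mulrBl HD.
Qed.

Lemma comm_y_sP p : (p < N)%N -> sP p * y = y * sP p.
Proof. by move=> pN; apply: sP_comm => //; [exact: g_y|by rewrite y_eps]. Qed.
Lemma comm_y_sB p : (p < N)%N -> sB p * y = y * sB p.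
Proof.
move=> pN; apply: sB_comm => // [|d]; first by rewrite y_x.
by rewrite y_eps.
Qed.
Lemma comm_y_sA p : (p < N)%N -> sA p * y = y * sA p.
Proof. by move=> pN; apply: sA_comm => //; rewrite y_eps. Qed.

Lemma sT_txr a : (a < N)%N ->
  sT a * sX a.+1 - sX a * sT a = \sum_d sE a d * sE a.+1 d.
Proof.
move=> aN; rewrite sE_sum_pair; apply: (sT_diagB (u := xcomp a.+1) (u' := xcomp a)
  (r := fun k => \sum_d ecomp a d k * ecomp a.+1 d k) aN) => k kN.
- rewrite delta_comp //; case: (eqVneq k a) => [->|ka]; last case: (eqVneq k a.+1) => [->|ka'] /=.
  + by rewrite Dcomp_l xcomp_succ xcomp_self mulrN mulNr opprK addrC -g_sP // mulrBl comm_x_sP.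
  + by rewrite Dcomp_r xcomp_pred xcomp_self -sP_g // mulrBr comm_x_sP.
  have [ak ak'] : a != k /\ a.+1 != k by rewrite eq_sym ka eq_sym.
  rewrite Dcomp_far // xcomp_neq // xcomp_neq // unb_S // (klr_txr R) //.
  exact: unb_S_lt.
case: (eqVneq k a) => [->|ka]; last case: (eqVneq k a.+1) => [->|ka'].
- by rewrite swp_l 2!xcomp_self Ocomp_l mulrDl mulrDr comm_y_sP ?comm_y_sB.
- by rewrite swp_r xcomp_succ xcomp_pred Ocomp_r mulrBl mulrBr comm_x_sP ?comm_x_sA.
by rewrite Ocomp_far // mul0r mulr0.
Qed.

Lemma sT_txl a : (a < N)%N ->
  sX a.+1 * sT a - sT a * sX a = \sum_d sE a d * sE a.+1 d.
Proof.
move=> aN; apply: oppr_inj; rewrite opprB sE_sum_pair.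
rewrite -[RHS]sub0r -rend_diag0 rend_diagB; apply: (sT_diagB (u := xcomp a) (u' := xcomp a.+1)
  (r := fun k => 0 - \sum_d ecomp a d k * ecomp a.+1 d k) aN) => k kN.
- rewrite sub0r delta_comp //.
  case: (eqVneq k a) => [->|ka]; last case: (eqVneq k a.+1) => [->|ka'] /=.
  + rewrite Dcomp_l xcomp_succ xcomp_self mulrN mulNr opprK addrC -sP_g // mulrBr opprB.
    by rewrite comm_x_sP.
  + by rewrite Dcomp_r xcomp_pred xcomp_self -g_sP // mulrBl opprB comm_x_sP.
  have [ak ak'] : a != k /\ a.+1 != k by rewrite eq_sym ka eq_sym.
  rewrite Dcomp_far // xcomp_neq // xcomp_neq // unb_S // -(klr_txl R) ?opprB //.
  exact: unb_S_lt.
case: (eqVneq k a) => [->|ka]; last case: (eqVneq k a.+1) => [->|ka'].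
- by rewrite swp_l xcomp_pred xcomp_succ Ocomp_l mulrDl mulrDr comm_x_sP ?comm_x_sB.
- by rewrite swp_r 2!xcomp_self Ocomp_r mulrBl mulrBr comm_y_sP ?comm_y_sA.
by rewrite Ocomp_far // mul0r mulr0.
Qed.

Lemma sP_id p : (p < N)%N -> sP p * eps p c = sP p.
Proof. by move=> pN; rewrite sP_eps // eqxx mul1r. Qed.

Lemma sB_sP p : (p < N)%N -> sB p * sP p = 0.
Proof.
move=> pN; rewrite strand_B.unlock mulr_suml big1 // => d _; rewrite -mulrA eps_sP //.
case: eqP => [->|_]; last by rewrite mul0r mulr0.
by rewrite /Q (negPf (arrI c)) eqxx mul0r.
Qed.

Lemma sP_sB p : (p < N)%N -> sP p * sB p = 0.
Proof.
move=> pN; rewrite -[RHS](sB_sP pN); symmetry; apply: sB_comm => // [|| d].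
- by rewrite comm_y_sP.
- by rewrite comm_x_sP.
by rewrite comm_eps_sP.
Qed.

Lemma sA_sP p : (p < N)%N -> sA p * sP p = 0.
Proof. by move=> pN; rewrite strand_A.unlock mulrBl eps_sP // eqxx !mul1r subrr. Qed.
Lemma sP_sA p : (p < N)%N -> sP p * sA p = 0.
Proof. by move=> pN; rewrite strand_A.unlock mulrBr sP_id // mulr1 subrr. Qed.

Lemma sB_sA p : (p < N)%N -> sB p * sA p = sB p.
Proof.
move=> pN; rewrite strand_A.unlock mulrBr mulr1 -[X in _ - X](_ : 0 = _) ?subr0 //.
rewrite strand_B.unlock mulr_suml big1 // => d _; rewrite -mulrA (klr_ee R) //.
case: eqP => [->|_]; last by rewrite mulr0.
by rewrite /Q (negPf (arrI c)) eqxx mul0r.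
Qed.
Lemma sA_sB p : (p < N)%N -> sA p * sB p = sB p.
Proof.
move=> pN; rewrite -[RHS](sB_sA pN); symmetry; apply: sB_comm => // [|| d].
- by rewrite comm_y_sA.
- by rewrite comm_x_sA.
by rewrite comm_eps_sA.
Qed.

Lemma sE_Q_pair p q : (p <= N)%N -> (q <= N)%N ->
  \sum_d \sum_d' Q arr d d' (sX p) (sX q) * (sE p d * sE q d')
  = @rend_diag 'I_N.+1 B (fun k => \sum_d \sum_d'
      Q arr d d' (xcomp p k) (xcomp q k) * (ecomp p d k * ecomp q d' k)).
Proof.
move=> pN qN; rewrite -rend_diag_sum; apply: eq_bigr => d _.
rewrite -rend_diag_sum; apply: eq_bigr => d' _; rewrite rend_diagM.
have -> : Q arr d d' (sX p) (sX q)
    = @rend_diag 'I_N.+1 B (fun k => Q arr d d' (xcomp p k) (xcomp q k)).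
  rewrite /Q; case: ifP => _; first exact: rend_diagB.
  case: ifP => _; first exact: rend_diagB.
  by case: ifP; rewrite ?rend_diag0 ?rend_diag1.
exact: rend_diagM.
Qed.

Lemma sQ_l p : (p < N)%N -> - sP p * - sP p + (sP p + sB p) * (sA p - sP p) = sB p.
Proof.
move=> pN; rewrite mulrNN mulrBr !mulrDl sP_sA // sB_sA // sB_sP // add0r addr0.
by rewrite addrC subrK.
Qed.
Lemma sQ_r p : (p < N)%N -> sP p * sP p + (sA p - sP p) * (sP p + sB p) = sB p.
Proof.
move=> pN; rewrite mulrDr [_ * sP p in X in _ + X]mulrBl [_ * sB p]mulrBl sA_sP // sA_sB // sP_sB // subr0 sub0r.
by rewrite addrA subrr add0r.
Qed.
Lemma sQ_lr p : (p < N)%N -> - sP p * (sP p + sB p) + (sP p + sB p) * sP p = 0.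
Proof. by move=> pN; rewrite mulNr mulrDl mulrDr sP_sB // sB_sP // addNr. Qed.
Lemma sQ_rl p : (p < N)%N -> sP p * (sA p - sP p) + (sA p - sP p) * - sP p = 0.
Proof. by move=> pN; rewrite mulrN [_ * sP p]mulrBl mulrBr sP_sA // sA_sP // subrr. Qed.

Lemma lin2 (d1 o1 d2 o2 d3 o3 u v : B) :
  d1 * (d2 * u + o2 * v) + o1 * (d3 * v + o3 * u) =
  (d1 * d2 + o1 * o3) * u + (d1 * o2 + o1 * d3) * v.
Proof. by rewrite !mulrDr !mulrDl !mulrA [o1 * d3 * v + _]addrC addrACA. Qed.

Lemma Qcomp_l a : \sum_d \sum_d' Q arr d d' (xcomp a a) (xcomp a.+1 a)
   * (ecomp a d a * ecomp a.+1 d' a) = sB a.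
Proof.
rewrite strand_B.unlock xcomp_self xcomp_succ (bigD1 c) //= [X in _ + X]big1 ?addr0 => [|d /negPf dc].
  by apply: eq_bigr => d' _; rewrite ecomp_self ecomp_succ eqxx mul1r.
by rewrite big1 // => d' _; rewrite ecomp_self dc mul0r mulr0.
Qed.

Lemma Qcomp_r a : \sum_d \sum_d' Q arr d d' (xcomp a a.+1) (xcomp a.+1 a.+1)
   * (ecomp a d a.+1 * ecomp a.+1 d' a.+1) = sB a.
Proof.
rewrite strand_B.unlock xcomp_self xcomp_pred; apply: eq_bigr => d _; rewrite (bigD1 c) //=.
rewrite big1 ?addr0 => [|d' /negPf dc]; last by rewrite ecomp_self dc !mulr0.
by rewrite ecomp_self ecomp_pred eqxx mulr1 Q_sym.
Qed.

Lemma sT_tt a : (a < N)%N ->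
  sT a * sT a = \sum_d \sum_d' Q arr d d' (sX a) (sX a.+1) * (sE a d * sE a.+1 d').
Proof.
move=> aN; rewrite sE_Q_pair; try lia.
apply: rend_ext => v k; have kN : (k <= N)%N by rewrite -ltnS.
rewrite rendE_mul sT_at sT_in // sT_in ?swp_le // swpK /= inord_val.
case: (eqVneq (k : nat) a) => [kE|ka]; last case: (eqVneq (k : nat) a.+1) => [kE|ka'].
- rewrite lin2 kE swp_l Dcomp_l Dcomp_r Ocomp_l Ocomp_r.
  by rewrite sQ_l // sQ_lr // mul0r addr0 Qcomp_l.
- rewrite lin2 kE swp_r Dcomp_l Dcomp_r Ocomp_l Ocomp_r.
  by rewrite sQ_r // sQ_rl // mul0r addr0 Qcomp_r.
rewrite Ocomp_far // mul0r !addr0 mul0r addr0 !Dcomp_far // mulrA (klr_tt R) ?unb_S_lt //.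
congr (_ * _); apply: eq_bigr => d _; apply: eq_bigr => d' _.
have [ak ak'] : a != k /\ a.+1 != k by rewrite eq_sym ka eq_sym.
by rewrite 2?ecomp_neq // 2?xcomp_neq // unb_S.
Qed.

Section FarCommutation.
Variables (p q : nat).
Hypotheses (pN : (p < N)%N) (qN : (q.+1 < N)%N) (pq : p != q) (pq' : p != q.+1).

Lemma comm_t_eps d : eps p d * t q = t q * eps p d.
Proof. by rewrite (klr_te R) // swp_id. Qed.
Lemma comm_t_sP : sP p * t q = t q * sP p.
Proof. by apply: sP_comm => //; [apply: g_t|apply: comm_t_eps]. Qed.
Lemma comm_t_sB : sB p * t q = t q * sB p.
Proof.
apply: sB_comm => // [||d]; [exact: y_t|by rewrite (klr_tx R)|exact: comm_t_eps].
Qed.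
Lemma comm_t_sA : sA p * t q = t q * sA p.
Proof. by apply: sA_comm => //; apply: comm_t_eps. Qed.
End FarCommutation.

Lemma comm_t_Dcomp a k q : (a < N)%N -> (q.+1 < N)%N -> a != q -> a != q.+1 ->
  (k == a) || (k == a.+1) -> Dcomp a k * t q = t q * Dcomp a k.
Proof.
move=> aN qN aq aq' /orP[] /eqP->; first by rewrite Dcomp_l mulNr mulrN comm_t_sP.
by rewrite Dcomp_r comm_t_sP.
Qed.
Lemma comm_t_Ocomp a k q : (a < N)%N -> (q.+1 < N)%N -> a != q -> a != q.+1 ->
  Ocomp a k * t q = t q * Ocomp a k.
Proof.
move=> aN qN aq aq'; rewrite /Ocomp; case: ifP => _.
  by rewrite mulrDl mulrDr comm_t_sP ?comm_t_sB.
by case: ifP => _; rewrite ?mul0r ?mulr0 // mulrBl mulrBr comm_t_sP ?comm_t_sA.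
Qed.

Lemma sT_tC a b : (a.+1 < b)%N -> (b < N)%N -> sT a * sT b = sT b * sT a.
Proof.
move=> ab bN; have aN : (a < N)%N by lia.
apply: rend_ext => v k; have kN : (k <= N)%N by rewrite -ltnS.
rewrite 2!rendE_mul [LHS]sT_at [RHS]sT_at.
rewrite (sT_in _ _ kN) (sT_in _ _ kN) (sT_in _ _ (swp_le aN kN)) (sT_in _ _ (swp_le bN kN)) inord_val.
have [ka|ka] := boolP (((k : nat) == a) || ((k : nat) == a.+1)).
  have [kb kb'] : (k : nat) != b /\ (k : nat) != b.+1 by split; apply/eqP; lia.
  have [sb sb'] : swp a k != b /\ swp a k != b.+1.
    by case/orP: ka => /eqP->; rewrite ?swp_l ?swp_r; split; apply/eqP; lia.
  rewrite !(Ocomp_far kb kb') !(Ocomp_far sb sb') !mul0r !addr0 !(Dcomp_far kb kb') !(Dcomp_far sb sb').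
  have [-> ->] : unb k b = b.-1 /\ unb (swp a k) b = b.-1.
    by case/orP: ka => /eqP->; rewrite ?swp_l ?swp_r /unb; split; case: ifP; lia.
  rewrite mulrDr !mulrA comm_t_Dcomp ?comm_t_Ocomp //; try lia; try (by apply/eqP; lia).
move: ka; rewrite negb_or => /andP[ka ka'].
rewrite !(Ocomp_far ka ka') !mul0r !addr0 !(Dcomp_far ka ka').
have [kb|kb] := boolP (((k : nat) == b) || ((k : nat) == b.+1)).
  have [sa sa'] : swp b k != a /\ swp b k != a.+1.
    by case/orP: kb => /eqP->; rewrite ?swp_l ?swp_r; split; apply/eqP; lia.
  rewrite !(Ocomp_far sa sa') !mul0r !addr0 !(Dcomp_far sa sa').
  have [-> ->] : unb k a = a /\ unb (swp b k) a = a.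
    by case/orP: kb => /eqP->; rewrite ?swp_l ?swp_r /unb; split; case: ifP; lia.
  rewrite mulrDr !mulrA comm_t_Dcomp ?comm_t_Ocomp //; try lia; try (by apply/eqP; lia).
move: kb; rewrite negb_or => /andP[kb kb'].
rewrite !(Ocomp_far kb kb') !mul0r !addr0 !(Dcomp_far kb kb') !mulrA (klr_tC R) //.
  by move: ka ka' kb kb'; rewrite /unb; do 2!(case: ifP => ?); lia.
exact: unb_S_lt.
Qed.

Section BraidEntries.
Variable a : nat.
Hypothesis aN : (a.+1 < N)%N.
Let aN' : (a < N)%N. Proof. lia. Qed.
Local Notation f := (two eps a).
Local Notation P0 := (sP a).
Local Notation P1 := (sP a.+1).
Local Notation B0 := (sB a).
Local Notation B1 := (sB a.+1).
Local Notation A0 := (sA a).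
Local Notation A1 := (sA a.+1).
Local Notation ta := (t a).

Lemma eq_on_f u v : (forall d d', u * (f d d' * 1) = v * (f d d' * 1)) -> u = v.
Proof. by move=> uv; apply: (eq_on_two R aN) => d d'; have := uv d d'; rewrite !mulr1. Qed.

(** The entries of the braid relation are compared after multiplication by the
    idempotent f of the old letters at a and a + 1.  The rules move f to the left
    and evaluate P, A and B on it; then f absorbs every correction term. *)
Definition f_rules := (sP_l aN, sP_r aN, sB_l aN, sB_r aN, sA_l aN, sA_r aN, t_f aN).

Lemma Q_cc u v : Q arr c c u v = 0 :> B.
Proof. by rewrite /Q (negPf (arrI c)) eqxx. Qed.

Ltac fw := rewrite ?mul0r; rewrite !(mulrDl, mulrBl, mulNr, mulrDr, mulrBr, mulrN) -!mulrA.
Lemma slope_cc i : slope arr B i i = 0. Proof. exact: subrr. Qed.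

Lemma twoE b b' : eps a b * eps a.+1 b' = f b b'. Proof. by rewrite two.unlock. Qed.

Lemma sum_slope_l d d' z : (\sum_b slope arr B c b * (eps a b * eps a.+1 c)) * (f d d' * z)
   = if d' == c then slope arr B c d * (f d d' * z) else 0.
Proof.
rewrite mulrA mulr_suml; have E b : slope arr B c b * (eps a b * eps a.+1 c) * f d d'
   = if (b == d) && (c == d') then slope arr B c b * f d d' else 0.
  rewrite twoE -mulrA (two_mul R aN); case: ifP => [/andP[/eqP-> /eqP->]|] //.
  by rewrite mulr0.
rewrite (bigD1 d) //= big1 ?addr0 => [|b /negPf bd]; last by rewrite E bd.
by rewrite E eqxx eq_sym /=; case: ifP; rewrite ?mul0r // mulrA.
Qed.

Lemma sum_slope_r d d' z : (\sum_b slope arr B c b * (eps a c * eps a.+1 b)) * (f d d' * z)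
   = if d == c then slope arr B c d' * (f d d' * z) else 0.
Proof.
rewrite mulrA mulr_suml; have E b : slope arr B c b * (eps a c * eps a.+1 b) * f d d'
   = if (c == d) && (b == d') then slope arr B c b * f d d' else 0.
  rewrite twoE -mulrA (two_mul R aN); case: ifP => [/andP[/eqP-> /eqP->]|] //.
  by rewrite mulr0.
rewrite (bigD1 d') //= big1 ?addr0 => [|b /negPf bd]; last by rewrite E bd andbF.
by rewrite E eqxx andbT eq_sym /=; case: ifP; rewrite ?mul0r // mulrA.
Qed.

Lemma sum_slope_m d d' z : (\sum_b slope arr B b c * (eps a b * eps a.+1 b)) * (f d d' * z)
   = if d == d' then slope arr B d c * (f d d' * z) else 0.
Proof.
rewrite mulrA mulr_suml; have E b : slope arr B b c * (eps a b * eps a.+1 b) * f d d'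
   = if (b == d) && (b == d') then slope arr B b c * f d d' else 0.
  rewrite twoE -mulrA (two_mul R aN); case: ifP => [/andP[/eqP <- /eqP <-]|] //.
  by rewrite mulr0.
rewrite (bigD1 d) //= big1 ?addr0 => [|b /negPf bd]; last by rewrite E bd.
by rewrite E eqxx /=; case: ifP; rewrite ?mul0r // mulrA.
Qed.

Ltac fz := do 14? [progress rewrite ?(f_tgl aN) ?(f_tgr aN) ?(f_tQl aN) ?(f_tQr aN) ?(f_tt aN)
  ?(f_g aN _ _ _ aN') ?(f_g aN _ _ _ aN) ?(f_Q aN _ _ _ _ aN') ?(f_Q aN _ _ _ _ aN) ?eqxx ?mulr0 ?mul0r ?Q_cc ?slope_cc ?oppr0 ?addr0 ?add0r ?subr0 ?sub0r ?mulrBr ?mulrDr ?mulrN ?opprK].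
Ltac fr := do 12? [progress rewrite ?f_rules ?eqxx ?mulr0 ?mul0r ?Q_cc ?slope_cc ?oppr0 ?addr0 ?add0r ?subr0 ?sub0r].

Lemma gg z : g a * (g a.+1 * z) = g a.+1 * (g a * z).
Proof. by rewrite mulrA g_g // -mulrA. Qed.

Lemma QQ i i' z : Q arr c i y (x a.+1) * (Q arr c i' y (x a) * z)
  = Q arr c i' y (x a) * (Q arr c i y (x a.+1) * z).
Proof.
have xx : x a.+1 * x a = x a * x a.+1 by apply: (klr_xC R).
rewrite !mulrA; congr (_ * _); by apply: Q_comm; apply/esym/Q_comm; rewrite ?y_x.
Qed.

Lemma slope_comm i j u z : u * (slope arr B i j * z) = slope arr B i j * (u * z).
Proof.
rewrite !mulrA; congr (_ * _); rewrite /slope mulrBl mulrBr.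
by rewrite -!natr_comm.
Qed.

Lemma slope_anti i j : slope arr B i j = - slope arr B j i.
Proof. by rewrite /slope opprB. Qed.

(** The two places where the braid relation between the new strand and two old
    ones needs its right-hand side. *)
Lemma slope_end_l d z : d != c ->
  - (g a.+1 * (f d c * (Q arr d c (x a) (x a.+1) * z))) + g a.+1 * (Q arr c d y (x a) * (f d c * z))
  = slope arr B c d * (f d c * z).
Proof.
move=> dc; rewrite addrC -mulrBr.
have -> : f d c * (Q arr d c (x a) (x a.+1) * z) = Q arr d c (x a) (x a.+1) * (f d c * z).
  by rewrite !mulrA; congr (_ * _); apply/esym/Q_comm; apply: (x_two R).
rewrite -mulrBl slope_g_l // -mulrA slope_comm.
by rewrite [g a.+1 * _]mulrA gl // mul1r.
Qed.

Lemma slope_end_r d z :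
  g a * (Q arr c d y (x a.+1) * (f c d * z)) - g a * (f c d * (Q arr c d (x a) (x a.+1) * z))
  = slope arr B c d * (f c d * z).
Proof.
rewrite -mulrBr.
have -> : f c d * (Q arr c d (x a) (x a.+1) * z) = Q arr c d (x a) (x a.+1) * (f c d * z).
  by rewrite !mulrA; congr (_ * _); apply/esym/Q_comm; apply: (x_two R).
rewrite -mulrBl slope_g_r // -mulrA slope_comm.
by rewrite [g a * _]mulrA gl // mul1r.
Qed.

Ltac fc := rewrite ?slope_comm ?(Q_g _ _ aN' aN) ?(Q_g _ _ aN aN') ?(Q_g _ _ aN aN) ?(Q_g _ _ aN' aN') ?QQ ?gg.

Ltac entry ne := fw; rewrite ?sum_slope_l ?sum_slope_r ?sum_slope_m;
  do 5 (fr; rewrite ?ne); do 5 (fz; rewrite ?ne); fc; rewrite ?subrr ?addNr.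

(** P, A and B only distinguish c from the other colours, and the crossing of the
    two old strands only asks whether their colours agree: five cases. *)
Lemma two_cases u v :
  u * (f c c * 1) = v * (f c c * 1) ->
  (forall d, ((d == c) = false) * ((c == d) = false) -> u * (f c d * 1) = v * (f c d * 1)) ->
  (forall d, ((d == c) = false) * ((c == d) = false) -> u * (f d c * 1) = v * (f d c * 1)) ->
  (forall d, (d == c) = false -> u * (f d d * 1) = v * (f d d * 1)) ->
  (forall d d',
    ((d == c) = false) * ((d' == c) = false) * ((d == d') = false) * ((d' == d) = false) ->
    u * (f d d' * 1) = v * (f d d' * 1)) -> u = v.
Proof.
move=> Ecc Ecd Edc Edd E; apply: eq_on_f => d d'.
have [->|/negPf dc] := eqVneq d c; have [->|/negPf d'c] := eqVneq d' c => //.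
- by apply: Ecd; rewrite d'c eq_sym d'c.
- by apply: Edc; rewrite dc eq_sym dc.
have [<-|/negPf dd] := eqVneq d d'; first exact: Edd.
by apply: E; rewrite dc d'c dd eq_sym dd.
Qed.

(** The nine entries of the braid relation at the copies a, a + 1 and a + 2, where
    the new strand meets two adjacent old strands: entry ij is the contribution of
    copy a + j to copy a + i.  The off-diagonal entries vanish and the diagonal
    ones give the slopes. *)
Lemma ent01 : - (ta * (P0 + B0) * P1) + (P0 * ta * (P0 + B0) + (P0 + B0) * P1 * P0) = 0.
Proof.
by apply: two_cases => [|d ne|d ne|d ne|d d' ne];
  [entry (eqxx c); rewrite addrK subrK addNr|entry ne|entry ne|entry ne|entry ne].
Qed.

Lemma ent02 : ta * (P0 + B0) * (P1 + B1) - (P0 + B0) * (P1 + B1) * ta = 0.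
Proof.
by apply: two_cases => [|d ne|d ne|d ne|d d' ne];
  [entry (eqxx c); rewrite addrK subrr|entry ne|entry ne|entry ne; rewrite subrK subrr|entry ne].
Qed.

Lemma ent10 : - (P1 * (A0 - P0) * ta) + ((A0 - P0) * ta * P0 + P0 * P1 * (A0 - P0)) = 0.
Proof.
by apply: two_cases => [|d ne|d ne|d ne|d d' ne];
  [entry (eqxx c); rewrite opprB addrAC subrr sub0r subrr|entry ne|entry ne|entry ne|entry ne].
Qed.

Lemma ent11 : P1 * P0 * P1 + (P1 + B1) * ta * (A1 - P1) - ((A0 - P0) * ta * (P0 + B0) - P0 * P1 * P0) = \sum_d slope arr B d c * (eps a d * eps a.+1 d).
Proof.
by apply: two_cases => [|d ne|d ne|d ne|d d' ne];
  [entry (eqxx c); rewrite opprB opprK [X in _ + X]addrC subrK opprD addrA addrAC subrK subrr|entry ne|entry ne|entry ne; rewrite opprD addrA subrr sub0r -mulNr -slope_anti|entry ne].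
Qed.

Lemma ent12 : (P1 + B1) * ta * P1 - P1 * P0 * (P1 + B1) - P0 * (P1 + B1) * ta = 0.
Proof.
by apply: two_cases => [|d ne|d ne|d ne|d d' ne];
  [entry (eqxx c); rewrite addrK subrr|entry ne|entry ne|entry ne|entry ne].
Qed.

Lemma ent20 : (A1 - P1) * (A0 - P0) * ta - ta * (A1 - P1) * (A0 - P0) = 0.
Proof.
by apply: two_cases => [|d ne|d ne|d ne|d d' ne];
  [entry (eqxx c); rewrite subrK subrr|entry ne|entry ne|entry ne|entry ne].
Qed.

Lemma ent21 : P1 * ta * (A1 - P1) - (A1 - P1) * P0 * P1 - ta * (A1 - P1) * P0 = 0.
Proof.
by apply: two_cases => [|d ne|d ne|d ne|d d' ne];
  [entry (eqxx c); rewrite subrK opprD subrK addNr|entry ne|entry ne|entry ne|entry ne].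
Qed.

Lemma ent22 : (A1 - P1) * P0 * (P1 + B1) + P1 * ta * P1 - ta * P1 * ta = \sum_d slope arr B c d * (eps a c * eps a.+1 d).
Proof.
by apply: two_cases => [|d ne|d ne|d ne|d d' ne];
  [entry (eqxx c); rewrite [- _ + _]addrC addrK subrr|entry ne; rewrite slope_end_r|entry ne|entry ne|entry ne].
Qed.

Lemma ent00 : - (ta * P0 * ta) + (P0 + B0) * P1 * (A0 - P0) - P0 * ta * P0 = \sum_d slope arr B c d * (eps a d * eps a.+1 c).
Proof.
by apply: two_cases => [|d ne|d ne|d ne|d d' ne];
  [entry (eqxx c)|entry ne|entry ne; rewrite slope_end_l // ne|entry ne|entry ne].
Qed.

End BraidEntries.

Lemma slope_rend (T : Type) d d' :
  slope arr (rend T B) d d' = rend_diag (fun=> slope arr B d d').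
Proof. by rewrite /slope !rend_diag_nat rend_diagB. Qed.

Lemma sE_slope_triple p q r :
  \sum_d \sum_d' slope arr (rend 'I_N.+1 B) d d' * (sE p d * sE q d' * sE r d)
  = @rend_diag 'I_N.+1 B (fun k => \sum_d \sum_d'
      slope arr B d d' * (ecomp p d k * ecomp q d' k * ecomp r d k)).
Proof.
rewrite -rend_diag_sum; apply: eq_bigr => d _.
rewrite -rend_diag_sum; apply: eq_bigr => d' _.
by rewrite slope_rend !rend_diagM.
Qed.

Section BraidRows.
Variables (a : nat).
Hypothesis aN : (a.+1 < N)%N.
Let aN' : (a < N)%N. Proof. lia. Qed.

Lemma row0l v : sT a v (inord a) = - sP a * v (inord a) + (sP a + sB a) * v (inord a.+1).
Proof. by rewrite sT_in ?Dcomp_l ?Ocomp_l ?swp_l //; lia. Qed.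
Lemma row1l v : sT a v (inord a.+1) = (sA a - sP a) * v (inord a) + sP a * v (inord a.+1).
Proof. by rewrite sT_in ?Dcomp_r ?Ocomp_r ?swp_r 1?addrC //; lia. Qed.
Lemma row2l v : sT a v (inord a.+2) = t a * v (inord a.+2).
Proof.
have [n1 n2] : a.+2 != a /\ a.+2 != a.+1 by split; apply/eqP; lia.
rewrite sT_in // Dcomp_far // Ocomp_far // mul0r addr0 /unb.
by case: ifP => //; lia.
Qed.
Lemma row0r v : sT a.+1 v (inord a) = t a * v (inord a).
Proof.
have [n1 n2] : a != a.+1 /\ a != a.+2 by split; apply/eqP; lia.
rewrite sT_in ?Dcomp_far ?Ocomp_far // ?mul0r ?addr0 /unb; last by lia.
by case: ifP => //; lia.
Qed.
Lemma row1r v : sT a.+1 v (inord a.+1)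
  = - sP a.+1 * v (inord a.+1) + (sP a.+1 + sB a.+1) * v (inord a.+2).
Proof. by rewrite sT_in ?Dcomp_l ?Ocomp_l ?swp_l //; lia. Qed.
Lemma row2r v : sT a.+1 v (inord a.+2)
  = (sA a.+1 - sP a.+1) * v (inord a.+1) + sP a.+1 * v (inord a.+2).
Proof. by rewrite sT_in ?Dcomp_r ?Ocomp_r ?swp_r 1?addrC //; lia. Qed.
End BraidRows.

Section Linear3.
Variables u0 u1 u2 : B.
Definition lc c0 c1 c2 : B := c0 * u0 + c1 * u1 + c2 * u2.
Lemma lc0 : u0 = lc 1 0 0. Proof. by rewrite /lc mul1r !mul0r !addr0. Qed.
Lemma lc1 : u1 = lc 0 1 0. Proof. by rewrite /lc mul1r !mul0r add0r addr0. Qed.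
Lemma lc2 : u2 = lc 0 0 1. Proof. by rewrite /lc mul1r !mul0r !add0r. Qed.
Lemma lcM z c0 c1 c2 : z * lc c0 c1 c2 = lc (z * c0) (z * c1) (z * c2).
Proof. by rewrite /lc !mulrDr !mulrA. Qed.
Lemma lcD c0 c1 c2 d0 d1 d2 : lc c0 c1 c2 + lc d0 d1 d2 = lc (c0 + d0) (c1 + d1) (c2 + d2).
Proof. by rewrite /lc !mulrDl addrACA; congr (_ + _); rewrite addrACA. Qed.
Lemma lcB c0 c1 c2 d0 d1 d2 : lc c0 c1 c2 - lc d0 d1 d2 = lc (c0 - d0) (c1 - d1) (c2 - d2).
Proof. by rewrite /lc !mulrBl !opprD addrACA; congr (_ + _); rewrite addrACA. Qed.
End Linear3.

(** Linear combinations of three vectors with coefficients on the left, made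
    opaque so that identities can be compared coefficient by coefficient. *)
Lemma linear3 (u0 u1 u2 : B) : exists l : B -> B -> B -> B,
  [/\ [/\ u0 = l 1 0 0, u1 = l 0 1 0 & u2 = l 0 0 1],
      forall z c0 c1 c2, z * l c0 c1 c2 = l (z * c0) (z * c1) (z * c2),
      forall c0 c1 c2 d0 d1 d2, l c0 c1 c2 + l d0 d1 d2 = l (c0 + d0) (c1 + d1) (c2 + d2) &
      forall c0 c1 c2 d0 d1 d2, l c0 c1 c2 - l d0 d1 d2 = l (c0 - d0) (c1 - d1) (c2 - d2)].
Proof.
exists (lc u0 u1 u2); split; [split; [exact: lc0|exact: lc1|exact: lc2]| | |].
- exact: lcM.
- exact: lcD.
- exact: lcB.
Qed.

Section BraidRowIdentities.
Variable a : nat.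
Hypothesis aN : (a.+1 < N)%N.
Local Notation P0 := (sP a).
Local Notation P1 := (sP a.+1).
Local Notation B0 := (sB a).
Local Notation B1 := (sB a.+1).
Local Notation A0 := (sA a).
Local Notation A1 := (sA a.+1).
Local Notation ta := (t a).
Variables u0 u1 u2 : B.

Let m3 (u v w : B) : u * v * w = u * (v * w) := esym (mulrA u v w).
Let ent00' := (ltac:(have E := ent00 aN; rewrite ?m3 in E; exact: E)).
Let ent01' := (ltac:(have E := ent01 aN; rewrite ?m3 in E; exact: E)).
Let ent02' := (ltac:(have E := ent02 aN; rewrite ?m3 in E; exact: E)).
Let ent10' := (ltac:(have E := ent10 aN; rewrite ?m3 in E; exact: E)).
Let ent11' := (ltac:(have E := ent11 aN; rewrite ?m3 in E; exact: E)).
Let ent12' := (ltac:(have E := ent12 aN; rewrite ?m3 in E; exact: E)).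
Let ent20' := (ltac:(have E := ent20 aN; rewrite ?m3 in E; exact: E)).
Let ent21' := (ltac:(have E := ent21 aN; rewrite ?m3 in E; exact: E)).
Let ent22' := (ltac:(have E := ent22 aN; rewrite ?m3 in E; exact: E)).

Lemma braid_row0 :
  ta * (- P0 * (ta * u0) + (P0 + B0) * (- P1 * u1 + (P1 + B1) * u2))
  - (- P0 * (ta * (- P0 * u0 + (P0 + B0) * u1))
     + (P0 + B0) * (- P1 * ((A0 - P0) * u0 + P0 * u1) + (P1 + B1) * (ta * u2)))
  = (\sum_d slope arr B c d * (eps a d * eps a.+1 c)) * u0.
Proof.
have [l [[-> -> ->] lM lD lB]] := linear3 u0 u1 u2.
rewrite !(lM, lD, lB) !(mulr0, mulr1, addr0, add0r, subr0, sub0r).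
rewrite ?(mulNr, mulrN, opprK, oppr0, addr0, add0r, subr0, sub0r).
by congr (l _ _ _); [rewrite opprB addrA ent00' | rewrite opprD !opprK ent01' | exact: ent02'].
Qed.

Lemma braid_row1 :
  - P1 * ((A0 - P0) * (ta * u0) + P0 * (- P1 * u1 + (P1 + B1) * u2))
  + (P1 + B1) * (ta * ((A1 - P1) * u1 + P1 * u2))
  - ((A0 - P0) * (ta * (- P0 * u0 + (P0 + B0) * u1))
     + P0 * (- P1 * ((A0 - P0) * u0 + P0 * u1) + (P1 + B1) * (ta * u2)))
  = (\sum_d slope arr B d c * (eps a d * eps a.+1 d)) * u1.
Proof.
have [l [[-> -> ->] lM lD lB]] := linear3 u0 u1 u2.
rewrite !(lM, lD, lB) !(mulr0, mulr1, addr0, add0r, subr0, sub0r).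
rewrite ?(mulNr, mulrN, opprK, oppr0, addr0, add0r, subr0, sub0r).
by congr (l _ _ _); [rewrite opprD !opprK ent10' | exact: ent11' | rewrite [- _ + _]addrC ent12'].
Qed.

Lemma braid_row2 :
  (A1 - P1) * ((A0 - P0) * (ta * u0) + P0 * (- P1 * u1 + (P1 + B1) * u2))
  + P1 * (ta * ((A1 - P1) * u1 + P1 * u2))
  - ta * ((A1 - P1) * ((A0 - P0) * u0 + P0 * u1) + P1 * (ta * u2))
  = (\sum_d slope arr B c d * (eps a c * eps a.+1 d)) * u2.
Proof.
have [l [[-> -> ->] lM lD lB]] := linear3 u0 u1 u2.
rewrite !(lM, lD, lB) !(mulr0, mulr1, addr0, add0r, subr0, sub0r).
rewrite ?(mulNr, mulrN, opprK, oppr0, addr0, add0r, subr0, sub0r).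
by congr (l _ _ _); [exact: ent20' | rewrite [- _ + _]addrC ent21' | exact: ent22'].
Qed.
End BraidRowIdentities.

Lemma diag0 a : (a.+1 < N)%N -> \sum_d \sum_d' slope arr B d d' * (ecomp a d a * ecomp a.+1 d' a * ecomp a.+2 d a)
  = \sum_d slope arr B c d * (eps a d * eps a.+1 c).
Proof.
move=> aN; rewrite (bigD1 c) //= [X in _ + X]big1 ?addr0; last first.
  move=> d /negPf dc; apply: big1 => d' _.
  by rewrite /ecomp eqxx dc !mul0r mulr0.
apply: eq_bigr => d _; rewrite /ecomp !eqxx mul1r.
have [n1 n2] : (a.+1 == a) = false /\ (a.+2 == a) = false by split; apply/eqP; lia.
by rewrite n1 n2 /unb; case: ifP; case: ifP => //; lia.
Qed.

Lemma diag1 a : (a.+1 < N)%N -> \sum_d \sum_d' slope arr B d d' * (ecomp a d a.+1 * ecomp a.+1 d' a.+1 * ecomp a.+2 d a.+1)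
  = \sum_d slope arr B d c * (eps a d * eps a.+1 d).
Proof.
move=> aN; apply: eq_bigr => d _; rewrite (bigD1 c) //= [X in _ + X]big1 ?addr0; last first.
  by move=> d' /negPf dc; rewrite /ecomp eqxx dc mulr0 mul0r mulr0.
rewrite /ecomp !eqxx mulr1.
have [n1 n2] : (a == a.+1) = false /\ (a.+2 == a.+1) = false by split; apply/eqP; lia.
by rewrite n1 n2 /unb; case: ifP; case: ifP => //; lia.
Qed.

Lemma diag2 a : (a.+1 < N)%N -> \sum_d \sum_d' slope arr B d d' * (ecomp a d a.+2 * ecomp a.+1 d' a.+2 * ecomp a.+2 d a.+2)
  = \sum_d slope arr B c d * (eps a c * eps a.+1 d).
Proof.
move=> aN; rewrite (bigD1 c) //= [X in _ + X]big1 ?addr0; last first.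
  move=> d /negPf dc; apply: big1 => d' _.
  by rewrite /ecomp eqxx dc !mulr0.
apply: eq_bigr => d _; rewrite /ecomp !eqxx mulr1.
have [n1 n2] : (a == a.+2) = false /\ (a.+1 == a.+2) = false by split; apply/eqP; lia.
by rewrite n1 n2 /unb; case: ifP; case: ifP => //; lia.
Qed.

Lemma sT_braid a : (a.+1 < N)%N ->
  sT a.+1 * sT a * sT a.+1 - sT a * sT a.+1 * sT a =
  \sum_d \sum_d' slope arr (rend 'I_N.+1 B) d d' * (sE a d * sE a.+1 d' * sE a.+2 d).
Proof.
move=> aN; rewrite sE_slope_triple; apply: rend_ext => v k.
have kN : (k <= N)%N by rewrite -ltnS.
rewrite rendE_sub !rendE_mul.
have rows := (row0l aN, row1l aN, row2l aN, row0r aN, row1r aN, row2r aN).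
have D3 j : rend_diag (fun k : 'I_N.+1 => \sum_d \sum_d'
      slope arr B d d' * (ecomp a d k * ecomp a.+1 d' k * ecomp a.+2 d k)) v j =
   (\sum_d \sum_d' slope arr B d d' * (ecomp a d j * ecomp a.+1 d' j * ecomp a.+2 d j)) * v j.
  by [].
rewrite D3 {D3}.
have ni (i j : nat) : i <> j -> (i == j) = false by case: eqP.
case: (eqVneq (k : nat) a) => [kE|ka].
  have -> : k = inord a by rewrite -kE inord_val.
  rewrite inordK ?ltnS -?kE // kE diag0 //.
  by rewrite !rows braid_row0.
case: (eqVneq (k : nat) a.+1) => [kE|ka'].
  have -> : k = inord a.+1 by rewrite -kE inord_val.
  rewrite inordK ?ltnS -?kE // kE diag1 //.
  by rewrite !rows braid_row1.
case: (eqVneq (k : nat) a.+2) => [kE|ka''].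
  have -> : k = inord a.+2 by rewrite -kE inord_val.
  rewrite inordK ?ltnS -?kE // kE diag2 //.
  by rewrite !rows braid_row2.
have Tl u : sT a u k = t (unb k a) * u k.
  by rewrite sT_at Dcomp_far // Ocomp_far // mul0r addr0 inord_val.
have Tr u : sT a.+1 u k = t (unb k a.+1) * u k.
  by rewrite sT_at Dcomp_far // Ocomp_far // mul0r addr0 inord_val.
rewrite !(Tl, Tr) !mulrA -mulrBl (unb_S ka ka'); congr (_ * _).
have bN : ((unb k a).+2 < N)%N by rewrite /unb; case: ifP; lia.
rewrite (klr_braid R bN); apply: eq_bigr => d _; apply: eq_bigr => d' _.
have [/negPf n0 [/negPf n1 /negPf n2]] : (a : nat) != k /\ a.+1 != k /\ a.+2 != k.
  by rewrite eq_sym ka eq_sym ka' eq_sym ka''.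
by rewrite /ecomp n0 n1 n2 (unb_S ka' ka'') (unb_S ka ka').
Qed.

(** All relations but the braid relation involve a single crossing, or two that are
    far apart, hence at most one old strand meeting the new one. *)
Lemma strand_klr : klr arr N.+1 sE sX sT.
Proof.
split.
- move=> p d d' pN; rewrite rend_diagM; case: ifP => dd; last first.
    by rewrite -rend_diag0; apply: rend_diag_ext => k; rewrite ecomp_ee // dd.
  by apply: rend_diag_ext => k; rewrite ecomp_ee // dd.
- move=> p pN; rewrite rend_diag_sum -rend_diag1; apply: rend_diag_ext => k.
  exact: ecomp_sum.
- move=> p q d d' pN qN; rewrite !rend_diagM; apply: rend_diag_ext => k.
  exact: ecomp_eC.
- move=> p q pN qN; rewrite !rend_diagM; apply: rend_diag_ext => k.
  exact: xcomp_xC.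
- move=> p q d pN qN; rewrite !rend_diagM; apply: rend_diag_ext => k.
  exact: xcomp_ecomp.
- by move=> a p d aN pN; apply: sT_te.
- by move=> a p aN pN; apply: sT_tx.
- by move=> a aN; apply: sT_txr.
- by move=> a aN; apply: sT_txl.
- by move=> a aN; apply: sT_tt.
- by move=> a b ab bN; apply: sT_tC.
- by move=> a aN; apply: sT_braid.
Qed.
End Strand.

(** * Symmetric elements of the torus *)

Section CommutingProducts.
Variable B : pzRingType.

Lemma prod_comm k (F : nat -> B) z :
  (forall p, (p < k)%N -> z * F p = F p * z) -> z * \prod_(p < k) F p = \prod_(p < k) F p * z.
Proof.
elim: k => [|k IH] zF; first by rewrite big_ord0 mulr1 mul1r.
rewrite big_ord_recr /= mulrA IH => [|p pk]; last by apply: zF; lia.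
by rewrite -!mulrA zF.
Qed.

Lemma prod_split k (F H : nat -> B) :
  (forall p q, (p < k)%N -> (q < k)%N -> H p * F q = F q * H p) ->
  \prod_(p < k) (F p * H p) = \prod_(p < k) F p * \prod_(p < k) H p.
Proof.
elim: k => [|k IH] C; first by rewrite !big_ord0 mulr1.
rewrite !big_ord_recr /= IH => [|p q *]; last by apply: C; lia.
rewrite -!mulrA; congr (_ * _); rewrite !mulrA; congr (_ * _).
by rewrite [RHS]prod_comm // => p pk; rewrite C //; lia.
Qed.

End CommutingProducts.

Section Weight.
Variables (I : finType) (arr : rel I) (B : pzRingType) (N : nat).
Variables (eps : nat -> I -> B) (x t : nat -> B).
Hypothesis arrI : forall i, ~~ arr i i.
Hypothesis arrN : forall i j, arr i j -> ~~ arr j i.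
Hypothesis R : klr arr N eps x t.
Variables (c : I) (y : B) (g : nat -> B).
Hypothesis y_eps : forall p d, (p < N)%N -> y * eps p d = eps p d * y.
Hypothesis y_x : forall p, (p < N)%N -> y * x p = x p * y.
Hypothesis y_t : forall a, (a.+1 < N)%N -> y * t a = t a * y.
Hypothesis gl : forall p, (p < N)%N -> g p * (y - x p) = 1.
Hypothesis gr : forall p, (p < N)%N -> (y - x p) * g p = 1.

(** The subring containing all coefficients of the inserted strand; its generators
    commute, which makes the products below independent of the order. *)
Inductive torus : B -> Prop :=
| torus_eps p d of (p < N)%N : torus (eps p d)
| torus_x p of (p < N)%N : torus (x p)
| torus_y : torus y
| torus_g p of (p < N)%N : torus (g p)
| torus1 : torus 1
| torusB u v of torus u & torus v : torus (u - v)
| torusM u v of torus u & torus v : torus (u * v).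

Lemma torus0 : torus 0. Proof. by rewrite -(subrr 1); apply: torusB; apply: torus1. Qed.
Lemma torusN u : torus u -> torus (- u).
Proof. by move=> ?; rewrite -sub0r; apply: torusB => //; apply: torus0. Qed.
Lemma torusD u v : torus u -> torus v -> torus (u + v).
Proof. by move=> ? ?; rewrite -[v]opprK; apply: torusB => //; apply: torusN. Qed.
Lemma torus_sum (J : finType) (F : J -> B) : (forall j, torus (F j)) -> torus (\sum_j F j).
Proof. by move=> tF; elim/big_rec: _ => [|j u _ tu]; [exact: torus0|apply: torusD]. Qed.
Lemma torus_nat n : torus n%:R.
Proof. by elim: n => [|n IH]; [exact: torus0|rewrite -addn1 natrD; apply: torusD => //; exact: torus1]. Qed.

Lemma torus_prod k (F : nat -> B) : (forall p, (p < k)%N -> torus (F p)) -> torus (\prod_(p < k) F p).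
Proof.
elim: k => [|k IH] tF; first by rewrite big_ord0; apply: torus1.
by rewrite big_ord_recr; apply: torusM; [apply: IH => p pk; apply: tF; lia|apply: tF].
Qed.

Lemma torus_comm u v : torus u -> torus v -> u * v = v * u.
Proof.
move=> tu tv; elim: tu => [p d pN|p pN||p pN||u1 u2 _ IH1 _ IH2|u1 u2 _ IH1 _ IH2]; last 3 first.
- by rewrite mul1r mulr1.
- by rewrite mulrBl mulrBr IH1 IH2.
- by rewrite -mulrA IH2 !mulrA IH1.
all: elim: tv => [q d' qN|q qN||q qN||v1 v2 _ IH1 _ IH2|v1 v2 _ IH1 _ IH2];
  try by rewrite ?mulr1 ?mul1r // mulrBl mulrBr IH1 IH2.
all: try by rewrite mulrA IH1 -!mulrA IH2.
- exact: (klr_eC R).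
- by rewrite (klr_xe R).
- by rewrite y_eps.
- by rewrite (g_eps R y_eps gl gr).
- by rewrite (klr_xe R).
- exact: (klr_xC R).
- by rewrite y_x.
- by rewrite (g_x R y_x gl gr).
- by rewrite y_eps.
- by rewrite y_x.
- by rewrite (g_y y_x gl gr).
- by rewrite (g_eps R y_eps gl gr).
- by rewrite (g_x R y_x gl gr).
- by rewrite (g_y y_x gl gr).
- by rewrite (g_g R y_x gl gr).
Qed.

(** The element of the torus equal to w d p on the letter d at position p. *)
Definition weighted (w : I -> nat -> B) p := \sum_d w d p * eps p d.

Definition tame (w : I -> nat -> B) := forall d p, (p < N)%N -> torus (w d p).

Lemma torus_weighted w p : tame w -> (p < N)%N -> torus (weighted w p).
Proof. by move=> tw pN; apply: torus_sum => d; apply: torusM; [apply: tw|apply: torus_eps]. Qed.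

Lemma weighted_eps w p d : (p < N)%N -> weighted w p * eps p d = w d p * eps p d.
Proof.
move=> pN; rewrite mulr_suml (bigD1 d) //= -mulrA (klr_ee R) // eqxx big1 ?addr0 //.
by move=> b /negPf bd; rewrite -mulrA (klr_ee R) // bd mulr0.
Qed.

Lemma weightedM w w' p : tame w -> tame w' -> (p < N)%N ->
  weighted w p * weighted w' p = weighted (fun d p => w d p * w' d p) p.
Proof.
move=> tw tw' pN; rewrite {2}/weighted mulr_sumr; apply: eq_bigr => d _.
rewrite [w' d p * _](@torus_comm _ (eps p d)); [|exact: tw'|exact: torus_eps].
rewrite mulrA weighted_eps // -!mulrA; congr (_ * _).
by apply: torus_comm; [exact: torus_eps|exact: tw'].
Qed.

(** The condition under which the two values u_a and u_(a+1) may be moved through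
    the crossing t_a: they are exchanged between different letters, and their
    product is preserved. *)
Definition exchanges a (u : nat -> B) :=
  [/\ forall d d' z, d != d' -> two eps a d d' * (t a * (u a * z)) = two eps a d d' * (u a.+1 * (t a * z)),
      forall d d' z, d != d' -> two eps a d d' * (t a * (u a.+1 * z)) = two eps a d d' * (u a * (t a * z)) &
      t a * (u a * u a.+1) = u a * u a.+1 * t a].

Section Crossing.
Variable a : nat.
Hypothesis aN : (a.+1 < N)%N.
Let aN' : (a < N)%N. Proof. lia. Qed.

Let tw d d' : torus (two eps a d d').
Proof. by rewrite two.unlock; apply: torusM; apply: torus_eps. Qed.

Lemma exchangesM u v : torus (u a) -> torus (u a.+1) -> torus (v a) ->
  exchanges a u -> exchanges a v -> exchanges a (fun p => u p * v p).
Proof.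
move=> tu0 tu1 tv [u1 u2 u3] [v1 v2 v3]; split=> [d d' z dd|d d' z dd|].
- rewrite -!mulrA u1 // [LHS]mulrA (torus_comm (tw d d') tu1) -mulrA v1 //.
  by rewrite [LHS]mulrA -(torus_comm (tw d d') tu1) -mulrA.
- rewrite -!mulrA u2 // [LHS]mulrA (torus_comm (tw d d') tu0) -mulrA v2 //.
  by rewrite [LHS]mulrA -(torus_comm (tw d d') tu0) -mulrA.
have -> : u a * v a * (u a.+1 * v a.+1) = u a * u a.+1 * (v a * v a.+1).
  by rewrite -!mulrA; congr (_ * _); rewrite !mulrA (torus_comm tv tu1).
by rewrite [LHS]mulrA u3 -[LHS]mulrA v3 !mulrA.
Qed.

Lemma exchanges_nat s : exchanges a (fun=> s%:R).
Proof.
have sC z : t a * (s%:R * z) = s%:R * (t a * z) by rewrite !mulrA -natr_comm.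
by split=> [d d' z _|d d' z _|]; [rewrite sC|rewrite sC|rewrite -natrM natr_comm].
Qed.

Lemma exchangesN u : exchanges a u -> exchanges a (fun p => - u p).
Proof.
move=> [u1 u2 u3]; split=> [d d' z dd|d d' z dd|].
- by rewrite !mulNr !mulrN u1.
- by rewrite !mulNr !mulrN u2.
by rewrite mulrNN.
Qed.

Lemma exchanges_root : exchanges a (fun p => y - x p).
Proof.
have xl : t a * (x a.+1 + x a) = (x a.+1 + x a) * t a.
  rewrite mulrDl mulrDr; apply/eqP; rewrite -subr_eq0.
  rewrite [_ * t a + _]addrC opprD addrACA.
  by rewrite (klr_txr R aN) -opprB (klr_txl R aN) subrr.
have xx : t a * (x a * x a.+1) = x a * x a.+1 * t a.
  have e1 : t a * x a = x a.+1 * t a - \sum_d eps a d * eps a.+1 d.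
    by rewrite -(klr_txl R aN) opprB addrC subrK.
  have e2 : t a * x a.+1 = x a * t a + \sum_d eps a d * eps a.+1 d.
    by rewrite -(klr_txr R aN) addrC subrK.
  have xd : x a.+1 * (\sum_d eps a d * eps a.+1 d) = (\sum_d eps a d * eps a.+1 d) * x a.+1.
    rewrite mulr_sumr mulr_suml; apply: eq_bigr => d _.
    by rewrite mulrA (klr_xe R) // -!mulrA (klr_xe R).
  rewrite mulrA e1 mulrBl -mulrA e2 mulrDr xd addrK mulrA.
  by rewrite (klr_xC R aN).
have tx d d' z : d != d' -> two eps a d d' * (t a * (x a * z)) = two eps a d d' * (x a.+1 * (t a * z)).
  move=> /negPf dd; apply/eqP; rewrite eq_sym -subr_eq0 -mulrBr !mulrA -mulrBl (klr_txl R aN).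
  by rewrite mulrA -[_ * z]mulrA (f_delta R aN) dd.
have tx' d d' z : d != d' -> two eps a d d' * (t a * (x a.+1 * z)) = two eps a d d' * (x a * (t a * z)).
  move=> /negPf dd; apply/eqP; rewrite -subr_eq0 -mulrBr !mulrA -mulrBl (klr_txr R aN).
  by rewrite mulrA -[_ * z]mulrA (f_delta R aN) dd.
have ty z : t a * (y * z) = y * (t a * z) by rewrite !mulrA y_t.
split=> [d d' z dd|d d' z dd|].
- by rewrite !mulrBl !mulrBr tx // ty.
- by rewrite !mulrBl !mulrBr tx' // ty.
have -> : (y - x a) * (y - x a.+1) = y * y - y * (x a.+1 + x a) + x a * x a.+1.
  rewrite mulrBl !mulrBr mulrDr -y_x // opprB opprD -!addrA; congr (_ + (_ + _)).
  by rewrite addrC.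
rewrite mulrDr mulrBr [RHS]mulrDl mulrBl xx; congr (_ - _ + _).
  by rewrite ty -y_t // mulrA.
by rewrite ty xl mulrA.
Qed.

(** The inverse of a symmetric element is symmetric: conjugate the statement for
    y - x by its inverse. *)
Lemma exchanges_inv : exchanges a g.
Proof.
split=> [d d' z dd|d d' z dd|].
- by rewrite (f_tgl R y_eps y_t gl gr aN) (negPf dd) subr0.
- by rewrite (f_tgr R y_eps y_x y_t gl gr aN) (negPf dd) addr0.
have [_ _ E] := exchanges_root.
have ggl : g a * g a.+1 * ((y - x a) * (y - x a.+1)) = 1.
  have -> : (y - x a) * (y - x a.+1) = (y - x a.+1) * (y - x a).
    by apply: torus_comm; apply: torusB; try apply: torus_y; apply: torus_x.
  by rewrite mulrA -[g a * _ * _]mulrA gl // mulr1 gl.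
have ggr : ((y - x a) * (y - x a.+1)) * (g a * g a.+1) = 1.
  rewrite [g a * _](g_g R y_x gl gr) //.
  by rewrite mulrA -[_ * _ * g a.+1]mulrA gr // mulr1 gr.
rewrite -[LHS]mul1r -ggl -!mulrA; congr (_ * (_ * _)).
have := congr1 (fun z => z * (g a * g a.+1)) E.
by rewrite /= -mulrA ggr mulr1 -!mulrA => <-.
Qed.

Lemma t_weighted w : tame w -> (forall d, exchanges a (w d)) ->
  t a * (weighted w a * weighted w a.+1) = weighted w a * weighted w a.+1 * t a.
Proof.
move=> tm ex.
have W0 d d' z : two eps a d d' * (weighted w a * z) = two eps a d d' * (w d a * z).
  rewrite !mulrA; congr (_ * _).
  rewrite (torus_comm (tw d d')); last exact: torus_weighted.
  rewrite (torus_comm (tw d d')); last exact: tm.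
  by rewrite two.unlock mulrA weighted_eps // -mulrA.
have W1 d d' z : two eps a d d' * (weighted w a.+1 * z) = two eps a d d' * (w d' a.+1 * z).
  rewrite !mulrA; congr (_ * _).
  rewrite (torus_comm (tw d d')); last exact: torus_weighted.
  rewrite (torus_comm (tw d d')); last exact: tm.
  by rewrite two.unlock (klr_eC R d d' aN' aN) mulrA weighted_eps // -mulrA.
suff H d d' : two eps a d d' * (t a * (weighted w a * weighted w a.+1)) =
    two eps a d d' * (weighted w a * weighted w a.+1 * t a).
  rewrite -[LHS]mul1r -[RHS]mul1r -(two_sum R aN) [LHS]mulr_suml [RHS]mulr_suml.
  apply: eq_bigr => d _; rewrite [LHS]mulr_suml [RHS]mulr_suml.
  by apply: eq_bigr => d' _; apply: H.
rewrite [LHS]mulrA -(t_two R aN) -[LHS]mulrA W0.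
have fC d1 d2 u z : torus u -> two eps a d1 d2 * (u * z) = u * (two eps a d1 d2 * z).
  by move=> tu; rewrite [LHS]mulrA (torus_comm (tw d1 d2) tu) -mulrA.
have -> : two eps a d' d * (w d' a * weighted w a.+1) = two eps a d' d * (w d' a * w d a.+1).
  by rewrite !(fC _ _ _ _ (tm d' _ aN')) -[weighted w a.+1]mulr1 W1 mulr1.
rewrite [LHS]mulrA (t_two R aN) -[LHS]mulrA.
rewrite -[X in _ = _ * X]mulrA W0.
have -> : two eps a d d' * (w d a * (weighted w a.+1 * t a)) = two eps a d d' * (w d a * (w d' a.+1 * t a)).
  by rewrite !(fC _ _ _ _ (tm d _ aN')) W1.
have [dd|dd] := eqVneq d d'.
  by rewrite -dd; have [_ _ ->] := ex d; rewrite !mulrA.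
have [e1 _ _] := ex d'; have [_ e2 _] := ex d.
rewrite e1 // (fC _ _ _ _ (tm d' _ aN)) -[w d a.+1]mulr1 e2 // mulr1 -(fC _ _ _ _ (tm d' _ aN)).
congr (_ * _); rewrite !mulrA; congr (_ * _).
by apply: torus_comm; apply: tm.
Qed.

End Crossing.

(** Families such that, when every letter is given one of them, the product of
    the resulting weights over all positions commutes with all crossings. *)
Record balanced (u : nat -> B) : Prop := {
  sym_torus : forall p, (p < N)%N -> torus (u p);
  sym_far : forall a p, (a.+1 < N)%N -> (p < N)%N -> p != a -> p != a.+1 ->
    t a * u p = u p * t a;
  sym_exchanges : forall a, (a.+1 < N)%N -> exchanges a u }.

Lemma balancedM u v : balanced u -> balanced v -> balanced (fun p => u p * v p).
Proof.
move=> su sv; split=> [p pN|a p aN pN pa pa'|a aN].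
- by apply: torusM; apply: sym_torus.
- by rewrite mulrA (sym_far su) // -!mulrA (sym_far sv).
- by apply: (exchangesM aN); first [exact: sym_exchanges | (apply: sym_torus => //; lia)].
Qed.

Lemma balancedN u : balanced u -> balanced (fun p => - u p).
Proof.
move=> su; split=> [p pN|a p aN pN pa pa'|a aN].
- by apply: torusN; apply: sym_torus.
- by rewrite mulrN (sym_far su) // mulNr.
- by apply: exchangesN; apply: sym_exchanges.
Qed.

Lemma balanced_nat s : balanced (fun=> s%:R).
Proof.
split=> [p pN|a p aN pN pa pa'|a aN]; first exact: torus_nat.
- by rewrite natr_comm.
- exact: exchanges_nat.
Qed.

Lemma balanced_root : balanced (fun p => y - x p).
Proof.
split=> [p pN|a p aN pN pa pa'|a aN].
- by apply: torusB; [apply: torus_y|apply: torus_x].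
- by rewrite mulrBr mulrBl y_t // (klr_tx R).
- exact: exchanges_root.
Qed.

Lemma balanced_inv : balanced g.
Proof.
split=> [p pN|a p aN pN pa pa'|a aN]; first exact: torus_g.
- by rewrite (g_t R y_t gl gr).
- exact: exchanges_inv.
Qed.

(** The product of the weights over all positions commutes with the crossings,
    since t_a is moved through the factors at a and a + 1 jointly and commutes with
    each of the others. *)
Lemma t_prod_weighted w a : (forall d, balanced (w d)) -> (a.+1 < N)%N ->
  t a * (\prod_(p < N) weighted w p) = (\prod_(p < N) weighted w p) * t a.
Proof.
move=> sw aN; have tm : tame w by move=> d p pN; apply: sym_torus.
have tC p : (p < N)%N -> p != a -> p != a.+1 -> t a * weighted w p = weighted w p * t a.
  move=> pN pa pa'; rewrite mulr_sumr mulr_suml; apply: eq_bigr => d _.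
  by rewrite mulrA (sym_far (sw d)) // -!mulrA (klr_te R) // swp_id.
have lo k : (k <= a)%N -> t a * (\prod_(p < k) weighted w p) = (\prod_(p < k) weighted w p) * t a.
  by move=> ka; apply: prod_comm => p pk; apply: tC; lia.
suff H k : (k <= N)%N -> (a.+1 < k)%N ->
    t a * (\prod_(p < k) weighted w p) = (\prod_(p < k) weighted w p) * t a.
  by apply: H; lia.
elim: k => // k IH kN; rewrite ltnS leq_eqVlt => /orP[/eqP ak|ak].
  rewrite -ak !big_ord_recr /= -!mulrA [LHS]mulrA lo // -[LHS]mulrA; congr (_ * _).
  by rewrite (t_weighted aN tm) => [|d]; [rewrite mulrA|apply: sym_exchanges].
rewrite big_ord_recr /= mulrA IH -?mulrA ?tC //; lia.
Qed.

(** The rising weight is the off-diagonal entry P + B of the crossings that move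
    the new strand to the left, and the falling weight the entry A - P of those
    that move it to the right.  The trace weight is chosen so that the product of
    the three is a constant: the poles and zeros at x_p in y cancel. *)
Definition rising_weight d p : B := if d == c then g p else Q arr c d y (x p).
Definition falling_weight d p : B := if d == c then - g p else 1.
Definition trace_weight d p : B :=
  if d == c then (y - x p) * (y - x p) else if adj arr c d then g p else 1.
Definition unit_weight d (p : nat) : B :=
  if d == c then - 1 else if adj arr c d then slope arr B c d else 1.

Lemma eq_balanced u v : (forall p, u p = v p) -> balanced u -> balanced v.
Proof. by move=> uv; have -> : v = u by apply: funext => p. Qed.

Lemma balanced_rising d : balanced (rising_weight d).
Proof.
rewrite /rising_weight; case: (d == c); first exact: balanced_inv.
rewrite /Q; case: (arr c d); first exact: balanced_root.
case: (arr d c); last by case: (c == d); [exact: (balanced_nat 0)|exact: (balanced_nat 1)].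
by apply: eq_balanced (balancedN balanced_root) => p; rewrite opprB.
Qed.

Lemma balanced_falling d : balanced (falling_weight d).
Proof.
rewrite /falling_weight; case: (d == c); last exact: (balanced_nat 1).
exact: balancedN balanced_inv.
Qed.

Lemma balanced_trace d : balanced (trace_weight d).
Proof.
rewrite /trace_weight; case: (d == c); first exact: balancedM balanced_root balanced_root.
by case: (adj _ _ _); [exact: balanced_inv|exact: (balanced_nat 1)].
Qed.

Lemma sym_tame w : (forall d, balanced (w d)) -> tame w.
Proof. by move=> sw d p pN; apply: sym_torus. Qed.

Lemma eq_on_eps p u v : (p < N)%N -> (forall d, u * eps p d = v * eps p d) -> u = v.
Proof.
move=> pN uv; rewrite -[u]mulr1 -[v]mulr1 -(klr_sum R pN) !mulr_sumr.
by apply: eq_bigr => d _.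
Qed.

Lemma rising_factor p : (p < N)%N ->
  strand_P eps c g p + strand_B arr eps x c y p = weighted rising_weight p.
Proof.
move=> pN; apply: (eq_on_eps pN) => d; rewrite weighted_eps // mulrDl.
rewrite strand_P.unlock strand_B.unlock -mulrA (klr_ee R) //.
have -> : (\sum_b Q arr c b y (x p) * eps p b) * eps p d = Q arr c d y (x p) * eps p d.
  exact: (@weighted_eps (fun b p => Q arr c b y (x p))).
rewrite /rising_weight [d == c]eq_sym; case: (eqVneq c d) => [<-|cd]; last by rewrite mulr0 add0r.
by rewrite /Q (negPf (arrI c)) eqxx mul0r addr0.
Qed.

Lemma falling_factor p : (p < N)%N ->
  strand_A eps c p - strand_P eps c g p = weighted falling_weight p.
Proof.
move=> pN; apply: (eq_on_eps pN) => d; rewrite weighted_eps // mulrBl.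
rewrite strand_P.unlock strand_A.unlock -mulrA mulrBl mul1r (klr_ee R) //.
rewrite /falling_weight [d == c]eq_sym; case: (eqVneq c d) => [<-|cd].
  by rewrite subrr sub0r mulNr.
by rewrite mulr0 !subr0 mul1r.
Qed.

Lemma trace_factor p : (p < N)%N ->
  weighted trace_weight p * (weighted falling_weight p * weighted rising_weight p)
  = weighted unit_weight p.
Proof.
have tr := sym_tame balanced_rising; have tf := sym_tame balanced_falling.
have tt := sym_tame balanced_trace.
move=> pN; rewrite !weightedM //; last by move=> d q qN; apply: torusM; [exact: tf|exact: tr].
apply: (eq_on_eps pN) => d; rewrite !weighted_eps //; congr (_ * _).
rewrite /trace_weight /falling_weight /rising_weight /unit_weight; case: (eqVneq d c) => [_|dc].
  rewrite mulNr mulrN; congr (- _).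
  by rewrite -mulrA [X in _ * X]mulrA gr // mul1r gr.
rewrite mul1r /adj /Q /slope; case: (boolP (arr c d)) => [cd|_] /=.
  by rewrite (negPf (arrN cd)) subr0 gl.
by case: ifP => _; [rewrite sub0r -opprB mulrN gl|rewrite eq_sym (negPf dc) mulr1].
Qed.

Lemma trace_cancel :
  \prod_(p < N) weighted trace_weight p *
    (\prod_(p < N) weighted falling_weight p * \prod_(p < N) weighted rising_weight p)
  = \prod_(p < N) weighted unit_weight p.
Proof.
have tr := sym_tame balanced_rising; have tf := sym_tame balanced_falling.
have tt := sym_tame balanced_trace.
rewrite -prod_split => [|p q pN qN]; last by apply: torus_comm; apply: torus_weighted.
rewrite -(prod_split (F := weighted trace_weight)
  (H := fun p => weighted falling_weight p * weighted rising_weight p)) => [|p q pN qN].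
  by apply: eq_bigr => p _; apply: trace_factor.
by apply: torus_comm; [apply: torusM|]; apply: torus_weighted.
Qed.

End Weight.

(** * The submodule generated by the strand at one end *)

(** If S is a subgroup stable under the coefficients C and under all generators
    but the first, then S + s_0 S + s_1 s_0 S + ... + s_(n-1) ... s_0 S, built one
    step at a time, is stable under all generators.  These are the minimal coset
    representatives of the symmetric group modulo the stabiliser of one point. *)
Section Lattice.
Variables (T : Type) (R : pzRingType) (C : rend T R -> Prop) (s : nat -> rend T R) (n : nat).
Hypothesis C_s : forall a u, (a < n)%N -> C u ->
  exists u' u'', [/\ C u', C u'' & u * s a = s a * u' + u''].
Hypothesis ss : forall a, (a < n)%N -> C (s a * s a).
Hypothesis s_far : forall a b, (a.+1 < b)%N -> (b < n)%N -> s a * s b = s b * s a.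
Hypothesis s_braid : forall a, (a.+1 < n)%N ->
  exists2 u, C u & s a * s a.+1 * s a = s a.+1 * s a * s a.+1 + u.

Definition add_closed (S : (T -> R) -> Prop) :=
  S (fun=> 0) /\ forall u v, S u -> S v -> S (fun k => u k - v k).

Lemma add_closedN S u : add_closed S -> S u -> S (fun k => - u k).
Proof.
move=> [S0 SB] Su; have := SB _ _ S0 Su; congr (S _); apply: funext => k.
by rewrite sub0r.
Qed.

Lemma add_closedD S u v : add_closed S -> S u -> S v -> S (fun k => u k + v k).
Proof.
move=> Sa Su Sv; have := (proj2 Sa) _ _ Su (add_closedN Sa Sv); congr (S _).
by apply: funext => k; rewrite opprK.
Qed.

Fixpoint lattice (S : (T -> R) -> Prop) d : (T -> R) -> Prop :=
  if d is d'.+1 then fun v => exists v1 v2,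
    [/\ lattice S d' v1, lattice S d' v2 & v = fun k => v1 k + s d' v2 k]
  else S.

Variable S : (T -> R) -> Prop.
Hypothesis Sadd : add_closed S.
Hypothesis SC : forall u v, C u -> S v -> S (u v).
Hypothesis Ss : forall a v, (0 < a < n)%N -> S v -> S (s a v).

Lemma lattice_add d : add_closed (lattice S d).
Proof.
elim: d => [//|d [IH0 IHD]]; split=> [|_ _ [u1 [u2 [h1 h2 ->]]] [v1 [v2 [h3 h4 ->]]]].
  exists (fun=> 0), (fun=> 0); split=> //; apply: funext => k.
  by rewrite rend0 addr0.
exists (fun k => u1 k - v1 k), (fun k => u2 k - v2 k); split; [exact: IHD|exact: IHD|].
by apply: funext => k; rewrite rendB opprD addrACA.
Qed.

Lemma latticeS d v : lattice S d v -> lattice S d.+1 v.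
Proof.
move=> h; exists v, (fun=> 0); split=> //; first by case: (lattice_add d).
by apply: funext => k; rewrite rend0 addr0.
Qed.

Lemma lattice_start d v : S v -> lattice S d v.
Proof. by move=> Sv; elim: d => // d; exact: latticeS. Qed.

Lemma lattice_s d v : lattice S d v -> lattice S d.+1 (s d v).
Proof.
move=> h; exists (fun=> 0), v; split=> //; first by case: (lattice_add d).
by apply: funext => k; rewrite add0r.
Qed.

Lemma latticeC d u v : (d <= n)%N -> C u -> lattice S d v -> lattice S d (u v).
Proof.
elim: d u v => [|d IH] u v dn Cu; first exact: SC.
case=> [v1 [v2 [h1 h2 ->]]]; have [u' [u'' [Cu' Cu'' E]]] := C_s dn Cu.
have -> : u (fun k => v1 k + s d v2 k) = fun k => (u v1 k + u'' v2 k) + s d (u' v2) k.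
  apply: funext => k; rewrite rendD -addrA; congr (_ + _).
  by rewrite -rendE_mul E rendE_add rendE_mul addrC.
exists (fun k => u v1 k + u'' v2 k), (u' v2); split=> //; last by apply: IH => //; lia.
by apply: (add_closedD (lattice_add d)); apply: IH => //; lia.
Qed.

(** Stage d is stable under every s_a with a different from d: the generator s_(d-1)
    was added last and has its square in C, the braid relation handles s_(d-2), and
    all others commute with the generator added last. *)
Lemma lattice_stable d a v : (d <= n)%N -> (a < n)%N -> a != d ->
  lattice S d v -> lattice S d (s a v).
Proof.
elim/ltn_ind: d a v => -[|d] IH a v dn an ad; first by apply: Ss; lia.
have LD u w := add_closedD (u := u) (v := w) (lattice_add d.+1).
have [->|ad'] := eqVneq a d.
  case=> [v1 [v2 [h1 h2 ->]]]; rewrite rendD; apply: (LD _ _); first exact: lattice_s.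
  by apply: latticeS; rewrite -rendE_mul; apply: latticeC => //; [lia|apply: ss].
case=> [v1 [v2 [h1 h2 ->]]]; rewrite rendD; apply: (LD _ _).
  by apply: latticeS; apply: IH => //; lia.
have [far|near] := boolP ((a.+1 < d)%N || (d.+1 < a)%N).
  have -> : s a (s d v2) = s d (s a v2).
    by rewrite -!rendE_mul; case/orP: far => ?; [rewrite (@s_far a d)|rewrite (@s_far d a)] => //; lia.
  by apply: lattice_s; apply: IH => //; lia.
have da : d = a.+1 by lia.
subst d; case: h2 => [w1 [w2 [k1 k2 ->]]].
rewrite !rendD; apply: (LD _ _).
  apply: latticeS; apply: lattice_s; apply: IH => //; try lia.
have [u Cu E] := s_braid dn.
have -> : s a (s a.+1 (s a w2)) = fun k => s a.+1 (s a (s a.+1 w2)) k + u w2 k.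
  by rewrite -[LHS]/((s a * s a.+1 * s a) w2) E.
apply: (LD _ _); last by apply: latticeS; apply: latticeS; apply: latticeC => //; lia.
by apply: lattice_s; apply: lattice_s; apply: IH => //; lia.
Qed.

End Lattice.

Section Coefficients.
Variables (I : finType) (arr : rel I) (B : pzRingType) (n : nat) (J : Type) (kappa : J -> B).
Variables (eps : nat -> I -> B) (x t : nat -> B).
Hypothesis R : klr arr n eps x t.
Hypothesis kappa_t : forall j a, (a.+1 < n)%N -> kappa j * t a = t a * kappa j.

(** The ring generated by idempotents, dots and scalars; crossings move through it
    up to terms that lie in it. *)
Inductive coefficient : B -> Prop :=
| coef_eps p d of (p < n)%N : coefficient (eps p d)
| coef_x p of (p < n)%N : coefficient (x p)
| coef_kappa j : coefficient (kappa j)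
| coef1 : coefficient 1
| coefB u v of coefficient u & coefficient v : coefficient (u - v)
| coefM u v of coefficient u & coefficient v : coefficient (u * v).

Lemma coef0 : coefficient 0. Proof. by rewrite -(subrr 1); apply: coefB; apply: coef1. Qed.
Lemma coefN u : coefficient u -> coefficient (- u).
Proof. by move=> ?; rewrite -sub0r; apply: coefB => //; apply: coef0. Qed.
Lemma coefD u v : coefficient u -> coefficient v -> coefficient (u + v).
Proof. by move=> ? ?; rewrite -[v]opprK; apply: coefB => //; apply: coefN. Qed.
Lemma coef_sum (H : finType) (F : H -> B) : (forall j, coefficient (F j)) -> coefficient (\sum_j F j).
Proof. by move=> tF; elim/big_rec: _ => [|j u _ tu]; [exact: coef0|apply: coefD]. Qed.
Lemma coef_nat k : coefficient k%:R.
Proof. by elim: k => [|k IH]; [exact: coef0|rewrite -addn1 natrD; apply: coefD => //; exact: coef1]. Qed.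

Lemma coef_Q c d u v : coefficient u -> coefficient v -> coefficient (Q arr c d u v).
Proof.
move=> cu cv; rewrite /Q; case: ifP => _; first exact: coefB.
case: ifP => _; first exact: coefB.
by case: ifP => _; [exact: coef0|exact: coef1].
Qed.

Lemma coef_delta a : (a.+1 < n)%N -> coefficient (\sum_d eps a d * eps a.+1 d).
Proof. by move=> an; apply: coef_sum => d; apply: coefM; apply: coef_eps; lia. Qed.

Lemma coef_t a u : (a.+1 < n)%N -> coefficient u ->
  exists u' u'', [/\ coefficient u', coefficient u'' & u * t a = t a * u' + u''].
Proof.
move=> an; elim=> [p d pn|p pn|j||u1 u2 _ [v1 [w1 [h1 h2 E1]]] _ [v2 [w2 [h3 h4 E2]]]
  |u1 u2 c1 [v1 [w1 [h1 h2 E1]]] _ [v2 [w2 [h3 h4 E2]]]].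
- exists (eps (swp a p) d), 0; split; [|exact: coef0|].
    by apply: coef_eps; rewrite /swp; case: ifP => ?; [|case: ifP => ?]; lia.
  by rewrite addr0 (klr_te R) ?swpK // /swp; case: ifP => ?; [|case: ifP => ?]; lia.
- have [->|pa] := eqVneq p a.
    exists (x a.+1), (- \sum_d eps a d * eps a.+1 d); split; [exact: coef_x|apply/coefN/coef_delta=> //|].
    by rewrite -(klr_txr R an) opprB addrC subrK.
  have [->|pa'] := eqVneq p a.+1.
    exists (x a), (\sum_d eps a d * eps a.+1 d); split; [apply: coef_x; lia|exact: coef_delta|].
    by rewrite -(klr_txl R an) addrC subrK.
  by exists (x p), 0; split; [exact: coef_x|exact: coef0|rewrite addr0 (klr_tx R)].
- by exists (kappa j), 0; split; [exact: coef_kappa|exact: coef0|rewrite addr0 kappa_t].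
- by exists 1, 0; split; [exact: coef1|exact: coef0|rewrite mul1r mulr1 addr0].
- exists (v1 - v2), (w1 - w2); split; [exact: coefB|exact: coefB|].
  by rewrite mulrBl mulrBr E1 E2 opprD addrACA.
exists (v1 * v2), (w1 * v2 + u1 * w2); split; [exact: coefM| |].
  by apply: coefD; apply: coefM.
by rewrite -mulrA E2 mulrDr !mulrA E1 mulrDl addrA.
Qed.

Lemma coef_tt a : (a.+1 < n)%N -> coefficient (t a * t a).
Proof.
move=> an; have an' : (a < n)%N by lia.
rewrite (klr_tt R an); apply: coef_sum => c; apply: coef_sum => d; apply: coefM.
  by apply: coef_Q; apply: coef_x.
by apply: coefM; apply: coef_eps.
Qed.

Lemma coef_braid a : (a.+2 < n)%N -> coefficient (t a.+1 * t a * t a.+1 - t a * t a.+1 * t a).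
Proof.
move=> an; rewrite (klr_braid R an); apply: coef_sum => c; apply: coef_sum => d; apply: coefM.
  by apply: coefB; apply: coef_nat.
by apply: coefM; [apply: coefM|]; apply: coef_eps; lia.
Qed.

Inductive generated : B -> Prop :=
| gen_eps p d of (p < n)%N : generated (eps p d)
| gen_x p of (p < n)%N : generated (x p)
| gen_t a of (a.+1 < n)%N : generated (t a)
| gen_kappa j : generated (kappa j)
| gen1 : generated 1
| genB u v of generated u & generated v : generated (u - v)
| genM u v of generated u & generated v : generated (u * v).

Lemma gen0 : generated 0. Proof. by rewrite -(subrr 1); apply: genB; apply: gen1. Qed.
Lemma genN u : generated u -> generated (- u).
Proof. by move=> ?; rewrite -sub0r; apply: genB => //; apply: gen0. Qed.
Lemma genD u v : generated u -> generated v -> generated (u + v).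
Proof. by move=> ? ?; rewrite -[v]opprK; apply: genB => //; apply: genN. Qed.

End Coefficients.

Section StrandLattice.
Variables (I : finType) (arr : rel I) (B : pzRingType) (N : nat).
Variables (eps : nat -> I -> B) (x t : nat -> B).
Hypothesis arrI : forall i, ~~ arr i i.
Hypothesis arrN : forall i j, arr i j -> ~~ arr j i.
Hypothesis R : klr arr N eps x t.
Variables (c : I) (y : B) (g : nat -> B).
Hypothesis y_eps : forall p d, (p < N)%N -> y * eps p d = eps p d * y.
Hypothesis y_x : forall p, (p < N)%N -> y * x p = x p * y.
Hypothesis y_t : forall a, (a.+1 < N)%N -> y * t a = t a * y.
Hypothesis gl : forall p, (p < N)%N -> g p * (y - x p) = 1.
Hypothesis gr : forall p, (p < N)%N -> (y - x p) * g p = 1.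
Variables (J : Type) (kappa : J -> B).
Hypothesis kappa_eps : forall j p d, (p < N)%N -> kappa j * eps p d = eps p d * kappa j.
Hypothesis kappa_x : forall j p, (p < N)%N -> kappa j * x p = x p * kappa j.
Hypothesis kappa_t : forall j a, (a.+1 < N)%N -> kappa j * t a = t a * kappa j.
Hypothesis kappa_y : forall j, kappa j * y = y * kappa j.

Local Notation E := (sE N eps c).
Local Notation X := (sX N x y).
Local Notation T := (sT arr N eps x t c y g).
Definition sK (j : J) := @rend_diag 'I_N.+1 B (fun=> kappa j).

Lemma torus_kappa j u : torus N eps x y g u -> kappa j * u = u * kappa j.
Proof.
elim=> [p d pN|p pN||p pN||u1 u2 _ E1 _ E2|u1 u2 _ E1 _ E2].
- exact: kappa_eps.
- exact: kappa_x.
- exact: kappa_y.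
- by rewrite -(g_comm gl gr) // mulrBl mulrBr kappa_y kappa_x.
- by rewrite mulr1 mul1r.
- by rewrite mulrBr mulrBl E1 E2.
- by rewrite mulrA E1 -!mulrA E2.
Qed.

Let tP p : (p < N)%N -> torus N eps x y g (strand_P eps c g p).
Proof. by move=> pN; rewrite strand_P.unlock; apply: torusM; [apply: torus_g|apply: torus_eps]. Qed.
Let tA p : (p < N)%N -> torus N eps x y g (strand_A eps c p).
Proof. by move=> pN; rewrite strand_A.unlock; apply: torusB; [apply: torus1|apply: torus_eps]. Qed.
Let tB p : (p < N)%N -> torus N eps x y g (strand_B arr eps x c y p).
Proof.
move=> pN; rewrite strand_B.unlock; apply: torus_sum => d; apply: torusM; last exact: torus_eps.
have ty := torus_y N eps x y g; have tx : torus N eps x y g (x p) by exact: torus_x.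
rewrite /Q; case: ifP => _; first exact: torusB.
case: ifP => _; first exact: torusB.
by case: ifP => _; [exact: torus0|exact: torus1].
Qed.

Lemma sK_sE j p d : (p <= N)%N -> sK j * E p d = E p d * sK j.
Proof.
move=> pN; rewrite !rend_diagM; apply: rend_diag_ext => k; have kN := ltn_ord k.
rewrite /ecomp; case: ifP => [_|/negbT pk]; first by rewrite -natr_comm.
by rewrite kappa_eps // unb_lt.
Qed.

Lemma sK_sX j p : (p <= N)%N -> sK j * X p = X p * sK j.
Proof.
move=> pN; rewrite !rend_diagM; apply: rend_diag_ext => k; have kN := ltn_ord k.
rewrite /xcomp; case: ifP => [_|/negbT pk]; first exact: kappa_y.
by rewrite kappa_x // unb_lt.
Qed.

Lemma sK_sT j a : (a < N)%N -> sK j * T a = T a * sK j.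
Proof.
move=> aN; apply: rend_ext => v k; have kN := ltn_ord k.
have D u : sK j u = fun k => kappa j * u k by [].
rewrite !rendE_mul D !sT_at mulrDr D !mulrA; congr (_ * _ + _ * _).
  rewrite /Dcomp; case: ifP => [_|/negbT ka]; first by rewrite mulrN mulNr torus_kappa //; apply: tP.
  case: ifP => [_|/negbT ka']; first by apply: torus_kappa; apply: tP.
  by apply: kappa_t; rewrite /unb; case: ifP; lia.
rewrite /Ocomp; case: ifP => _; first by apply: torus_kappa; apply: torusD; [exact: tP|exact: tB].
case: ifP => _; last by rewrite mulr0 mul0r.
by apply: torus_kappa; apply: torusB; [exact: tA|exact: tP].
Qed.

Let RR := strand_klr arrI arrN R c y_eps y_x y_t gl gr.
Let C := coefficient N.+1 sK E X.

Variable S : ('I_N.+1 -> B) -> Prop.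
Hypothesis Sadd : add_closed S.
Hypothesis SE : forall p d v, (p <= N)%N -> S v -> S (E p d v).
Hypothesis SX : forall p v, (p <= N)%N -> S v -> S (X p v).
Hypothesis SK : forall j v, S v -> S (sK j v).

Lemma coefficient_stable u v : C u -> S v -> S (u v).
Proof.
move=> Cu; elim: Cu v => [p d pN|p pN|j||u1 u2 _ S1 _ S2|u1 u2 _ S1 _ S2] v Sv.
- exact: SE.
- exact: SX.
- exact: SK.
- by [].
- by apply: (proj2 Sadd); [apply: S1|apply: S2].
- by rewrite rendE_mul; apply/S1/S2.
Qed.

Let Ct a u : (a < N)%N -> C u -> exists u' u'', [/\ C u', C u'' & u * T a = T a * u' + u''].
Proof. by move=> aN; apply: (coef_t RR) => // j b bN; apply: sK_sT. Qed.

Lemma rising_stable : (forall a v, (a.+1 < N)%N -> S v -> S (T a v)) ->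
  forall a v, (a < N)%N -> lattice (fun d : nat => T (N.-1 - d)%N) S N v ->
    lattice (fun d : nat => T (N.-1 - d)%N) S N (T a v).
Proof.
move=> ST a v aN; have -> : a = (N.-1 - (N.-1 - a))%N by lia.
apply: (@lattice_stable _ _ C (fun d : nat => T (N.-1 - d)%N) N) => //; try lia.
- by move=> b u bN; apply: Ct; lia.
- by move=> b bN; apply: (coef_tt sK RR); lia.
- by move=> b b' bb' b'N; symmetry; apply: (klr_tC RR); lia.
- move=> b bN; exists (T (N.-1 - b)%N * T (N.-1 - b.+1)%N * T (N.-1 - b)%N
      - T (N.-1 - b.+1)%N * T (N.-1 - b)%N * T (N.-1 - b.+1)%N); last by rewrite addrC subrK.
  have -> : (N.-1 - b)%N = (N.-1 - b.+1).+1 by lia.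
  by apply: (coef_braid sK RR); lia.
- exact: coefficient_stable.
- by move=> b u bN; apply: ST; lia.
Qed.

Lemma falling_stable : (forall a v, (0 < a < N)%N -> S v -> S (T a v)) ->
  forall a v, (a < N)%N -> lattice T S N v -> lattice T S N (T a v).
Proof.
move=> ST a v aN; apply: (@lattice_stable _ _ C T N) => //; try lia.
- by move=> b bN; apply: (coef_tt sK RR).
- by move=> b b' bb' b'N; rewrite (klr_tC RR).
- move=> b bN; exists (- (T b.+1 * T b * T b.+1 - T b * T b.+1 * T b)).
    by apply/coefN/(coef_braid sK RR).
  by rewrite opprB addrC subrK.
- exact: coefficient_stable.
Qed.

Lemma lattice_coefficient s u v : C u -> (forall a, (a < N)%N -> exists2 b, (b < N)%N & s a = T b) ->
  lattice s S N v -> lattice s S N (u v).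
Proof.
move=> Cu sT; apply: (@latticeC _ _ C s N) => //; last exact: coefficient_stable.
by move=> a w aN; have [b bN ->] := sT a aN; apply: Ct.
Qed.

Lemma lattice_generated s : (forall a, (a < N)%N -> exists2 b, (b < N)%N & s a = T b) ->
  (forall a v, (a < N)%N -> lattice s S N v -> lattice s S N (T a v)) ->
  forall u v, generated N.+1 sK E X T u -> lattice s S N v -> lattice s S N (u v).
Proof.
move=> sT Ts u v gu; elim: gu v => [p d pN|p pN|a aN|j||u1 u2 _ S1 _ S2|u1 u2 _ S1 _ S2] v Sv.
- by apply: lattice_coefficient => //; apply: coef_eps.
- by apply: lattice_coefficient => //; apply: coef_x.
- exact: Ts.
- by apply: lattice_coefficient => //; apply: coef_kappa.
- by [].
- by apply: (proj2 (lattice_add _ _ _)) => //; [apply: S1|apply: S2].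
- by rewrite rendE_mul; apply/S1/S2.
Qed.

End StrandLattice.

Section StrandValues.
Variables (I : finType) (arr : rel I) (B : pzRingType) (N : nat).
Variables (eps : nat -> I -> B) (x t : nat -> B).
Hypothesis arrI : forall i, ~~ arr i i.
Hypothesis arrN : forall i j, arr i j -> ~~ arr j i.
Hypothesis R : klr arr N eps x t.
Variables (c : I) (y : B) (g : nat -> B).
Hypothesis y_eps : forall p d, (p < N)%N -> y * eps p d = eps p d * y.
Hypothesis y_x : forall p, (p < N)%N -> y * x p = x p * y.
Hypothesis y_t : forall a, (a.+1 < N)%N -> y * t a = t a * y.
Hypothesis gl : forall p, (p < N)%N -> g p * (y - x p) = 1.
Hypothesis gr : forall p, (p < N)%N -> (y - x p) * g p = 1.
Variables (J : Type) (kappa : J -> B).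
Hypothesis kappa_eps : forall j p d, (p < N)%N -> kappa j * eps p d = eps p d * kappa j.
Hypothesis kappa_x : forall j p, (p < N)%N -> kappa j * x p = x p * kappa j.
Hypothesis kappa_t : forall j a, (a.+1 < N)%N -> kappa j * t a = t a * kappa j.
Hypothesis kappa_y : forall j, kappa j * y = y * kappa j.
Variable Bp : B -> Prop.
Hypothesis Bp0 : Bp 0.
Hypothesis BpB : forall u v, Bp u -> Bp v -> Bp (u - v).
Hypothesis Bp_eps : forall p d u, (p < N)%N -> Bp u -> Bp (eps p d * u).
Hypothesis Bp_x : forall p u, (p < N)%N -> Bp u -> Bp (x p * u).
Hypothesis Bp_t : forall a u, (a.+1 < N)%N -> Bp u -> Bp (t a * u).
Hypothesis Bp_kappa : forall j u, Bp u -> Bp (kappa j * u).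
Hypothesis Bp_y : forall u, Bp u -> Bp (y * u).

Local Notation E := (sE N eps c).
Local Notation X := (sX N x y).
Local Notation T := (sT arr N eps x t c y g).
Local Notation rising := (weighted eps (rising_weight arr x c y g)).
Local Notation falling := (weighted eps (falling_weight c g)).

Variable (Y : B).
Hypothesis Y_eps : forall p d, (p < N)%N -> Y * eps p d = eps p d * Y.
Hypothesis Y_x : forall p, (p < N)%N -> Y * x p = x p * Y.
Hypothesis Y_t : forall a, (a.+1 < N)%N -> Y * t a = t a * Y.
Hypothesis Y_kappa : forall j, kappa j * Y = Y * kappa j.
Hypothesis Y_y : Y * y = y * Y.

(** Vectors with the new strand at position e only, and value in the multiple
    Y Bp of a subgroup Bp of B stable under the old generators and y.  They form a
    subgroup stable under the crossings that do not touch position e. *)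
Definition at_end (e : nat) (v : 'I_N.+1 -> B) :=
  (forall k : 'I_N.+1, k != e :> nat -> v k = 0) /\ exists2 b, Bp b & v (inord e) = Y * b.

Section AtEnd.
Variable e : nat.
Hypothesis eN : (e <= N)%N.

Lemma at_end_add : add_closed (at_end e).
Proof.
split=> [|u v [u0 [b Bb ub]] [v0 [b' Bb' vb]]].
  by split=> //; exists 0 => //; rewrite mulr0.
split=> [k ke|]; first by rewrite u0 // v0 // subr0.
by exists (b - b'); [exact: BpB|rewrite ub vb mulrBr].
Qed.

Lemma at_end_diag (u : nat -> B) v : (forall b, Bp b -> Bp (u e * b)) -> Y * u e = u e * Y ->
  at_end e v -> at_end e (@rend_diag 'I_N.+1 B (fun k => u k) v).
Proof.
move=> Bu uY [v0 [b Bb vb]]; split=> [k ke|] /=; first by rewrite v0 ?mulr0.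
by exists (u e * b); [exact: Bu|rewrite inordK // vb mulrA -uY mulrA].
Qed.

Lemma at_end_E p d v : (p <= N)%N -> at_end e v -> at_end e (E p d v).
Proof.
move=> pN; apply: (at_end_diag (u := ecomp eps c p d)) => [b Bb|]; rewrite /ecomp; case: ifP => [_|/negbT pe].
- by case: (d == c); rewrite ?mul1r ?mul0r.
- by apply: Bp_eps => //; apply: (unb_lt (N := N)).
- by rewrite natr_comm.
by rewrite Y_eps //; apply: unb_lt.
Qed.

Lemma at_end_X p v : (p <= N)%N -> at_end e v -> at_end e (X p v).
Proof.
move=> pN; apply: (at_end_diag (u := xcomp x y p)) => [b Bb|]; rewrite /xcomp; case: ifP => [_|/negbT pe] //.
- exact: Bp_y.
- by apply: Bp_x => //; apply: (unb_lt (N := N)).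
by rewrite Y_x //; apply: unb_lt.
Qed.

Lemma at_end_K j v : at_end e v -> at_end e (sK N kappa j v).
Proof. by apply: (at_end_diag (u := fun=> kappa j)) => // b; apply: Bp_kappa. Qed.

Lemma at_end_T a v : (a < N)%N -> e != a -> e != a.+1 -> at_end e v -> at_end e (T a v).
Proof.
move=> aN ea ea' [v0 [b Bb vb]]; split=> [k ke|].
  rewrite sT_at inord_val v0 // mulr0 add0r.
  case: (boolP ((k == a :> nat) || (k == a.+1 :> nat))) => [|/norP[ka ka']]; last first.
    by rewrite Ocomp_far // mul0r.
  move=> ka; rewrite v0 ?mulr0 // inordK; first last.
    by rewrite ltnS; apply: swp_le => //; rewrite -ltnS.
  by case/orP: ka => /eqP->; rewrite ?swp_l ?swp_r eq_sym.
rewrite sT_in // Ocomp_far // mul0r addr0 Dcomp_far // vb.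
by exists (t (unb e a) * b); [apply: Bp_t => //|rewrite !mulrA Y_t //]; rewrite /unb; case: ifP; lia.
Qed.

End AtEnd.

(** After d steps to the left, the leftmost position reached carries the product of
    the d weights collected on the way: each earlier summand vanishes there, and
    the last crossing contributes its off-diagonal entry. *)
Lemma rising_values d v : (d <= N)%N -> lattice (fun d : nat => T (N.-1 - d)%N) (at_end N) d v ->
  (forall k : 'I_N.+1, (k < N - d)%N -> v k = 0) /\
  exists2 b, Bp b & v (inord (N - d)) = \prod_(N - d <= p < N) rising p * (Y * b).
Proof.
elim: d v => [|d IH] v dN.
  rewrite subn0 => -[v0 [b Bb vb]]; split=> [k kN|]; first by apply: v0; lia.
  by exists b; rewrite ?big_geq // mul1r.
case=> [v1 [v2 [h1 h2 ->]]]; have dN' : (d <= N)%N by lia.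
have [u0 _] := IH _ dN' h1; have [w0 [b Bb wb]] := IH _ dN' h2.
set k := (N - d.+1)%N; have kE : (N - d)%N = k.+1 by lia.
have -> : (N.-1 - d)%N = k by lia.
split=> [j jk|].
  rewrite u0 ?add0r; last by lia.
  rewrite sT_at Ocomp_far ?mul0r ?addr0; try lia.
  by rewrite inord_val w0 ?mulr0 //; lia.
exists b => //.
rewrite u0 ?add0r; last by rewrite inordK; lia.
rewrite sT_in; last by lia.
rewrite w0 ?mulr0 ?add0r; last by rewrite inordK; lia.
rewrite Ocomp_l swp_l -kE wb (rising_factor arrI R) //; last by lia.
by rewrite [in RHS]big_ltn ?mulrA ?kE //; lia.
Qed.

Lemma falling_values d v : (d <= N)%N -> lattice T (at_end 0) d v ->
  (forall k : 'I_N.+1, (d < k)%N -> v k = 0) /\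
  exists2 b, Bp b & v (inord d) = \prod_(p < d) falling p * (Y * b).
Proof.
elim: d v => [|d IH] v dN.
  case=> [v0 [b Bb vb]]; split=> [k kN|]; first by apply: v0; lia.
  by exists b; rewrite ?big_ord0 // mul1r.
case=> [v1 [v2 [h1 h2 ->]]]; have dN' : (d <= N)%N by lia.
have [u0 _] := IH _ dN' h1; have [w0 [b Bb wb]] := IH _ dN' h2.
split=> [j jk|].
  rewrite u0 ?add0r; last by lia.
  rewrite sT_at Ocomp_far ?mul0r ?addr0; try lia.
  by rewrite inord_val w0 ?mulr0 //; lia.
exists b => //.
rewrite u0 ?add0r; last by rewrite inordK; lia.
rewrite sT_in; last by lia.
rewrite w0 ?mulr0 ?add0r; last by rewrite inordK; lia.
rewrite Ocomp_r swp_r wb (falling_factor R) // mulrA big_ord_recr /=; congr (_ * _).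
have tf := sym_tame (balanced_falling R c y_eps y_x y_t gl gr).
by apply: prod_comm => p pd; apply: (torus_comm R y_eps y_x gl gr);
  apply: (torus_weighted tf); lia.
Qed.

(** Whatever element of the algebra is applied to a vector at the right end, its
    value at the left end is divisible by the product of the rising weights. *)
Lemma rising_image u v : generated N.+1 (sK N kappa) E X T u -> at_end N v ->
  exists2 b, Bp b & u v ord0 = \prod_(p < N) rising p * (Y * b).
Proof.
move=> gu Sv; have h : lattice (fun d : nat => T (N.-1 - d)%N) (at_end N) N (u v).
  apply: (lattice_generated arrI arrN R y_eps y_x y_t gl gr kappa_eps kappa_x kappa_t kappa_y _ _ _ _ _ _ gu).
  - exact: at_end_add.
  - by move=> p d w pN; apply: at_end_E.
  - by move=> p w pN; apply: at_end_X.
  - by move=> j w; apply: at_end_K.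
  - by move=> a aN; exists (N.-1 - a)%N => //; lia.
  - move=> a w aN; apply: (rising_stable arrI arrN R y_eps y_x y_t gl gr kappa_eps kappa_x kappa_t kappa_y) => //.
    + exact: at_end_add.
    + by move=> p d z pN; apply: at_end_E.
    + by move=> p z pN; apply: at_end_X.
    + by move=> j z; apply: at_end_K.
    by move=> b z bN; apply: at_end_T; lia.
  - by apply: lattice_start => //; exact: at_end_add.
have [_ [b Bb E0]] := rising_values (leqnn N) h.
exists b => //; rewrite subnn big_mkord in E0; rewrite -E0; congr (u v _).
by apply: val_inj; rewrite /= inordK.
Qed.

(** The same from the left end to the right end, with the falling weights. *)
Lemma falling_image u v : generated N.+1 (sK N kappa) E X T u -> at_end 0 v ->
  exists2 b, Bp b & u v ord_max = \prod_(p < N) falling p * (Y * b).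
Proof.
move=> gu Sv; have h : lattice T (at_end 0) N (u v).
  apply: (lattice_generated arrI arrN R y_eps y_x y_t gl gr kappa_eps kappa_x kappa_t kappa_y _ _ _ _ _ _ gu).
  - exact: at_end_add.
  - by move=> p d w pN; apply: at_end_E.
  - by move=> p w pN; apply: at_end_X.
  - by move=> j w; apply: at_end_K.
  - by move=> a aN; exists a.
  - move=> a w aN; apply: (falling_stable arrI arrN R y_eps y_x y_t gl gr kappa_eps kappa_x kappa_t kappa_y) => //.
    + exact: at_end_add.
    + by move=> p d z pN; apply: at_end_E.
    + by move=> p z pN; apply: at_end_X.
    + by move=> j z; apply: at_end_K.
    by move=> b z bN; apply: at_end_T; lia.
  - by apply: lattice_start => //; exact: at_end_add.
have [_ [b Bb E0]] := falling_values (leqnn N) h.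
exists b => //; rewrite -E0; congr (u v _).
by apply: val_inj; rewrite /= inordK.
Qed.

End StrandValues.

(** * Representations of the quiver Hecke algebra *)

Lemma klr_rmorph (I : finType) (arr : rel I) (A B : pzRingType) (f : {rmorphism A -> B}) n eps x t :
  klr arr n eps x t -> klr arr n (fun p d => f (eps p d)) (f \o x) (f \o t).
Proof.
move=> R; have fM u v : f u * f v = f (u * v) by rewrite rmorphM.
have fS (u : I -> A) : \sum_d f (u d) = f (\sum_d u d) by rewrite rmorph_sum.
split=> /=.
- by move=> p c d pn; rewrite fM (klr_ee R) //; case: ifP; rewrite ?rmorph0.
- by move=> p pn; rewrite fS (klr_sum R) // rmorph1.
- by move=> p q c d pn qn; rewrite !fM (klr_eC R).
- by move=> p q pn qn; rewrite !fM (klr_xC R).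
- by move=> p q d pn qn; rewrite !fM (klr_xe R).
- by move=> a p d an pn; rewrite !fM (klr_te R).
- by move=> a p an pn pa pa'; rewrite !fM (klr_tx R).
- by move=> a an; rewrite !fM -rmorphB (klr_txr R) // -fS; apply: eq_bigr => d _; rewrite fM.
- by move=> a an; rewrite !fM -rmorphB (klr_txl R) // -fS; apply: eq_bigr => d _; rewrite fM.
- move=> a an; rewrite !fM (klr_tt R) // -fS; apply: eq_bigr => c _.
  by rewrite -fS; apply: eq_bigr => d _; rewrite rmorphM (rmorph_Q arr f) !fM.
- by move=> a b ab bn; rewrite !fM (klr_tC R).
move=> a an; rewrite !fM -rmorphB (klr_braid R) // -fS; apply: eq_bigr => c _.
by rewrite -fS; apply: eq_bigr => d _; rewrite rmorphM (rmorph_slope arr f) !fM.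
Qed.

Lemma klr_restrict (I : finType) (arr : rel I) (B : pzRingType) n m (eps : nat -> I -> B) x t :
  (m <= n)%N -> klr arr n eps x t -> klr arr m eps x t.
Proof.
move=> mn R; split.
- by move=> p c d pm; apply: (klr_ee R); lia.
- by move=> p pm; apply: (klr_sum R); lia.
- by move=> p q c d pm qm; apply: (klr_eC R); lia.
- by move=> p q pm qm; apply: (klr_xC R); lia.
- by move=> p q d pm qm; apply: (klr_xe R); lia.
- by move=> a p d am pm; apply: (klr_te R); lia.
- by move=> a p am pm; apply: (klr_tx R); lia.
- by move=> a am; apply: (klr_txr R); lia.
- by move=> a am; apply: (klr_txl R); lia.
- by move=> a am; apply: (klr_tt R); lia.
- by move=> a b ab bm; apply: (klr_tC R); lia.
- by move=> a am; apply: (klr_braid R); lia.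
Qed.

Lemma scalar_comm (K : comNzRingType) (A : algType K) (c : K) (z : A) : c%:A * z = z * c%:A.
Proof. by rewrite mulr_algl mulr_algr. Qed.

Section Representations.
Variables (K : fieldType) (I : finType) (arr : rel I) (i0 : I) (n : nat).
Hypothesis arrN : forall i j, arr i j -> ~~ arr j i.

Definition qh_scalar (c : K) : quiver_hecke K arr n := ring_pi _ (c%:A : free_alg K (qh_gen I n)).

Lemma qh_scalar_comm c z : qh_scalar c * z = z * qh_scalar c.
Proof.
have M (u v : free_alg K (qh_gen I n)) :
    ring_pi _ u * ring_pi _ v = ring_pi _ (u * v) :> quiver_hecke K arr n.
  by symmetry; exact: rmorphM.
rewrite -[z]ring_piK; apply: (etrans (M _ _)); apply: (etrans _ (esym (M _ _))).
exact: (congr1 (ring_pi _) (@scalar_comm K (free_alg K (qh_gen I n)) c (repr z))).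
Qed.

Lemma quiver_hecke_ind (P : quiver_hecke K arr n -> Prop) :
  (forall i, P (qh_e K arr i)) -> (forall p, P (qh_x K arr p)) -> (forall a, P (qh_t K arr a)) ->
  (forall c, P (qh_scalar c)) -> (forall u v, P u -> P v -> P (u + v)) ->
  (forall u v, P u -> P v -> P (u * v)) -> forall z, P z.
Proof.
move=> Pe Px Pt Pc PD PM z; rewrite -[z]ring_piK; move: (repr z) => {}z.
elim/free_alg_ind: z => [[[i|p]|a]|c|u v IHu IHv|u v IHu IHv].
- exact: Pe.
- exact: Px.
- exact: Pt.
- exact: Pc.
- rewrite [ring_pi _ _]rmorphD; exact: PD.
- rewrite [ring_pi _ _]rmorphM; exact: PM.
Qed.

(** The condition on the idempotents appears both for letters and for words, because
    some constructions provide one form and need the other. *)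
Record represents (B : pzRingType) (phi : quiver_hecke K arr n -> B)
  (kappa : K -> B) (eps : nat -> I -> B) (x t : nat -> B) : Prop := {
  rep_eps : forall p d, (p < n)%N -> \sum_(i | letters i0 i p == d) phi (qh_e K arr i) = eps p d;
  rep_e : forall i, phi (qh_e K arr i) = pre eps n (letters i0 i);
  rep_x : forall p : 'I_n, phi (qh_x K arr p) = x p;
  rep_t : forall a : 'I_n.-1, phi (qh_t K arr a) = t a;
  rep_kappa : forall c, phi (qh_scalar c) = kappa c }.

Section Maps.
Variable B : pzRingType.

Lemma pre_letter eps (x t : nat -> B) p d : klr arr n eps x t -> (p < n)%N ->
  \sum_(i : word I n | letters i0 i p == d) pre eps n (letters i0 i) = eps p d.
Proof.
move=> R pn; rewrite -[RHS]mulr1 -(pre_sum R i0) mulr_sumr [RHS](bigID (fun i => letters i0 i p == d)) /=.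
rewrite [X in _ + X]big1 ?addr0; last first.
  by move=> i /negPf id; rewrite (eps_pre R) // id.
by apply: eq_bigr => i id; rewrite (eps_pre R) // id.
Qed.

Lemma representation (kappa : {rmorphism K -> B}) eps x t :
  klr arr n eps x t ->
  (forall c p d, (p < n)%N -> kappa c * eps p d = eps p d * kappa c) ->
  (forall c p, (p < n)%N -> kappa c * x p = x p * kappa c) ->
  (forall c a, (a.+1 < n)%N -> kappa c * t a = t a * kappa c) ->
  exists phi : {rmorphism quiver_hecke K arr n -> B}, represents phi kappa eps x t.
Proof.
move=> R ke kx kt; have [phi [pe px pt pk]] := quiver_hecke_morphism i0 arrN R ke kx kt.
exists phi; split=> [p d pn|i|p|a|c] //; last by rewrite pk !rmorph1 mulr1.
by rewrite -(pre_letter d R pn); apply: eq_bigr => i _; rewrite pe.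
Qed.

Variable psi : {rmorphism quiver_hecke K arr n -> B}.

Lemma pre_qeps i : pre (qeps i0 psi) n (letters i0 i) = psi (qh_e K arr i).
Proof.
have E := ee psi; rewrite /= in E; apply: (eq_on_e (psi := psi)) => j; rewrite E.
suff H k : (k <= n)%N -> pre (qeps i0 psi) k (letters i0 i) * psi (qh_e K arr j)
    = if [forall p : 'I_n, (p < k)%N ==> (i p == j p)] then psi (qh_e K arr j) else 0.
  rewrite H //; case: forallP => [ij|nij].
    have -> : i = j by apply/ffunP => p; apply/eqP; have := ij p; rewrite ltn_ord.
    by rewrite eqxx.
  by case: eqP => // ij; case: nij => p; rewrite ij eqxx implybT.
elim: k => [|k IH] kn.
  by rewrite pre0 mul1r; case: forallP => // [[]] p; rewrite ltn0.
rewrite preS -mulrA qeps_e; have kE := letters_ord i0 _ (Ordinal kn).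
rewrite (kE i) (kE j); case: (eqVneq (j (Ordinal kn)) (i (Ordinal kn))) => ji; last first.
  rewrite mulr0; case: forallP => // /(_ (Ordinal kn)); rewrite /= ltnSn eq_sym.
  by rewrite (negPf ji).
rewrite IH; last by lia.
congr (if _ then _ else _); apply/forallP/forallP => h p; have := h p; last first.
  by case: (ltnP p k) => //= pk; rewrite (ltn_trans pk (ltnSn k)).
case: (ltngtP p k) => [pk|pk|pk] /=; rewrite ltnS.
- by rewrite ltnW.
- by rewrite leqNgt pk.
by have -> : p = Ordinal kn; [exact: val_inj|rewrite ji eqxx implybT].
Qed.

Lemma represents_self (kappa : K -> B) : (forall c, psi (qh_scalar c) = kappa c) ->
  represents psi kappa (qeps i0 psi) (qx psi) (qt psi).
Proof.
move=> pk; split=> [p d pn|i|p|a|c] //.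
- by rewrite pre_qeps.
- by rewrite qxE.
- by rewrite qtE.
Qed.

Lemma represents_generated kappa eps x t z :
  represents psi kappa eps x t -> generated n kappa eps x t (psi z).
Proof.
move=> rp; elim/quiver_hecke_ind: z => [i|p|a|c|u v IHu IHv|u v IHu IHv].
- rewrite (rep_e rp); suff H k : (k <= n)%N -> generated n kappa eps x t (pre eps k (letters i0 i)).
    exact: H.
  elim: k => [|k IH] kn; first by rewrite pre0; apply: gen1.
  by rewrite preS; apply: genM; [apply: IH; lia|apply: gen_eps].
- by rewrite (rep_x rp); apply: gen_x.
- by rewrite (rep_t rp); apply: gen_t; rewrite -ltn_predRL.
- by rewrite (rep_kappa rp); apply: gen_kappa.
- by rewrite rmorphD; apply: genD.
- by rewrite rmorphM; apply: genM.
Qed.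

End Maps.
End Representations.

(** * The residue map *)

Section Laurent.
Variable A : pzRingType.
Local Notation laurent := (rend int A).

(** Laurent series in y with coefficients in A, realised as operators on families
    indexed by the integers: A acts by left multiplication and y by the shift.  For
    a nilpotent X, the inverse of y - X is then a finite sum. *)
Definition embed (a : A) : laurent := rend_diag (fun=> a).

Fact embed_zmod : zmod_morphism embed.
Proof. by move=> a b; rewrite /embed -rend_diagB. Qed.
HB.instance Definition _ := GRing.isZmodMorphism.Build A laurent embed embed_zmod.
Fact embed_monoid : monoid_morphism embed.
Proof. by split=> [|a b]; [exact: rend_diag1|rewrite /embed rend_diagM]. Qed.
HB.instance Definition _ := GRing.isMonoidMorphism.Build A laurent embed embed_monoid.

Fact shift_subproof (s : int) : @right_linear int A (fun v k => v (k - s)).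
Proof. by split. Qed.
Definition shift s : laurent := Rend (shift_subproof s).

Lemma shiftD r s : shift r * shift s = shift (r + s).
Proof. by apply: rend_ext => v k; rewrite rendE_mul /= opprD addrA. Qed.
Lemma shift0 : shift 0 = 1.
Proof. by apply: rend_ext => v k; rewrite /= subr0. Qed.
Lemma shift_embed s a : shift s * embed a = embed a * shift s.
Proof. by apply: rend_ext. Qed.

Definition one_at0 (k : int) : A := (k == 0)%:R.
(** The coefficient of y^(-1), read off the image of the constant series 1. *)
Definition res (u : laurent) : A := u one_at0 (- 1).

Lemma res_embed_l a u : res (embed a * u) = a * res u.
Proof. by []. Qed.
Lemma res_embed_r a u : res (u * embed a) = res u * a.
Proof.
rewrite /res rendE_mul -[RHS]/((fun k => u one_at0 k * a) (- 1)) -rendMr.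
by congr (u _ _); apply: funext => k; rewrite /= /one_at0 -natr_comm.
Qed.
Lemma resB u v : res (u - v) = res u - res v.
Proof. by []. Qed.

(** No pole at y = 0. *)
Definition regular (u : laurent) := forall k, k < 0 -> u one_at0 k = 0.

Lemma regular_res u : regular u -> res u = 0. Proof. by apply. Qed.
Lemma regular0 : regular 0. Proof. by []. Qed.
Lemma regular1 : regular 1.
Proof. by move=> k k0; rewrite rendE_one /one_at0 lt_eqF. Qed.
Lemma regularB u v : regular u -> regular v -> regular (u - v).
Proof. by move=> ru rv k k0; rewrite rendE_sub ru // rv // subr0. Qed.
Lemma regularN u : regular u -> regular (- u).
Proof. by move=> ru k k0; rewrite rendE_opp ru // oppr0. Qed.
Lemma regularD u v : regular u -> regular v -> regular (u + v).
Proof. by move=> ru rv k k0; rewrite rendE_add ru // rv // addr0. Qed.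
Lemma regular_embed a u : regular u -> regular (embed a * u).
Proof. by move=> ru k k0; rewrite rendE_mul /= ru // mulr0. Qed.
Lemma regular_shift u : regular u -> regular (shift 1 * u).
Proof. by move=> ru k k0; rewrite rendE_mul /= ru //; lia. Qed.

(** Expanded in descending powers of y, the series f starts with a y^r. *)
Definition lead (r : int) (a : A) (f : int -> A) := f r = a /\ forall k, r < k -> f k = 0.

Lemma lead_root r a f X : lead r a f -> lead (r + 1) a ((shift 1 - embed X) f).
Proof.
case=> fr f0; split=> [|k rk]; rewrite rendE_sub /=.
  by rewrite addrK fr f0 ?mulr0 ?subr0 //; lia.
by rewrite !f0 ?mulr0 ?subr0 //; lia.
Qed.

Section Inverse.
Variables (X : A) (M : nat).
Hypothesis XM : X ^+ M = 0.
Let u := embed X * shift (- 1).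
Definition inverse_root : laurent := (\sum_(m < M) u ^+ m) * shift (- 1).

Let uM : u ^+ M = 0.
Proof.
have E : embed X ^+ M = 0 by rewrite -(rmorphXn (embed : {rmorphism A -> laurent})) XM rmorph0.
rewrite /u exprMn_comm; last exact/commr_sym/shift_embed.
by rewrite E mul0r.
Qed.

Let geom : (1 - u) * \sum_(m < M) u ^+ m = 1.
Proof. by apply: oppr_inj; rewrite -mulNr opprB -subrX1 uM sub0r. Qed.

Let geom' : (\sum_(m < M) u ^+ m) * (1 - u) = 1.
Proof.
rewrite -[RHS]geom mulr_suml mulr_sumr; apply: eq_bigr => m _.
by rewrite mulrBl mulrBr mul1r mulr1 -exprS -exprSr.
Qed.

Lemma inverse_root_l : inverse_root * (shift 1 - embed X) = 1.
Proof.
rewrite /inverse_root -mulrA mulrBr shiftD addNr shift0 shift_embed.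
exact: geom'.
Qed.

Lemma inverse_root_r : (shift 1 - embed X) * inverse_root = 1.
Proof.
have -> : shift 1 - embed X = shift 1 * (1 - u).
  by rewrite mulrBr mulr1 /u mulrA shift_embed -mulrA shiftD subrr shift0 mulr1.
by rewrite /inverse_root mulrA -[_ * _ * \sum_(_ < _) _]mulrA geom mulr1 shiftD subrr shift0.
Qed.

(** The coefficients of h = (y - X)^(-1) f satisfy h_(k-1) = f_k + X h_k; beyond the
    degree of f this makes each of them a multiple of every power of X. *)
Lemma lead_inverse r a f : lead r a f -> lead (r - 1) a (inverse_root f).
Proof.
case=> fr f0; set h := inverse_root f.
have E k : h (k - 1) = f k + X * h k.
  have := congr1 (fun z : laurent => z f k) inverse_root_r.
  rewrite /= -[LHS]/(h (k - 1) - X * h k) => <-.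
  by rewrite subrK.
have h0 k m : r <= k -> h k = X ^+ m * h (k + m%:Z).
  elim: m => [|m IH] rk; first by rewrite mul1r addr0.
  rewrite IH // exprSr -mulrA; congr (_ * _).
  have := E (k + m.+1%:Z); rewrite f0 ?add0r; last by lia.
  by move=> <-; congr h; lia.
have hr k : r <= k -> h k = 0 by move=> rk; rewrite (h0 k M rk) XM mul0r.
split=> [|k rk]; first by rewrite E fr hr // mulr0 addr0.
by apply: hr; lia.
Qed.

End Inverse.
End Laurent.

Section Residue.
Variables (K : fieldType) (I : finType) (arr : rel I) (i0 : I) (N : nat) (A : pzRingType).
Hypothesis arrI : forall i, ~~ arr i i.
Hypothesis arrN : forall i j, arr i j -> ~~ arr j i.
Variables (kappa : {rmorphism K -> A}) (eps : nat -> I -> A) (x t : nat -> A).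
Hypothesis R : klr arr N eps x t.
Hypothesis kappa_eps : forall j p d, (p < N)%N -> kappa j * eps p d = eps p d * kappa j.
Hypothesis kappa_x : forall j p, (p < N)%N -> kappa j * x p = x p * kappa j.
Hypothesis kappa_t : forall j a, (a.+1 < N)%N -> kappa j * t a = t a * kappa j.
Variable L : I -> nat.
Hypothesis cyc : (0 < N)%N -> \sum_d x 0 ^+ L d * eps 0 d = 0.
Variable M : nat.
Hypothesis xM : forall p, (p < N)%N -> x p ^+ M = 0.
Variable c : I.

(* The insertion of a strand of colour c, with y the shift of Laurent series. *)
Let eps' p d : rend int A := embed (eps p d).
Let x' p : rend int A := embed (x p).
Let t' a : rend int A := embed (t a).
Let kappa' j : rend int A := embed (kappa j).
Let y : rend int A := shift A 1.
Let g p : rend int A := inverse_root (x p) M.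

Let R' : klr arr N eps' x' t'. Proof. exact: (klr_rmorph (@embed A) R). Qed.
Let y_eps p d : (p < N)%N -> y * eps' p d = eps' p d * y. Proof. by move=> _; apply: shift_embed. Qed.
Let y_x p : (p < N)%N -> y * x' p = x' p * y. Proof. by move=> _; apply: shift_embed. Qed.
Let y_t a : (a.+1 < N)%N -> y * t' a = t' a * y. Proof. by move=> _; apply: shift_embed. Qed.
Let gl p : (p < N)%N -> g p * (y - x' p) = 1. Proof. by move=> pN; apply: inverse_root_l; apply: xM. Qed.
Let gr p : (p < N)%N -> (y - x' p) * g p = 1. Proof. by move=> pN; apply: inverse_root_r; apply: xM. Qed.
Let kappa_eps' j p d : (p < N)%N -> kappa' j * eps' p d = eps' p d * kappa' j.
Proof. by move=> pN; rewrite -!rmorphM kappa_eps. Qed.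
Let kappa_x' j p : (p < N)%N -> kappa' j * x' p = x' p * kappa' j.
Proof. by move=> pN; rewrite -!rmorphM kappa_x. Qed.
Let kappa_t' j a : (a.+1 < N)%N -> kappa' j * t' a = t' a * kappa' j.
Proof. by move=> aN; rewrite -!rmorphM kappa_t. Qed.
Let kappa_y j : kappa' j * y = y * kappa' j. Proof. by rewrite shift_embed. Qed.

Local Notation E := (sE N eps' c).
Local Notation X := (sX N x' y).
Local Notation T := (sT arr N eps' x' t' c y g).
Local Notation SK := (sK N kappa').
Local Notation tr := (weighted eps' (trace_weight arr x' c y g)).
Local Notation rising := (weighted eps' (rising_weight arr x' c y g)).
Local Notation falling := (weighted eps' (falling_weight c g)).
Local Notation unitw := (weighted eps' (unit_weight arr (rend int A) c)).
Let RR := strand_klr arrI arrN R' c y_eps y_x y_t gl gr.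

Fact sK_zmod : zmod_morphism SK.
Proof. by move=> a b; rewrite /sK rend_diagB; apply: rend_diag_ext => k; rewrite /kappa' !rmorphB. Qed.
HB.instance Definition _ := GRing.isZmodMorphism.Build K (rend 'I_N.+1 (rend int A)) SK sK_zmod.
Fact sK_monoid : monoid_morphism SK.
Proof.
split=> [|a b]; first by rewrite -rend_diag1; apply: rend_diag_ext => k; rewrite /kappa' !rmorph1.
by rewrite /sK rend_diagM; apply: rend_diag_ext => k; rewrite /kappa' !rmorphM.
Qed.
HB.instance Definition _ := GRing.isMonoidMorphism.Build K (rend 'I_N.+1 (rend int A)) SK sK_monoid.

Lemma strand_representation : exists rho : {rmorphism quiver_hecke K arr N.+1 -> rend 'I_N.+1 (rend int A)},
  represents i0 rho SK E X T.
Proof.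
apply: (representation i0 arrN RR) => [j p d pN|j p pN|j a aN].
- exact: (sK_sE c kappa_eps').
- exact: (sK_sX kappa_x' kappa_y).
- exact: (sK_sT arr c gl gr kappa_eps' kappa_x' kappa_t' kappa_y).
Qed.

(** Operators that do not move a new strand sitting to the right of all old ones. *)
Definition acts (u : rend 'I_N.+1 (rend int A)) (a : rend int A) : Prop :=
  (forall v, u v ord_max = a * v ord_max) /\
  (forall v, (forall k, k != ord_max -> v k = 0) -> forall k, k != ord_max -> u v k = 0).

Lemma acts1 : acts 1 1. Proof. by split=> // v; rewrite mul1r. Qed.
Lemma actsD u v a b : acts u a -> acts v b -> acts (u + v) (a + b).
Proof.
move=> [ua u0] [vb v0]; split=> [w|w w0 k k0]; first by rewrite rendE_add ua vb mulrDl.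
by rewrite rendE_add u0 // v0 // addr0.
Qed.
Lemma actsM u v a b : acts u a -> acts v b -> acts (u * v) (a * b).
Proof.
move=> [ua u0] [vb v0]; split=> [w|w w0 k k0]; first by rewrite rendE_mul ua vb mulrA.
by rewrite rendE_mul; apply: u0 => // j j0; apply: v0.
Qed.
Lemma acts_diag (u : 'I_N.+1 -> rend int A) a : u ord_max = a -> acts (rend_diag u) a.
Proof. by move=> ua; split=> [v|v v0 k k0] /=; rewrite ?ua // v0 // mulr0. Qed.

Lemma acts_E p d : (p < N)%N -> acts (E p d) (eps' p d).
Proof.
by move=> pN; apply: acts_diag; rewrite /ecomp /= /unb; case: eqP => [|_]; [lia|rewrite pN].
Qed.
Lemma acts_X p : (p < N)%N -> acts (X p) (x' p).
Proof.
by move=> pN; apply: acts_diag; rewrite /xcomp /= /unb; case: eqP => [|_]; [lia|rewrite pN].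
Qed.
Lemma acts_K j : acts (SK j) (kappa' j). Proof. exact: acts_diag. Qed.
Lemma acts_T a : (a.+1 < N)%N -> acts (T a) (t' a).
Proof.
move=> aN; split=> [v|v v0 k k0].
  rewrite sT_at Ocomp_far ?Dcomp_far /= ?mul0r ?addr0 ?inord_val; try lia.
  have -> : unb N a = a by rewrite /unb; case: ifP => //; lia.
  by congr (_ * v _); apply: val_inj; rewrite /= inordK.
have kN := ltn_ord k; have kN' : (k != N :> nat) by apply: contraNneq k0 => kN'; apply/eqP/val_inj.
rewrite sT_at inord_val v0 // mulr0 add0r v0 ?mulr0 //.
apply: contraNneq kN' => /(congr1 val); rewrite /= inordK ?ltnS; last by apply: swp_le; lia.
by rewrite /swp; case: ifP => ?; [|case: ifP => ?]; lia.
Qed.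

Section Theta.
Variable phi : {rmorphism quiver_hecke K arr N -> A}.
Hypothesis phiE : represents i0 phi kappa eps x t.
Variable iota : {rmorphism quiver_hecke K arr N -> quiver_hecke K arr N.+1}.
Hypothesis iotaE : represents i0 iota (qh_scalar arr N.+1)
  (qeps i0 idfun) (qx idfun) (qt (idfun : quiver_hecke K arr N.+1 -> _)).
Variable rho : {rmorphism quiver_hecke K arr N.+1 -> rend 'I_N.+1 (rend int A)}.
Hypothesis rhoE : represents i0 rho SK E X T.

Lemma rho_eps p d : (p <= N)%N -> rho (qeps i0 idfun p d) = E p d.
Proof. by move=> pN; rewrite rmorph_sum -(rep_eps rhoE). Qed.
Lemma rho_x p : (p <= N)%N -> rho (qx idfun p) = X p.
Proof.
by move=> pN; rewrite -[p]/(nat_of_ord (Ordinal (pN : (p < N.+1)%N))) qxE (rep_x rhoE).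
Qed.
Lemma rho_t a : (a < N)%N -> rho (qt idfun a) = T a.
Proof.
by move=> aN; rewrite -[a]/(nat_of_ord (Ordinal (aN : (a < N.+1.-1)%N))) qtE (rep_t rhoE).
Qed.

(** An element of R_N does not touch the last strand of R_(N+1). *)
Lemma acts_iota z : acts (rho (iota z)) (embed (phi z)).
Proof.
elim/quiver_hecke_ind: z => [i|p|a|j|u v hu hv|u v hu hv].
- rewrite (rep_e iotaE) (rep_e phiE).
  suff H k : (k <= N)%N -> acts (rho (pre (qeps i0 idfun) k (letters i0 i))) (embed (pre eps k (letters i0 i))).
    exact: H.
  elim: k => [|k IH] kN; first by rewrite !pre0 !rmorph1; apply: acts1.
  rewrite !preS [rho _]rmorphM [embed _]rmorphM; apply: actsM; first by apply: IH; lia.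
  by rewrite rho_eps; [apply: acts_E|lia].
- by rewrite (rep_x iotaE) (rep_x phiE) rho_x; [apply: acts_X|apply: ltnW].
- have aN : (a.+1 < N)%N by rewrite -ltn_predRL.
  by rewrite (rep_t iotaE) (rep_t phiE) rho_t; [apply: acts_T|lia].
- by rewrite (rep_kappa iotaE) (rep_kappa phiE) (rep_kappa rhoE); apply: acts_K.
- by rewrite !rmorphD; apply: actsD.
by rewrite [iota _]rmorphM [rho _]rmorphM [phi _]rmorphM [embed _]rmorphM; apply: actsM.
Qed.

Definition top_vector (k : 'I_N.+1) : rend int A := (k == ord_max)%:R.

(** The Laurent series by which a value in the last copy is multiplied before the
    residue is taken: it cancels the factors that the new strand collects on its
    way from the right end to the left end and back, together with the factor
    y^(L c) given by the cyclotomic element at the left end. *)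
Definition trace_factor_total : rend int A := \prod_(p < N) tr p * shift A (- (L c)%:Z).

Definition theta (z : quiver_hecke K arr N.+1) : A :=
  res (trace_factor_total * rho z top_vector ord_max).

Lemma thetaB z z' : theta (z - z') = theta z - theta z'.
Proof. by rewrite /theta [rho _]rmorphB rendE_sub mulrBr resB. Qed.

Lemma theta_iota_r z a : theta (z * iota a) = theta z * phi a.
Proof.
have [top supp] := acts_iota a; rewrite /theta [rho _]rmorphM rendE_mul.
have -> : rho (iota a) top_vector = fun k => top_vector k * embed (phi a).
  apply: funext => k; have [->|k0] := eqVneq k ord_max.
    by rewrite top /top_vector eqxx mulr1 mul1r.
  rewrite [RHS]( _ : _ = 0) ?supp // => [j j0|]; rewrite /top_vector.
    by rewrite (negPf j0).
  by rewrite (negPf k0) mul0r.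
by rewrite rendMr mulrA res_embed_r.
Qed.

(** The trace factor is symmetric in the dots, hence central with respect to the
    old strands. *)
Lemma total_generated u : generated N kappa' eps' x' t' u ->
  trace_factor_total * u = u * trace_factor_total.
Proof.
have tt := sym_tame (balanced_trace R' c y_eps y_x y_t gl gr).
have tp : torus N eps' x' y g (\prod_(p < N) tr p).
  by apply: torus_prod => p pN; apply: (torus_weighted tt).
move=> gu; have -> : u * trace_factor_total = \prod_(p < N) tr p * u * shift A (- (L c)%:Z).
  rewrite mulrA; congr (_ * _).
  elim: gu => [p d pN|p pN|a aN|j||u1 u2 _ E1 _ E2|u1 u2 _ E1 _ E2].
  - by apply: (torus_comm R' y_eps y_x gl gr) => //; apply: torus_eps.
  - by apply: (torus_comm R' y_eps y_x gl gr) => //; apply: torus_x.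
  - apply: (t_prod_weighted R' y_eps y_x gl gr) => // d.
    exact: (balanced_trace R' c y_eps y_x y_t gl gr).
  - exact: (torus_kappa gl gr kappa_eps' kappa_x' kappa_y).
  - by rewrite mul1r mulr1.
  - by rewrite mulrBl mulrBr E1 E2.
  - by rewrite -mulrA E2 !mulrA E1.
rewrite -!mulrA; congr (_ * _).
elim: gu => [p d pN|p pN|a aN|j||u1 u2 _ E1 _ E2|u1 u2 _ E1 _ E2]; try exact: shift_embed.
- by rewrite mul1r mulr1.
- by rewrite mulrBl mulrBr E1 E2.
- by rewrite mulrA E1 -!mulrA E2.
Qed.

Lemma theta_iota_l z a : theta (iota a * z) = phi a * theta z.
Proof.
have [top _] := acts_iota a; rewrite /theta [rho _]rmorphM rendE_mul top mulrA.
rewrite total_generated -?mulrA ?res_embed_l //.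
have := represents_generated a phiE; elim=> [p d pN|p pN|b bN|j||u1 u2 _ E1 _ E2|u1 u2 _ E1 _ E2].
- exact: gen_eps.
- exact: gen_x.
- exact: gen_t.
- exact: gen_kappa.
- by rewrite rmorph1; apply: gen1.
- by rewrite rmorphB; apply: genB.
- by rewrite rmorphM; apply: genM.
Qed.

(** The cyclotomic element acts as y^(L c) on the copy where the new strand comes
    first; in the other copies the first strand is an old one, and the
    cyclotomic relation of A gives 0. *)
Lemma rho_cyclotomic (n_gt0 : (0 < N.+1)%N) (Lambda : weight I) : (forall d, L d = Lambda d) ->
  rho (cyclotomic_elt K arr n_gt0 Lambda) =
  @rend_diag 'I_N.+1 (rend int A) (fun k => if k == 0 :> nat then shift A (L c) else 0).
Proof.
move=> LE; have -> : rho (cyclotomic_elt K arr n_gt0 Lambda) = \sum_d X 0 ^+ L d * E 0 d.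
  rewrite /cyclotomic_elt rmorph_sum (partition_big (fun i : word I N.+1 => i (Ordinal n_gt0)) xpredT) //=.
  apply: eq_bigr => d _; rewrite -(rep_eps rhoE) // mulr_sumr.
  apply: eq_big => [i|i /eqP <-]; first by rewrite (letters_ord i0 i (Ordinal n_gt0)).
  by rewrite [rho _]rmorphM [rho _]rmorphXn (rep_x rhoE) LE.
have Xn j : X 0 ^+ j = @rend_diag 'I_N.+1 (rend int A) (fun k => xcomp x' y 0 k ^+ j).
  elim: j => [|j IH]; first by rewrite expr0 -rend_diag1.
  by rewrite exprS IH rend_diagM; apply: rend_diag_ext => k; rewrite exprS.
transitivity (@rend_diag 'I_N.+1 (rend int A) (fun k => \sum_d xcomp x' y 0 k ^+ L d * ecomp eps' c 0 d k)).
  by rewrite -rend_diag_sum; apply: eq_bigr => d _; rewrite Xn rend_diagM.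
apply: rend_diag_ext => k; rewrite /xcomp /ecomp eq_sym; case: (eqVneq (k : nat) 0) => k0.
  rewrite (bigD1 c) //= eqxx mulr1 big1 ?addr0 => [|d /negPf->]; last by rewrite mulr0.
  elim: (L c) => [|j IH]; first by rewrite shift0.
  by rewrite exprS IH /y shiftD.
have kN := ltn_ord k; have N0 : (0 < N)%N by lia.
transitivity (embed (\sum_d x 0 ^+ L d * eps 0 d)); last by rewrite cyc // rmorph0.
rewrite rmorph_sum; apply: eq_bigr => d _.
have -> : unb k 0 = 0 by rewrite /unb; case: ifP => //; lia.
by rewrite rmorphM rmorphXn.
Qed.

Lemma regular_unit p u : (p < N)%N -> regular u -> regular (unitw p * u).
Proof.
move=> pN ru; rewrite mulr_suml; apply: (big_ind (@regular A)) => [|v w|d _].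
- exact: regular0.
- exact: regularD.
have re : regular (eps' p d * u) by exact: regular_embed.
rewrite -mulrA /unit_weight; case: ifP => _; first by rewrite mulN1r; apply: regularN.
case: ifP => _; last by rewrite mul1r.
rewrite /slope mulrBl; apply: regularB; case: (arr _ _); rewrite ?mul1r ?mul0r //; exact: regular0.
Qed.

Lemma regular_units u : regular u -> regular (\prod_(p < N) unitw p * u).
Proof.
suff H k w : (k <= N)%N -> regular w -> regular (\prod_(p < k) unitw p * w) by exact: H.
elim: k w => [|k IH] w kN rw; first by rewrite big_ord0 mul1r.
by rewrite big_ord_recr /= -mulrA; apply: IH; [lia|exact: regular_unit].
Qed.

Lemma generated_rho z : generated N.+1 SK E X T (rho z).
Proof. exact: (represents_generated z rhoE). Qed.

(** Only the part of a vector at the left end survives the cyclotomic element.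
    Reaching the left end costs the rising weights, returning to the right end the
    falling weights; with the trace factor these cancel to constants, so what
    remains has no pole and its residue is 0. *)
Lemma theta_cyclotomic (n_gt0 : (0 < N.+1)%N) (Lambda : weight I) z z' :
  (forall d, L d = Lambda d) -> theta (z * cyclotomic_elt K arr n_gt0 Lambda * z') = 0.
Proof.
move=> LE; rewrite /theta [rho _]rmorphM [rho (z * _)]rmorphM rho_cyclotomic // 2!rendE_mul.
have re p d u : (p < N)%N -> regular u -> regular (eps' p d * u) by move=> _; apply: regular_embed.
have rx p u : (p < N)%N -> regular u -> regular (x' p * u) by move=> _; apply: regular_embed.
have rt a u : (a.+1 < N)%N -> regular u -> regular (t' a * u) by move=> _; apply: regular_embed.
have rk j u : regular u -> regular (kappa' j * u) by apply: regular_embed.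
have [b rb vb] : exists2 b, regular b & rho z' top_vector ord0 = \prod_(p < N) rising p * (1 * b).
  apply: (rising_image arrI arrN R' y_eps y_x y_t gl gr kappa_eps' kappa_x' kappa_t' kappa_y
    (@regular0 A) (@regularB A) re rx rt rk (@regular_shift A) _ _ _ _ _ (generated_rho z')).
  - by move=> p d _; rewrite mul1r mulr1.
  - by move=> p _; rewrite mul1r mulr1.
  - by move=> a _; rewrite mul1r mulr1.
  - by move=> j; rewrite mul1r mulr1.
  - by rewrite mul1r mulr1.
  split=> [k kN|]; rewrite /top_vector.
    by case: eqP => // kE; rewrite kE eqxx in kN.
  exists 1; [exact: regular1|rewrite mulr1].
  by case: eqP => // [[]]; apply: val_inj; rewrite /= inordK.
have sr := balanced_rising R' c y_eps y_x y_t gl gr.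
have tR : torus N eps' x' y g (\prod_(p < N) rising p).
  by apply: torus_prod => p pN; apply: (torus_weighted (sym_tame sr)).
have ty : torus N eps' x' y g y := torus_y _ _ _ _ _.
pose Y := shift A (L c) * \prod_(p < N) rising p.
have tY : torus N eps' x' y g Y.
  apply: torusM => //; elim: (L c) => [|j IH]; first by rewrite shift0; apply: torus1.
  by rewrite -[j.+1]addn1 PoszD -shiftD; apply: torusM.
have tC := torus_comm R' y_eps y_x gl gr.
have [b' rb' ->] : exists2 b', regular b' &
    rho z (rend_diag (fun k : 'I_N.+1 => if k == 0 :> nat then shift A (L c) else 0) (rho z' top_vector)) ord_max
    = \prod_(p < N) falling p * (Y * b').
  apply: (falling_image arrI arrN R' y_eps y_x y_t gl gr kappa_eps' kappa_x' kappa_t' kappa_y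
    (@regular0 A) (@regularB A) re rx rt rk (@regular_shift A) _ _ _ _ _ (generated_rho z)).
  - by move=> p d pN; apply: tC => //; apply: torus_eps.
  - by move=> p pN; apply: tC => //; apply: torus_x.
  - move=> a aN; rewrite /Y -mulrA -(t_prod_weighted R' y_eps y_x gl gr sr aN) !mulrA.
    by rewrite shift_embed.
  - by move=> j; apply: (torus_kappa gl gr kappa_eps' kappa_x' kappa_y).
  - exact: tC.
  split=> [k /negPf k0|] /=; first by rewrite k0 mul0r.
  exists b => //; rewrite inordK // eqxx /Y -mulrA -[b in RHS]mul1r -vb.
  by congr (_ * rho z' _ _); apply: val_inj; rewrite /= inordK.
apply: regular_res; rewrite /trace_factor_total.
have -> : \prod_(p < N) tr p * shift A (- (L c)%:Z) * (\prod_(p < N) falling p * (Y * b'))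
   = \prod_(p < N) unitw p * b'.
  rewrite -(trace_cancel arrN R' c y_eps y_x y_t gl gr) -!mulrA; congr (_ * _).
  have sf := balanced_falling R' c y_eps y_x y_t gl gr.
  have tF : torus N eps' x' y g (\prod_(p < N) falling p).
    by apply: torus_prod => p pN; apply: (torus_weighted (sym_tame sf)).
  rewrite /Y !mulrA; congr (_ * _ * _).
  have E1 : \prod_(p < N) falling p * shift A (L c) = shift A (L c) * \prod_(p < N) falling p.
    apply: tC => //; elim: (L c) => [|j IH]; first by rewrite shift0; apply: torus1.
    by rewrite -[j.+1]addn1 PoszD -shiftD; apply: torusM.
  by rewrite -mulrA E1 mulrA shiftD addNr shift0 mul1r.
exact: regular_units.
Qed.

Lemma prod_weighted_pre (W : I -> nat -> rend int A) (w : nat -> I) k :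
  tame N eps' x' y g W -> (k <= N)%N ->
  \prod_(p < k) weighted eps' W p * embed (pre eps N w)
  = \prod_(p < k) W (w p) p * embed (pre eps N w).
Proof.
move=> tW; have tC := torus_comm R' y_eps y_x gl gr.
have tp : torus N eps' x' y g (embed (pre eps N w)).
  rewrite /pre rmorph_prod; apply: (torus_prod (F := fun p => eps' p (w p))) => p pN.
  exact: torus_eps.
elim: k => [|k IH] kN; first by rewrite !big_ord0.
rewrite !big_ord_recr /= -[LHS]mulrA -[RHS]mulrA.
have -> : weighted eps' W k * embed (pre eps N w) = W (w k) k * embed (pre eps N w).
  rewrite mulr_suml (bigD1 (w k)) //= -mulrA -rmorphM (eps_pre R) // eqxx big1 ?addr0 //.
  by move=> d /negPf dk; rewrite -mulrA -rmorphM (eps_pre R) // eq_sym dk rmorph0 mulr0.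
have EW : W (w k) k * embed (pre eps N w) = embed (pre eps N w) * W (w k) k.
  by apply: tC => //; apply: tW.
by rewrite EW !mulrA IH //; lia.
Qed.

(** The degree in y of the trace factor on the word w. *)
Definition degree (w : nat -> I) k : int :=
  2 * (\sum_(p < k) (w p == c))%N%:Z - (\sum_(p < k) adj arr c (w p))%N%:Z.

Lemma lead_trace (w : nat -> I) k r a f : (k <= N)%N -> lead r a f ->
  lead (r + degree w k) a ((\prod_(p < k) trace_weight arr x' c y g (w p) p) f).
Proof.
elim: k r f => [|k IH] r f kN fr.
  by rewrite /degree !big_ord0 (_ : r + _ = r) //; lia.
rewrite big_ord_recr rendE_mul /=.
have -> : r + degree w k.+1 = r + (2 * (w k == c)%:Z - (adj arr c (w k))%:Z) + degree w k.
  by rewrite /degree !big_ord_recr /= !PoszD; lia.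
apply: IH; first by lia.
rewrite /trace_weight; case: (eqVneq (w k) c) => [->|wk].
  have -> : adj arr c c = false by rewrite /adj (negPf (arrI c)).
  rewrite (_ : r + _ = r + 1 + 1); last by lia.
  rewrite rendE_mul; apply: lead_root.
  exact: lead_root.
case: (adj _ _ _); last by rewrite (_ : r + _ = r) //; lia.
rewrite (_ : r + _ = r - 1); last by lia.
by apply: lead_inverse => //; apply: xM.
Qed.

(** In descending powers of y the trace factor on the word w starts with
    y^(degree - L c); the exponent of the dot is the one that moves the leading
    term to y^(-1). *)
Lemma theta_lead (w : nat -> I) j :
  (L c + \sum_(p < N) adj arr c (w p) = 2 * \sum_(p < N) (w p == c) + j.+1)%N ->
  theta (qx idfun N ^+ j * qeps i0 idfun N c) * pre eps N w = pre eps N w.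
Proof.
move=> kE; rewrite /theta -res_embed_r.
have XN i u : ((X N ^+ i) u) ord_max = shift A i%:Z * u ord_max.
  elim: i => [|i IH]; first by rewrite expr0 rendE_one shift0 mul1r.
  by rewrite exprS rendE_mul /= /xcomp eqxx IH mulrA shiftD.
have -> : rho (qx idfun N ^+ j * qeps i0 idfun N c) top_vector ord_max = shift A j%:Z.
  rewrite [rho _]rmorphM [rho (_ ^+ j)]rmorphXn rho_eps // rho_x // rendE_mul XN.
  by rewrite /= /ecomp !eqxx /top_vector eqxx !mulr1.
rewrite /trace_factor_total -[_ * shift A j%:Z]mulrA shiftD -mulrA shift_embed mulrA.
rewrite prod_weighted_pre //; last exact: sym_tame (balanced_trace R' c y_eps y_x y_t gl gr).
rewrite /res -mulrA rendE_mul.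
have f1 : lead (- (L c)%:Z + j%:Z) (pre eps N w)
    ((embed (pre eps N w) * shift A (- (L c)%:Z + j%:Z)) (@one_at0 A)).
  split=> [|k rk]; rewrite rendE_mul /= /one_at0; first by rewrite subrr mulr1.
  by rewrite subr_eq0 gt_eqF ?mulr0.
have [] := lead_trace w (leqnn N) f1.
have -> : - (L c)%:Z + j%:Z + degree w N = - 1 by rewrite /degree; lia.
by [].
Qed.

End Theta.

(** A substitute for the trace form of the tower of cyclotomic algebras.  If A is a
    representation of R_N satisfying the cyclotomic relation, then adding a strand
    of colour c gives a map from R_(N+1) to A that is linear over R_N on both
    sides, vanishes on the cyclotomic ideal, and sends x^(k-1) on the added strand
    to 1 on every word for which
      k = L c + (number of neighbours of c) - 2 (number of letters c)
    is positive. *)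
Lemma residue_map (phi : {rmorphism quiver_hecke K arr N -> A})
    (iota : {rmorphism quiver_hecke K arr N -> quiver_hecke K arr N.+1}) :
  represents i0 phi kappa eps x t ->
  represents i0 iota (qh_scalar arr N.+1) (qeps i0 idfun)
    (qx idfun) (qt (idfun : quiver_hecke K arr N.+1 -> _)) ->
  exists theta : quiver_hecke K arr N.+1 -> A,
  [/\ forall z z', theta (z - z') = theta z - theta z',
      forall a z, theta (iota a * z) = phi a * theta z,
      forall a z, theta (z * iota a) = theta z * phi a,
      forall (n_gt0 : (0 < N.+1)%N) (Lambda : weight I) z z', (forall d, L d = Lambda d) ->
        theta (z * cyclotomic_elt K arr n_gt0 Lambda * z') = 0 &
      forall (w : nat -> I) j,
        (L c + \sum_(p < N) adj arr c (w p) = 2 * \sum_(p < N) (w p == c) + j.+1)%N ->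
        theta (qx idfun N ^+ j * qeps i0 idfun N c) * pre eps N w = pre eps N w].
Proof.
move=> phiE iotaE; have [rho rhoE] := strand_representation.
exists (theta rho); split.
- exact: thetaB.
- by move=> a z; apply: theta_iota_l.
- by move=> a z; apply: theta_iota_r.
- by move=> n_gt0 Lambda z z'; apply: theta_cyclotomic.
- by move=> w j; apply: theta_lead.
Qed.

End Residue.

(** * The cyclotomic quotient *)

Lemma ideal_vanish (F : pzRingType) (S : F -> Prop) (D : zmodType) (theta : F -> D) z :
  (forall u v, theta (u - v) = theta u - theta v) ->
  (forall s, S s -> forall u v, theta (u * s * v) = 0) -> in_ideal S z -> theta z = 0.
Proof.
move=> tB tc zI; suff H u v : theta (u * z * v) = 0 by have := H 1 1; rewrite mul1r mulr1.
elim: zI u v => [s Ss u v|u v|a b _ Ha _ Hb u v|a b _ Hb u v|a b _ Hb u v].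
- exact: tc.
- by rewrite mulr0 mul0r; have := tB 0 0; rewrite !subrr.
- by rewrite mulrBr mulrBl tB Ha Hb subrr.
- by rewrite mulrA Hb.
- by rewrite mulrA -mulrA Hb.
Qed.

Section ScalarMorphism.
Variables (K : fieldType) (I : finType) (arr : rel I) (n : nat).
Local Notation S := (@qh_scalar K I arr n).
Fact qh_scalar_zmod : zmod_morphism S.
Proof. by move=> c d; rewrite /qh_scalar scalerBl; exact: rmorphB. Qed.
HB.instance Definition _ := GRing.isZmodMorphism.Build K (quiver_hecke K arr n) S qh_scalar_zmod.
Fact qh_scalar_monoid : monoid_morphism S.
Proof.
split=> [|c d]; first by rewrite /qh_scalar scale1r; exact: rmorph1.
rewrite -[RHS](rmorphM (ring_pi _)); congr (ring_pi _ _).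
by rewrite -scalerAl mul1r scalerA.
Qed.
HB.instance Definition _ := GRing.isMonoidMorphism.Build K (quiver_hecke K arr n) S qh_scalar_monoid.
End ScalarMorphism.

Section Inclusion.
Variables (K : fieldType) (I : finType) (arr : rel I) (i0 : I).
Hypothesis arrN : forall i j, arr i j -> ~~ arr j i.

Lemma inclusion N : exists iota : {rmorphism quiver_hecke K arr N -> quiver_hecke K arr N.+1},
  represents i0 iota (@qh_scalar K I arr N.+1) (qeps i0 idfun) (qx idfun)
    (qt (idfun : quiver_hecke K arr N.+1 -> _)).
Proof.
have R := klr_restrict (leqnSn N) (quiver_hecke_klr i0 arrN (idfun : {rmorphism quiver_hecke K arr N.+1 -> _})).
apply: (representation (kappa := @qh_scalar K I arr N.+1) i0 arrN R) => *; exact: qh_scalar_comm.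
Qed.

Section Cyclotomic.
Variables (n : nat) (hn : (0 < n)%N) (Lambda : weight I).
Local Notation C := (cyclotomic_quiver_hecke K arr hn Lambda).
Definition cpi : {rmorphism quiver_hecke K arr n -> C} := ring_pi _.
Definition ceps : nat -> I -> C := qeps i0 cpi.
Definition cx : nat -> C := qx cpi.
Definition ct : nat -> C := qt cpi.
Local Notation ckappa := (@cqh_scalar K I arr n hn Lambda).

Lemma cyclotomic_klr : klr arr n ceps cx ct.
Proof. exact: quiver_hecke_klr. Qed.

Lemma cyclotomic_represents : represents i0 cpi ckappa ceps cx ct.
Proof. exact: represents_self. Qed.

Lemma cyclotomic_relation : \sum_d cx 0 ^+ Lambda d * ceps 0 d = 0.
Proof.
transitivity (cpi (cyclotomic_elt K arr hn Lambda)); last first.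
  rewrite -(rmorph0 cpi); apply/ring_pi_eq; rewrite subr0; apply/idealP.
  exact: in_ideal_gen.
rewrite /cyclotomic_elt [RHS]rmorph_sum.
rewrite [RHS](partition_big (fun i : word I n => i (Ordinal hn)) xpredT) //=.
apply: eq_bigr => d _; rewrite mulr_sumr.
apply: eq_big => [i|i /eqP Ei]; first by rewrite (letters_ord i0 i (Ordinal hn)).
rewrite [RHS]rmorphM [cpi (_ ^+ _)]rmorphXn -(qxE cpi) -Ei.
by rewrite (letters_ord i0 i (Ordinal hn)).
Qed.

Lemma cpi_surj (a : C) : exists z, cpi z = a.
Proof. by exists (repr a); apply: ring_piK. Qed.

Lemma cyclotomic_generated (a : C) : generated n ckappa ceps cx ct a.
Proof. by have [z <-] := cpi_surj a; apply: (represents_generated z cyclotomic_represents). Qed.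

Lemma cyclotomic_nilpotent : (forall i, ~~ arr i i) ->
  exists M, forall p, (p < n)%N -> cx p ^+ M = 0.
Proof.
move=> arrI; suff H k : (k <= n)%N -> exists M, forall p, (p < k)%N -> cx p ^+ M = 0 by exact: H.
elim: k => [|k IH] kn; first by exists 0.
have [|M HM] := IH; first by lia.
have [M' HM'] := x_nilpotent arrI cyclotomic_klr (fun _ => cyclotomic_relation) kn.
exists (M + M')%N => p; rewrite ltnS leq_eqVlt => /orP[/eqP->|pk].
  by rewrite exprD HM' mulr0.
by rewrite exprD HM // mul0r.
Qed.

Lemma vanish_on_ideal (D : zmodType) (theta : quiver_hecke K arr n -> D) z :
  (forall u v, theta (u - v) = theta u - theta v) ->
  (forall u v, theta (u * cyclotomic_elt K arr hn Lambda * v) = 0) ->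
  cpi z = 0 -> theta z = 0.
Proof.
move=> tB tc cz; have /ring_pi_eq/idealP : cpi z = cpi 0 by rewrite cz rmorph0.
rewrite subr0; apply: (ideal_vanish tB) => s sE u v.
rewrite sE; exact: tc.
Qed.

End Cyclotomic.
End Inclusion.

(** * Nonzero words and descent of regularity *)

Section Necessity.
Variables (K : fieldType) (I : finType) (arr : rel I) (i0 : I) (Lambda : weight I).
Hypothesis arrI : forall i, ~~ arr i i.
Hypothesis arrN : forall i j, arr i j -> ~~ arr j i.

Local Notation C hn := (cyclotomic_quiver_hecke K arr hn Lambda).

Lemma cpi_qeps n (hn : (0 < n)%N) p d : cpi K arr hn Lambda (qeps i0 idfun p d) = ceps K arr i0 hn Lambda p d.
Proof. by rewrite rmorph_sum. Qed.
Lemma cpi_qx n (hn : (0 < n)%N) p : cpi K arr hn Lambda (qx idfun p) = cx K arr hn Lambda p.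
Proof. by rewrite /cx /qx; case: insubP => //; rewrite rmorph0. Qed.

Lemma rmorph_pre (A B : pzRingType) (f : {rmorphism A -> B}) (eps : nat -> I -> A) k w :
  f (pre eps k w) = pre (fun p d => f (eps p d)) k w.
Proof. by rewrite /pre rmorph_prod. Qed.

Lemma pre_last (B : pzRingType) N (eps : nat -> I -> B) x t w : klr arr N.+1 eps x t ->
  eps N (w N) * pre eps N w = pre eps N.+1 w.
Proof. by move=> R; rewrite preS (eps_preC R). Qed.

Section Step.
Variables (N : nat) (A : pzRingType).
Variables (kappa : {rmorphism K -> A}) (eps : nat -> I -> A) (x t : nat -> A).
Hypothesis R : klr arr N eps x t.
Hypothesis kappaC : forall j a, kappa j * a = a * kappa j.
Hypothesis cyc : (0 < N)%N -> \sum_d x 0 ^+ Lambda d * eps 0 d = 0.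
Variable M : nat.
Hypothesis xM : forall p, (p < N)%N -> x p ^+ M = 0.

(** If the element of R_(N+1) vanished in the cyclotomic quotient, so would its
    image under the residue map, which is the idempotent of the shorter word. *)
Lemma nonvanishing_step (w : nat -> I) j :
  (Lambda (w N) + \sum_(p < N) adj arr (w N) (w p) = 2 * \sum_(p < N) (w p == w N) + j.+1)%N ->
  pre eps N w != 0 ->
  cx K arr (ltn0Sn N) Lambda N ^+ j * pre (ceps K arr i0 (ltn0Sn N) Lambda) N.+1 w != 0.
Proof.
move=> kE; apply: contraNneq => z0.
have [phi phiE] : exists phi : {rmorphism quiver_hecke K arr N -> A}, represents i0 phi kappa eps x t.
  by apply: (representation i0 arrN R) => *; apply: kappaC.
have [iota iotaE] := inclusion K i0 arrN N.
have [|||th [tB tl tr tc tv]] := residue_map arrI arrN R _ _ _ cyc xM (w N) phiE iotaE;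
  try by move=> *; apply: kappaC.
pose z := qx idfun N ^+ j * qeps i0 idfun N (w N) * iota (qh_e K arr [ffun p : 'I_N => w p]).
have lw p : (p < N)%N -> letters i0 [ffun p : 'I_N => w p] p = w p.
  by move=> pN; rewrite -[p]/(nat_of_ord (Ordinal pN)) letters_ord ffunE.
have : th z = 0.
  apply: (vanish_on_ideal tB (hn := ltn0Sn N) (Lambda := Lambda)) => [u v|]; first exact: tc.
  have Rc := cyclotomic_klr K i0 arrN (ltn0Sn N) Lambda.
  rewrite /z rmorphM [cpi _ _ _ _ (_ * _)]rmorphM rmorphXn cpi_qx cpi_qeps (rep_e iotaE).
  rewrite rmorph_pre (_ : pre _ N _ = pre (ceps K arr i0 (ltn0Sn N) Lambda) N w).
    rewrite -[LHS]mulrA -[RHS]z0; congr (_ * _).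
    exact: (pre_last w Rc).
  by apply: eq_bigr => p _; rewrite cpi_qeps lw.
by rewrite /z tr (rep_e phiE) (eq_pre _ lw) tv // => ->; rewrite eqxx.
Qed.

End Step.

(** Adding the letter w_q to its predecessors has the positive exponent bound
    k = j + 1 in the residue map. *)
Definition admissible (w : nat -> I) q j :=
  (Lambda (w q) + \sum_(p < q) adj arr (w q) (w p) = 2 * \sum_(p < q) (w p == w q) + j.+1)%N.

Local Notation cx' N := (cx K arr (ltn0Sn N) Lambda).
Local Notation ceps' N := (ceps K arr i0 (ltn0Sn N) Lambda).

Lemma klr0 : @klr I arr K 0 (fun _ _ => 0) (fun _ => 0) (fun _ => 0).
Proof. by split. Qed.

(** Adding the letters one at a time, starting from the field K as the algebra of
    rank 0. *)
Lemma nonvanishing N (w : nat -> I) j :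
  (forall q, (q < N)%N -> exists k, admissible w q k) -> admissible w N j ->
  cx' N N ^+ j * pre (ceps' N) N.+1 w != 0.
Proof.
elim: N j => [|N IH] j wq wN.
  apply: (nonvanishing_step (A := K) (kappa := idfun) klr0 _ _ (M := 0)) => //.
  - by move=> a b; rewrite mulrC.
  - by rewrite pre0 oner_neq0.
have [k hk] := wq N (ltnSn N).
have nz : pre (ceps' N) N.+1 w != 0.
  apply: contraNneq (IH k (fun q qN => wq q (ltnW qN)) hk) => ->.
  by rewrite mulr0.
have [M xM] := cyclotomic_nilpotent K i0 arrN (ltn0Sn N) Lambda arrI.
apply: (nonvanishing_step (kappa := @cqh_scalar K I arr N.+1 (ltn0Sn N) Lambda) _ _ _ xM wN nz).
- exact: cyclotomic_klr.
- exact: cqh_scalar_central.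
- by move=> _; apply: cyclotomic_relation.
Qed.

Definition von_neumann_regular (A : pzRingType) := forall a : A, exists b, a * b * a = a.

Section Central.
Variables (n : nat) (B : pzRingType) (eps : nat -> I -> B) (x t : nat -> B).
Hypothesis R : klr arr n eps x t.

(** The simplest symmetric function of the dots of colour c, and as such central. *)
Definition colour_sum c : B := \sum_(p < n) x p * eps p c.

(** Only the positions a and a + 1 matter, and there the two corrections cancel,
    because they occur for equal letters only. *)
Lemma colour_sum_t c a : (a.+1 < n)%N -> t a * colour_sum c = colour_sum c * t a.
Proof.
move=> an; have an' : (a < n)%N by lia.
pose i : 'I_n := Ordinal an'; pose j : 'I_n := Ordinal an.
have ij : j != i by apply/eqP => /(congr1 val) /=; lia.
rewrite /colour_sum (bigD1 i) //= (bigD1 j) //= addrA.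
rewrite mulrDr mulrDl; congr (_ + _); last first.
  rewrite mulr_sumr mulr_suml; apply: eq_bigr => p /andP[pi pj].
  have pa : p != a :> nat by apply: contraNneq pi => E; apply/eqP/val_inj.
  have pa' : p != a.+1 :> nat by apply: contraNneq pj => E; apply/eqP/val_inj.
  by rewrite mulrA (klr_tx R) // -!mulrA (klr_te R) // swp_id.
have tl : t a * x a = x a.+1 * t a - \sum_d eps a d * eps a.+1 d.
  by rewrite -(klr_txl R an) opprB addrC subrK.
have tr : t a * x a.+1 = x a * t a + \sum_d eps a d * eps a.+1 d.
  by rewrite -(klr_txr R an) addrC subrK.
have dd : (\sum_d eps a d * eps a.+1 d) * eps a c = (\sum_d eps a d * eps a.+1 d) * eps a.+1 c.
  apply: (eq_on_two R an) => d d'; rewrite -!mulrA (eps_two_l R) // (eps_two_r R) //.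
  case: (eqVneq c d) => [<-|cd]; case: (eqVneq c d') => [<-|cd'] //; rewrite ?mulr0 (sum_two R) //.
    by rewrite (negPf cd').
  by rewrite eq_sym (negPf cd).
rewrite /= mulrDr !mulrA tl tr mulrBl mulrDl dd addrACA addNr addr0.
rewrite -!mulrA !(klr_te R) // swp_l swp_r mulrDl -!mulrA addrC.
by [].
Qed.

Lemma colour_sum_central c (J : Type) (kappa : J -> B) z :
  (forall j b, kappa j * b = b * kappa j) -> generated n kappa eps x t z ->
  colour_sum c * z = z * colour_sum c.
Proof.
move=> kC; elim=> [p d pn|p pn|a an|j||u1 u2 _ E1 _ E2|u1 u2 _ E1 _ E2].
- rewrite mulr_suml mulr_sumr; apply: eq_bigr => q _.
  by rewrite -mulrA (klr_eC R) // !mulrA (klr_xe R).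
- rewrite mulr_suml mulr_sumr; apply: eq_bigr => q _.
  by rewrite -mulrA -(klr_xe R) // !mulrA (klr_xC R).
- by rewrite colour_sum_t.
- by rewrite kC.
- by rewrite mulr1 mul1r.
- by rewrite mulrBl mulrBr E1 E2.
- by rewrite mulrA E1 -!mulrA E2.
Qed.

Lemma colour_sum_pre c k (w : nat -> I) : (k < n)%N -> k.+1 = n -> w k = c ->
  (forall p, (p < k)%N -> w p != c) -> colour_sum c * pre eps n w = x k * pre eps n w.
Proof.
move=> kn kn1 wk wp; rewrite mulr_suml (bigD1 (Ordinal kn)) //= -mulrA (eps_pre R) // wk eqxx.
rewrite big1 ?addr0 // => p pk; rewrite -mulrA (eps_pre R) // (negPf (wp p _)) ?mulr0 //.
have pn := ltn_ord p; suff : (p : nat) != k by lia.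
by apply: contraNneq pk => E; apply/eqP/val_inj.
Qed.

End Central.

(** A central X = X b X equals b^m X^(m+1) for every m, and if X e = y e then
    X^(m+1) e = y^(m+1) e because X is central; so X e = 0 if y is nilpotent. *)
Lemma central_regular_nilpotent (B : pzRingType) (X b e y : B) m :
  (forall z, X * z = z * X) -> X * b * X = X -> X * e = y * e -> y ^+ m = 0 -> y * e = 0.
Proof.
move=> XC Xb Xe ym.
have Xm k : X = b ^+ k * X ^+ k.+1.
  elim: k => [|k IH]; first by rewrite mul1r.
  have bX : b * X * X = X by rewrite -(XC b).
  rewrite {1}IH [b ^+ k.+1]exprSr [X ^+ k.+2]exprS [X ^+ k.+1]exprS -!mulrA; congr (_ * _).
  by rewrite [RHS]mulrA [RHS]mulrA bX.
have Xme k : X ^+ k * e = y ^+ k * e.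
  elim: k => [//|k IH]; rewrite exprS -mulrA IH.
  by rewrite mulrA XC -mulrA Xe mulrA -exprSr.
by rewrite -Xe {1}(Xm m) -mulrA Xme exprS ym mulr0 mul0r mulr0.
Qed.

(** If the last letter c of w occurs once, the central sum of the dots of colour c
    acts on the idempotent of w as the last dot alone.  That dot is nilpotent, but
    not zero on this idempotent as soon as k >= 2. *)
Lemma not_regular N (w : nat -> I) j :
  (forall q, (q < N)%N -> exists k, admissible w q k) -> admissible w N j.+1 ->
  (forall p, (p < N)%N -> w p != w N) ->
  ~ von_neumann_regular (C (ltn0Sn N)).
Proof.
move=> wq wN wp reg; have nz := nonvanishing wq wN.
have R := cyclotomic_klr K i0 arrN (ltn0Sn N) Lambda.
have [M xM] := cyclotomic_nilpotent K i0 arrN (ltn0Sn N) Lambda arrI.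
pose X := colour_sum N.+1 (ceps' N) (cx' N) (w N).
have XC z : X * z = z * X.
  have gz := cyclotomic_generated i0 z.
  apply: (colour_sum_central R _ _ gz); exact: cqh_scalar_central.
have [b Xb] := reg X.
set e := pre (ceps' N) N.+1 w in nz.
have Xe : X * e = cx' N N * e by apply: (colour_sum_pre R).
have ye : cx' N N * e = 0 by apply: (central_regular_nilpotent XC Xb Xe (xM N (ltnSn N))).
by move: nz; rewrite exprSr -mulrA ye mulr0 eqxx.
Qed.

Section Selector.
Variables (n : nat) (D : pzRingType) (J : Type) (kappa : J -> D).
Variables (eps : nat -> I -> D) (x t : nat -> D).
Hypothesis R : klr arr n.+1 eps x t.
Hypothesis kappaC : forall j z, kappa j * z = z * kappa j.

(** The exponent bound k for adding the colour c to the word j, truncated at 0. *)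
Definition excess (j : word I n) c : nat :=
  (Lambda c + \sum_p adj arr c (j p) - 2 * \sum_p (j p == c))%N.

(** A colour that can be added to j.  It depends on the letters of j but not on
    their order, since the excess does not. *)
Definition choice_of (j : word I n) : option I := [pick c | (0 < excess j c)%N].

Lemma sum_sact (F : I -> nat) (a : 'I_n.-1) (j : word I n) :
  (\sum_p F (sact a j p) = \sum_p F (j p))%N.
Proof.
rewrite [RHS](reindex_inj (@perm_inj _ (tperm (lpos a) (rpos a)))) /=.
by apply: eq_bigr => p _; rewrite ffunE.
Qed.

Lemma excess_sact a j c : excess (sact a j) c = excess j c.
Proof. by rewrite /excess (sum_sact (fun d => adj arr c d : nat)) (sum_sact (fun d => (d == c) : nat)). Qed.

Lemma choice_sact a j : choice_of (sact a j) = choice_of j.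
Proof. by apply: eq_pick => c; rewrite excess_sact. Qed.

Lemma sactK a : involutive (@sact I n a).
Proof. by move=> j; apply/ffunP => p; rewrite !ffunE tpermK. Qed.

(** The elements of R_(n+1) that commute with R_n and that the residue maps, summed
    over all colours, send to 1. *)
Definition selector c : D :=
  \sum_(j | choice_of j == Some c) x n ^+ (excess j c).-1 * eps n c * pre eps n (letters i0 j).

Lemma selector_comm c z : generated n kappa eps x t z -> z * selector c = selector c * z.
Proof.
have xC k p u : (p < n.+1)%N -> x p * u = u * x p -> x p ^+ k * u = u * x p ^+ k.
  by move=> _ pu; apply/commr_sym/commrX/commr_sym.
elim=> [p d pn|p pn|a an|j||u1 u2 _ E1 _ E2|u1 u2 _ E1 _ E2].
- rewrite mulr_suml mulr_sumr; apply: eq_bigr => j _.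
  rewrite -[RHS]mulrA -(eps_preC R) ?mulrA; try lia; congr (_ * _).
  rewrite -[RHS]mulrA (klr_eC R _ d) ?mulrA; try lia; congr (_ * _).
  by rewrite xC // (klr_xe R) //; lia.
- rewrite mulr_suml mulr_sumr; apply: eq_bigr => j _.
  rewrite -[RHS]mulrA -(x_preC R) ?mulrA; try lia; congr (_ * _).
  rewrite -[RHS]mulrA -(klr_xe R) ?mulrA; try lia; congr (_ * _).
  by rewrite xC // (klr_xC R) //; lia.
- have an1 : (a < n.-1)%N by lia.
  pose a' := Ordinal an1.
  rewrite mulr_sumr [RHS]mulr_suml [RHS](reindex_inj (inv_inj (sactK a'))) /=.
  apply: eq_big => [j|j _]; first by rewrite choice_sact.
  rewrite excess_sact (eq_pre _ (fun p pn => letters_sact i0 j a' p)).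
  rewrite -[RHS]mulrA -(t_pre R) /=; try lia.
  rewrite !mulrA; congr (_ * _).
  rewrite -[RHS]mulrA -[eps n c in RHS](_ : eps (swp a n) c = _); last by rewrite swp_id //; lia.
  rewrite -(klr_te R) ?mulrA; try lia; congr (_ * _).
  by rewrite xC // (klr_tx R) //; lia.
- by rewrite kappaC.
- by rewrite mulr1 mul1r.
- by rewrite mulrBl mulrBr E1 E2.
- by rewrite -mulrA E2 !mulrA E1.
Qed.

End Selector.
Lemma additive_sum (D A : zmodType) (f : D -> A) (H : finType) (P : pred H) (F : H -> D) :
  (forall u v, f (u - v) = f u - f v) -> f (\sum_(j | P j) F j) = \sum_(j | P j) f (F j).
Proof.
move=> fB; have f0 : f 0 = 0 by have := fB 0 0; rewrite !subrr.
apply: (big_morph f _ f0) => u v.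
by rewrite -[v in LHS]opprK fB -[- v]sub0r fB f0 sub0r opprK.
Qed.

(** If iota z = iota z * d * iota z modulo the kernel of pi, multiply by S_c on the
    right, move it next to d and apply th_c.  Summing over c gives a * b * a = a with
    b the sum of the th_c (d * S_c). *)
Lemma regular_by_trace (H : finType) (Z D A B : pzRingType) (iota : {rmorphism Z -> D}) (phi : Z -> A)
    (pi : {rmorphism D -> B}) (th : H -> D -> A) (S : H -> D) :
  (forall a, exists z, phi z = a) -> (forall b, exists z, pi z = b) ->
  (forall c u v, th c (u - v) = th c u - th c v) -> (forall c z, pi z = 0 -> th c z = 0) ->
  (forall c a z, th c (iota a * z) = phi a * th c z) ->
  (forall c a z, th c (z * iota a) = th c z * phi a) ->
  (forall c z, iota z * S c = S c * iota z) -> \sum_c th c (S c) = 1 ->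
  von_neumann_regular B -> von_neumann_regular A.
Proof.
move=> phi_surj pi_surj thB th0 tl tr SC tS reg a.
have [z Ez] := phi_surj a; have [b Eb] := reg (pi (iota z)); have [d Ed] := pi_surj b.
exists (\sum_c th c (d * S c)).
have key c : a * th c (d * S c) * a = a * th c (S c).
  have /th0 : pi ((iota z * d * iota z - iota z) * S c) = 0.
    by rewrite rmorphM rmorphB !rmorphM Ed Eb subrr mul0r.
  have -> : (iota z * d * iota z - iota z) * S c = iota z * (d * S c * iota z) - iota z * S c.
    by rewrite mulrBl -!mulrA SC.
  move=> /(_ c); rewrite thB !tl tr Ez => /eqP.
  by rewrite subr_eq0 mulrA => /eqP.
by rewrite mulr_sumr mulr_suml (eq_bigr _ (fun c _ => key c)) -mulr_sumr tS mulr1.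
Qed.

Section Descent.
Hypothesis degree2 : forall d, (\sum_c adj arr c d = 2)%N.
Hypothesis Lambda0 : (0 < \sum_c Lambda c)%N.

(** Summed over the colours, the exponent bounds k add up to the sum of the
    values of the weight: every letter is counted twice as a neighbour and is
    subtracted twice as itself.  As the sum is positive, so is one of them. *)
Lemma choice_exists n (j : word I n) : exists c, choice_of j = Some c.
Proof.
rewrite /choice_of; case: pickP => [c _|none]; first by exists c.
have : (\sum_c (Lambda c + \sum_p adj arr c (j p)) <= \sum_c 2 * \sum_p (j p == c))%N.
  apply: leq_sum => c _; have := none c; rewrite /excess; lia.
rewrite big_split /= exchange_big /= [X in (_ + X <= _)%N](eq_bigr (fun=> 2%N)) => [|p _]; last exact: degree2.
rewrite -big_distrr /= exchange_big /= [X in (_ <= 2 * X)%N](eq_bigr (fun=> 1%N)) => [|p _].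
  by rewrite !sum_nat_const muln1 [(2 * _)%N]mulnC -{2}[(_ * 2)%N]add0n leq_add2r leqNgt Lambda0.
by rewrite (bigD1 (j p)) //= eqxx big1 // => c /negPf; rewrite eq_sym => ->.
Qed.

Lemma sum_over_choice n (D : nmodType) (F : word I n -> D) :
  \sum_c \sum_(j | choice_of j == Some c) F j = \sum_j F j.
Proof.
rewrite (exchange_big_dep xpredT) //=; apply: eq_bigr => j _.
have [c jc] := choice_exists j; rewrite (bigD1 c) ?jc //= big1 ?addr0 //.
by move=> c' /andP[/eqP[->]]; rewrite eqxx.
Qed.

(** Von Neumann regularity passes from the cyclotomic algebra of rank N + 2 to that
    of rank N + 1, for every quiver in which all vertices have two neighbours. *)
Lemma regular_descent N :
  von_neumann_regular (C (ltn0Sn N.+1)) -> von_neumann_regular (C (ltn0Sn N)).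
Proof.
have R := cyclotomic_klr K i0 arrN (ltn0Sn N) Lambda.
have [M xM] := cyclotomic_nilpotent K i0 arrN (ltn0Sn N) Lambda arrI.
have [iota iotaE] := inclusion K i0 arrN N.+1.
have phiE := cyclotomic_represents K arr i0 (ltn0Sn N) Lambda.
have kC j b := @cqh_scalar_central K I arr N.+1 (ltn0Sn N) Lambda j b.
have cyc := cyclotomic_relation K arr i0 (ltn0Sn N) Lambda.
have thE c := residue_map arrI arrN R (fun j p d _ => kC j _) (fun j p _ => kC j _)
  (fun j a _ => kC j _) (fun _ => cyc) xM c phiE iotaE.
have [th thP] := choice thE.
pose S := @selector N.+1 _ (qeps i0 idfun) (qx (idfun : quiver_hecke K arr N.+2 -> _)).
have descend := @regular_by_trace I (quiver_hecke K arr N.+1) (quiver_hecke K arr N.+2)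
  (C (ltn0Sn N)) (C (ltn0Sn N.+1)) iota (cpi K arr (ltn0Sn N) Lambda)
  (cpi K arr (ltn0Sn N.+1) Lambda) th S.
apply: descend.
- exact: cpi_surj.
- exact: cpi_surj.
- by move=> c; case: (thP c).
- move=> c z; have [tB _ _ tc _] := thP c.
  apply: (vanish_on_ideal tB (hn := ltn0Sn N.+1) (Lambda := Lambda)) => u v; exact: tc.
- by move=> c; case: (thP c).
- by move=> c; case: (thP c).
- move=> c z.
  have RD := quiver_hecke_klr i0 arrN (idfun : {rmorphism quiver_hecke K arr N.+2 -> _}).
  apply: (selector_comm RD _ c (represents_generated z iotaE)).
  exact: qh_scalar_comm.
rewrite (eq_bigr (fun c => \sum_(j | choice_of j == Some c) cpi K arr (ltn0Sn N) Lambda (qh_e K arr j))).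
  by rewrite sum_over_choice; apply: sum_e.
move=> c _; have [tB _ tr _ tv] := thP c.
rewrite /S /selector; apply: etrans; first exact: (additive_sum _ _ tB).
apply: eq_bigr => j jc.
rewrite -(rep_e iotaE) tr (rep_e phiE); apply: tv.
have kc : (0 < excess j c)%N.
  by move: jc; rewrite /choice_of; case: pickP => // c' h /eqP[<-].
have -> : (\sum_(p < N.+1) adj arr c (letters i0 j p) = \sum_p adj arr c (j p))%N.
  by apply: eq_bigr => p _; rewrite letters_ord.
have -> : (\sum_(p < N.+1) (letters i0 j p == c) = \sum_p (j p == c))%N.
  by apply: eq_bigr => p _; rewrite letters_ord.
by move: kc; rewrite /excess; lia.
Qed.

End Descent.
End Necessity.

(** * Semisimple rings are von Neumann regular *)

(** Let a be given, and let S be a sum of simple summands, maximal among those that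
    meet the left ideal generated by a in 0.  By maximality the left ideal and S
    together contain every summand, so 1 = b a + s with s in S.  Then a - a b a = a s
    lies in both, hence is 0. *)
Lemma semisimple_regular (A : pzRingType) : semisimple A -> von_neumann_regular A.
Proof.
case=> k [L [simpleL decomp]] a.
have L0 j : 0 \in L j by case: (simpleL j) => -[].
have LZ j (c u v : A^o) : u \in L j -> v \in L j -> c *: u + v \in L j.
  by case: (simpleL j) => -[_ LD] _ _; apply: LD.
pose inS (J : {set 'I_k}) (x : A^o) := exists2 f : 'I_k -> A^o,
  (forall j, f j \in L j) & x = \sum_(j in J) f j.
have S0 J : inS J 0 by exists (fun=> 0) => //; rewrite big1.
have SZ J (c u v : A^o) : inS J u -> inS J v -> inS J (c *: u + v).
  move=> [f fL ->] [g gL ->]; exists (fun j => c *: f j + g j) => [j|]; first exact: LZ.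
  by rewrite scaler_sumr -big_split.
pose disj (J : {set 'I_k}) := `[< forall b s, inS J s -> b * a = s -> s = 0 >].
have d0 : disj set0 by apply/asboolP => b s [f _ ->] _; rewrite big_set0.
have [J /maxsetP[/asboolP Jd Jmax]] := ex_maxset (ex_intro (fun J => disj J) set0 d0).
pose W (x : A^o) := exists b s, inS J s /\ x = b * a + s.
have W0 : W 0 by exists 0, 0; split=> //; rewrite mul0r addr0.
have WZ (c u v : A^o) : W u -> W v -> W (c *: u + v).
  move=> [b [s [Ss ->]]] [b' [s' [Ss' ->]]]; exists (c * b + b'), (c *: s + s').
  split; first exact: SZ.
  by rewrite scalerDr mulrDl addrACA -mulrA.
have LW i (x : A^o) : x \in L i -> W x.
  pose N : {pred A^o} := fun x => `[< x \in L i /\ W x >].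
  have Nsub : submod_closed N.
    split=> [|c u v /asboolP[uL uW] /asboolP[vL vW]]; apply/asboolP; split=> //.
      exact: LZ.
    exact: WZ.
  have NL : {subset N <= L i} by move=> z /asboolP[].
  move=> xL; case: (simpleL i) => _ _ /(_ N Nsub NL) [N0|LN]; last first.
    by have /asboolP[] := LN x xL.
  have [iJ|iJ] := boolP (i \in J).
    exists 0, x; split; last by rewrite mul0r add0r.
    exists (fun j => if j == i then x else 0) => [j|]; first by case: eqP => [->|].
    by rewrite (bigD1 i) //= eqxx big1 ?addr0 // => j /andP[_ /negPf->].
  suff /Jmax /(_ (subsetUr _ _)) E : disj (i |: J) by rewrite -E setU11 in iJ.
  apply/asboolP => b s [f fL ->]; rewrite big_setU1 //= => E.
  have fi : f i = 0.
    apply: N0; apply/asboolP; split; first exact: fL.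
    exists b, (- \sum_(j in J) f j); split; last by rewrite E addrK.
    by rewrite -scaleN1r -[_ *: _]addr0; apply: SZ => //; exists f.
  rewrite fi add0r in E *; apply: Jd E.
  by exists f.
have [b [s [Ss E1]]] : W 1.
  have [f [[fL E1] _]] := decomp 1; rewrite E1.
  apply: (big_ind W) => // [u v Wu Wv|j _]; last exact: (LW j).
  by rewrite -[u]scale1r; apply: WZ.
exists b.
have as0 : a * s = 0.
  apply: (Jd (1 - a * b)).
    by rewrite -[a * s]addr0; apply: (SZ J a s 0).
  by rewrite mulrBl mul1r -mulrA -{1}[a]mulr1 E1 mulrDr addrAC subrr add0r.
by rewrite -[RHS]mulr1 E1 mulrDr as0 addr0 mulrA.
Qed.

Local Open Scope nat_scope.

(** * Combinatorics of words on a cyclic quiver *)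

(** V stands for the set of words with nonzero idempotent.  It is closed under
    prefixes and under exchanging distant letters, its words contain neither cc nor
    cdc with c and d adjacent, and their first letters lie in the support of the
    weight.  The neighbours of c are f c and g c. *)
Section Words.
Variables (I : finType) (V : seq I -> Prop) (adj : rel I) (L : I -> nat).
Hypothesis V_prefix : forall s r, V (s ++ r) -> V s.
Hypothesis V_swap : forall s c d r, c != d -> ~~ adj c d -> V (s ++ c :: d :: r) -> V (s ++ d :: c :: r).
Hypothesis V_cc : forall s c, ~ V (s ++ [:: c; c]).
Hypothesis V_cdc : forall s c d, adj c d -> ~ V (s ++ [:: c; d; c]).
Hypothesis V_start : forall c, V [:: c] -> 0 < L c.
Hypothesis adjC : forall c d, adj c d = adj d c.

Lemma move_left s c r s' : (forall a, a \in r -> a != c /\ ~~ adj a c) ->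
  V (s ++ r ++ c :: s') -> V (s ++ c :: r ++ s').
Proof.
elim: r s => [//|a r IH] s far; rewrite -[s ++ _]cat_rcons => h.
have [ac acN] := far a (mem_head _ _).
apply: V_swap => //; rewrite -cat_rcons; apply: IH => // b br; apply: far.
by rewrite inE br orbT.
Qed.

Lemma move_right s c r s' : (forall a, a \in r -> a != c /\ ~~ adj a c) ->
  V (s ++ c :: r ++ s') -> V (s ++ r ++ c :: s').
Proof.
elim: r s => [//|a r IH] s far h.
have [ac acN] := far a (mem_head _ _).
rewrite -[s ++ _]cat_rcons; apply: IH => [b br|]; first by apply: far; rewrite inE br orbT.
by rewrite cat_rcons; apply: V_swap; rewrite 1?eq_sym 1?adjC.
Qed.

Variables (f g : I -> I).
Hypothesis adjE : forall c d, adj c d = (d == f c) || (d == g c).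

Lemma split_first (c : I) s : c \in s -> exists s1 s2, s = s1 ++ c :: s2 /\ c \notin s1.
Proof.
elim: s => // a s IH; rewrite inE; case: (eqVneq c a) => [<- _|ca /= /IH [s1 [s2 [-> cs1]]]].
  by exists [::], s.
by exists (a :: s1), s2; rewrite inE negb_or ca.
Qed.

Lemma split_last (c : I) s : c \in s -> exists s1 s2, s = s1 ++ c :: s2 /\ c \notin s2.
Proof.
elim/last_ind: s => // s a IH; rewrite mem_rcons inE; case: (eqVneq c a) => [<- _|ca /= /IH [s1 [s2 [-> cs1]]]].
  by exists s, [::]; rewrite cats1.
by exists s1, (rcons s2 a); rewrite rcons_cat mem_rcons inE negb_or ca.
Qed.

(** Between two successive occurrences of c both neighbours of c occur.  Otherwise
    at most one of them, d', occurs there; if it occurs twice, the statement for the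
    shorter stretch between two successive occurrences of d' gives another c.  If
    it occurs at most once, moving all other letters away leaves c c or c d' c. *)
Lemma repeated_letter s c r d : V (s ++ c :: r ++ [:: c]) -> c \notin r -> adj c d -> d \in r.
Proof.
have [m] := ubnP (size r); elim: m s c r d => // m IH s c r d rm h cr cd.
have far (q : seq I) : {subset q <= r} -> f c \notin q -> g c \notin q -> forall a, a \in q -> a != c /\ ~~ adj a c.
  move=> qr fq gq a aq; split; first by apply: contraNneq cr => <-; apply: qr.
  by rewrite adjC adjE negb_or; apply/andP; split; [apply: contraNneq fq => <-|apply: contraNneq gq => <-].
apply/negPn/negP => dr.
have : exists d', (forall q : seq I, d \notin q -> d' \notin q -> f c \notin q /\ g c \notin q) /\ adj c d'.
  move: (cd); rewrite adjE => /orP[] /eqP E; [exists (g c)|exists (f c)]; split.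
  - by move=> q; rewrite E.
  - by rewrite adjE eqxx orbT.
  - by move=> q; rewrite E.
  - by rewrite adjE eqxx.
case=> d' [dd' d'c].
have [d'r|d'r] := boolP (d' \in r); last first.
  have [fr gr] := dd' r dr d'r.
  have := move_left (s := s ++ [:: c]) (s' := [::]) (far r (fun _ h => h) fr gr).
  rewrite -!catA /= => /(_ h) /=; rewrite cats0 => h'.
  by apply: (@V_cc s c); apply: (V_prefix (r := r)); rewrite -catA.
have [r1 [r2 [rE d'r1]]] := split_first d'r.
have [d'r2|d'r2] := boolP (d' \in r2).
  have [r3 [r4 [r2E d'r3]]] := split_first d'r2.
  have sub3 : {subset r3 <= r} by move=> a a3; rewrite rE r2E !(mem_cat, inE) a3 !orbT.
  suff : c \in r3 by move/sub3; rewrite (negPf cr).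
  apply: (IH (s ++ c :: r1) d') => //; last by rewrite adjC.
    by move: rm; rewrite rE r2E !(size_cat, size_rcons) /= !size_cat /=; lia.
  apply: (V_prefix (r := r4 ++ [:: c])); move: h; rewrite rE r2E.
  by rewrite -?catA /= -?catA /= -?catA.
have s1 : {subset r1 <= r} by move=> a ar; rewrite rE mem_cat ar.
have s2 : {subset r2 <= r} by move=> a ar; rewrite rE mem_cat inE ar !orbT.
have [f1 g1] : f c \notin r1 /\ g c \notin r1 by apply: dd' => //; apply: contra dr; apply: s1.
have [f2 g2] : f c \notin r2 /\ g c \notin r2 by apply: dd' => //; apply: contra dr; apply: s2.
have h1 : V (s ++ r1 ++ c :: (d' :: r2 ++ [:: c])).
  apply: move_right; first exact: far.
  by move: h; rewrite rE -!catA.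
have := move_left (s := s ++ r1 ++ [:: c; d']) (s' := [::]) (far r2 s2 f2 g2).
rewrite -!catA /= cats0 => /(_ h1) h2.
apply: (@V_cdc (s ++ r1) c d' d'c); apply: (V_prefix (r := r2)).
by rewrite -!catA.
Qed.

(** A letter preceded neither by itself nor by a neighbour can be moved to the
    front. *)
Lemma first_letter s c : V (s ++ [:: c]) -> c \notin s -> f c \notin s -> g c \notin s -> 0 < L c.
Proof.
move=> h cs fs gs; apply: V_start; apply: (V_prefix (r := s)).
have := @move_left [::] c s [::]; rewrite /= cats0; apply=> // a as_.
split; first by apply: contraNneq cs => <-.
by rewrite adjC adjE negb_or; apply/andP; split; [apply: contraNneq fs => <-|apply: contraNneq gs => <-].
Qed.

End Words.

Section Chain.
Variables (I : finType) (V : seq I -> Prop) (adj : rel I) (L : I -> nat).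
Hypothesis V_prefix : forall s r, V (s ++ r) -> V s.
Hypothesis V_swap : forall s c d r, c != d -> ~~ adj c d -> V (s ++ c :: d :: r) -> V (s ++ d :: c :: r).
Hypothesis V_cc : forall s c, ~ V (s ++ [:: c; c]).
Hypothesis V_cdc : forall s c d, adj c d -> ~ V (s ++ [:: c; d; c]).
Hypothesis V_start : forall c, V [:: c] -> 0 < L c.
Hypothesis adjC : forall c d, adj c d = adj d c.

(** Suppose c is new in s, and so is its neighbour f c.  Either c can be moved to the
    front, or g c occurs before it; its first occurrence satisfies the same
    hypotheses.  Repeating this walks from c in the direction of g through letters
    of s until a letter in the support of the weight. *)
Lemma chain (f g : I -> I) s c : (forall c d, adj c d = (d == f c) || (d == g c)) -> cancel g f ->
  V (s ++ [:: c]) -> c \notin s -> f c \notin s ->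
  exists2 r, 0 < L (iter r g c) & forall k, k < r -> iter k.+1 g c \in s.
Proof.
move=> adjE gK; have [m] := ubnP (size s); elim: m s c => // m IH s c sm h cs fs.
have [gs|gs] := boolP (g c \in s); last first.
  by exists 0 => //=; apply: (first_letter V_prefix V_swap V_start adjC adjE h).
have [s1 [s2 [sE gs1]]] := split_first gs.
have sub1 : {subset s1 <= s} by move=> a a1; rewrite sE mem_cat a1.
have [||||r Lr rs] := IH s1 (g c) => //.
- by move: sm; rewrite sE size_cat /=; lia.
- by apply: (V_prefix (r := s2 ++ [:: c])); move: h; rewrite sE -!catA.
- by rewrite gK; apply: contra cs; apply: sub1.
exists r.+1 => [|[|k] kr] //; first by rewrite iterSr.
by rewrite iterSr; apply/sub1/rs.
Qed.

(** Two adjacent letters c and d = f c cannot be appended to s in both orders.  By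
    the previous lemmas neither occurs in s, so s contains a walk from c along g and
    a walk from d along f, both to the support of the weight.  The two endpoints
    are joined by a string of letters through c and d; if it is short, the
    endpoints are too close to each other, and if it is long, s has too many
    distinct letters. *)
Lemma no_exchange (f g : I -> I) n s c :
  (forall c d, adj c d = (d == f c) || (d == g c)) -> cancel f g -> cancel g f ->
  (forall i k l, k <= n -> l <= n -> iter k f i = iter l f i -> k = l) ->
  (forall i k, 0 < k < n -> 0 < L i -> L (iter k f i) = 0) ->
  (size s).+2 <= n -> V (s ++ [:: c; f c]) -> V (s ++ [:: f c; c]) -> False.
Proof.
move=> adjE fK gK inj far sn Vcd Vdc; set d := f c in Vcd Vdc.
have Vc : V (s ++ [:: c]) by apply: (V_prefix (r := [:: d])); rewrite -catA.
have Vd : V (s ++ [:: d]) by apply: (V_prefix (r := [:: c])); rewrite -catA.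
have cd : adj c d by rewrite adjE eqxx.
have rep := repeated_letter V_prefix V_swap V_cc V_cdc adjC adjE.
have only c1 d1 : adj c1 d1 -> V (s ++ [:: c1]) -> V (s ++ [:: d1]) -> c1 \notin s.
  move=> cd1 V1 V2; apply/negP => cs.
  have [s1 [r [sE cr]]] := split_last cs.
  have dr : d1 \in r by apply: (rep s1 c1) => //; move: V1; rewrite sE -!catA.
  have [r1 [r2 [rE dr2]]] := split_last dr.
  have : c1 \in r2.
    apply: (rep (s1 ++ c1 :: r1) d1) => //; last by rewrite adjC.
    by move: V2; rewrite sE rE -!catA /= -!catA.
  by move=> cr2; move: cr; rewrite rE mem_cat inE cr2 !orbT.
have cs : c \notin s := only _ _ cd Vc Vd.
have ds : d \notin s by apply: (only d c) => //; rewrite adjC.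
have [r Lr rs] := chain adjE gK Vc cs ds.
have [||q Lq qs] := @chain g f s d _ fK Vd ds; rewrite ?fK //.
  by move=> a b; rewrite adjE orbC.
have iK k i : iter k f (iter k g i) = i.
  by elim: k i => // k IHk i; rewrite iterSr iterS gK IHk.
have qE : iter q f d = iter (q + r).+1 f (iter r g c) by rewrite -addSn iterD iK iterSr.
have [small|large] := ltnP (q + r).+1 n.
  by move: Lq; rewrite qE far // small.
(* The two walks are cut down to n - 1 letters of s in total, which are pairwise
   distinct because n + 1 successive vertices of the cycle are. *)
pose r' := minn r n.-1; pose q' := n.-1 - r'.
have q'q : q' <= q by rewrite /q' /r'; lia.
have r'r : r' <= r by rewrite /r'; lia.
have rq : r' + q' = n.-1 by rewrite /q' /r'; lia.
pose b := iter r' g c.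
pose exps := iota 0 r' ++ iota r'.+2 q'.
have usub : {subset [seq iter k f b | k <- exps] <= s}.
  move=> a /mapP[k]; rewrite mem_cat !mem_iota => kE ->; case/orP: kE => kE.
    have -> : iter k f b = iter (r' - k.+1).+1 g c.
      have bE : b = iter k g (iter (r' - k.+1).+1 g c).
        by rewrite /b -iterD; congr (iter _ _ _); lia.
      by rewrite bE iK.
    by apply: rs; lia.
  have -> : iter k f b = iter (k - r'.+2).+1 f d.
    have kk : k = (k - r'.+2).+1 + 1 + r' by lia.
    by rewrite [in LHS]kk iterD iK iterD.
  by apply: qs; lia.
have uniqE : uniq [seq iter k f b | k <- exps].
  rewrite map_inj_in_uniq.
    rewrite cat_uniq !iota_uniq /= andbT; apply/hasPn => k; rewrite mem_iota => kE.
    by apply/negP; rewrite mem_iota; lia.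
  by move=> k l; rewrite !mem_cat !mem_iota => kn ln E; apply: (inj b) => //; lia.
have := uniq_leq_size uniqE usub; rewrite size_map size_cat !size_iota rq -ltnS => U.
by have := leq_trans sn (leq_trans (leqSpred n) U); rewrite ltnn.
Qed.

End Chain.

Local Open Scope ring_scope.

(** * Vanishing of the dots *)

Section WordIdempotents.
Variables (I : finType) (arr : rel I) (i0 : I) (A : pzRingType) (n : nat).
Variables (eps : nat -> I -> A) (x t : nat -> A).
Hypothesis arrI : forall i, ~~ arr i i.
Hypothesis arrN : forall i j, arr i j -> ~~ arr j i.
Hypothesis R : klr arr n eps x t.
Variable L : I -> nat.
Hypothesis cyc : (0 < n)%N -> \sum_d x 0 ^+ L d * eps 0 d = 0.

Definition es (s : seq I) : A := pre eps (size s) (nth i0 s).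

Lemma es_rcons s c : es (s ++ [:: c]) = es s * eps (size s) c.
Proof.
rewrite /es size_cat addn1 preS nth_cat ltnn subnn /=; congr (_ * _).
by apply: eq_pre => p ps; rewrite nth_cat ps.
Qed.

Lemma es_cat s r : exists z, es (s ++ r) = es s * z.
Proof.
elim/last_ind: r => [|r c [z E]]; first by exists 1; rewrite cats0 mulr1.
exists (z * eps (size (s ++ r)) c).
by rewrite -cats1 catA es_rcons E -mulrA.
Qed.

Lemma es_prefix s r : es s = 0 -> es (s ++ r) = 0.
Proof. by move=> s0; have [z ->] := es_cat s r; rewrite s0 mul0r. Qed.

Lemma x_prefix p s r : x p * es s = 0 -> x p * es (s ++ r) = 0.
Proof. by move=> s0; have [z ->] := es_cat s r; rewrite mulrA s0 mul0r. Qed.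

Section Swap.
Variables (s r : seq I) (c d : I).
Hypothesis sn : (size (s ++ c :: d :: r) <= n)%N.
Local Notation a := (size s).

Let an : (a.+1 < n)%N.
Proof. by move: sn; rewrite size_cat /=; lia. Qed.

Lemma t_es : t a * es (s ++ c :: d :: r) = es (s ++ d :: c :: r) * t a.
Proof.
rewrite /es (t_pre R) //; last by rewrite size_cat /=; lia.
have -> : size (s ++ d :: c :: r) = size (s ++ c :: d :: r) by rewrite !size_cat.
congr (_ * _); apply: eq_pre => p ps; rewrite /= /swp !nth_cat.
case: (ltngtP p a) => pa.
- have -> : (p == a.+1) = false by apply/eqP; lia.
  by rewrite pa.
- case: (eqVneq p a.+1) => [->|pa'].
    by rewrite ltnn subnn subSnn.
  have -> : (p < a)%N = false by lia.
  by have [q ->] : exists q, (p - a)%N = q.+2 by exists (p - a).-2; lia.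
have -> : (a.+1 < a)%N = false by lia.
by rewrite pa subnn subSnn.
Qed.

Lemma es_two : es (s ++ c :: d :: r) = two eps a c d * es (s ++ c :: d :: r).
Proof.
rewrite two.unlock -mulrA /es (eps_pre R) //; last by rewrite size_cat /=; lia.
rewrite nth_cat ltnNge leqnSn subSnn /=.
rewrite eqxx (eps_pre R) ?eqxx //; last by rewrite size_cat /=; lia.
by rewrite nth_cat ltnn subnn /= eqxx.
Qed.

Lemma tt_es : t a * (t a * es (s ++ c :: d :: r)) = Q arr c d (x a) (x a.+1) * es (s ++ c :: d :: r).
Proof. by apply: (klr_ttE R an); rewrite {1}es_two two.unlock. Qed.

Lemma es_far : c != d -> ~~ adj arr c d -> es (s ++ d :: c :: r) = 0 -> es (s ++ c :: d :: r) = 0.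
Proof.
rewrite /adj negb_or => cd /andP[/negPf cd1 /negPf cd2] E.
have := tt_es; rewrite /Q cd1 cd2 (negPf cd) mul1r => <-.
by rewrite t_es E mul0r mulr0.
Qed.

End Swap.

(** The induction is on the length of the words, since a word is studied through its
    prefixes and through the words obtained from it by exchanging letters. *)
Definition killed k := forall s p, (size s <= k)%N -> (p < size s)%N -> x p * es s = 0.

(** On the word s c c put e for its idempotent.  The dot x_a kills e, so
    x_(a+1) t e = e; applying t once more gives 0 = t x_a t e = x_(a+1) t^2 e - t e
    = - t e, hence e = 0. *)
Lemma es_cc k s c : killed k -> (size s < k)%N -> ((size s).+2 <= n)%N -> es (s ++ [:: c; c]) = 0.
Proof.
move=> kl sk sn; set e := es _; set a := size s.
have sn' : (size (s ++ [:: c; c]) <= n)%N by rewrite size_cat /=; lia.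
have xe : x a * e = 0.
  rewrite /e -[[:: c; c]]/([:: c] ++ [:: c]) catA; apply: x_prefix.
  by apply: kl; rewrite size_cat /=; lia.
have te : t a * e = e * t a by apply: t_es.
have de : (\sum_b eps a b * eps a.+1 b) * e = e.
  by rewrite /e es_two // mulrA (sum_two R) ?eqxx //; lia.
have tte : t a * (t a * e) = 0.
  by rewrite tt_es // /Q (negPf (arrI c)) eqxx mul0r.
have txl := klr_txl R sn.
have xte : x a.+1 * (t a * e) = e.
  by rewrite -[RHS]de -txl mulrBl -!mulrA xe mulr0 subr0.
have te0 : t a * e = 0.
  have : t a * (x a * (t a * e)) = 0 by rewrite te [x a * _]mulrA xe mul0r mulr0.
  have -> : t a * (x a * (t a * e)) = x a.+1 * (t a * (t a * e)) - (\sum_b eps a b * eps a.+1 b) * (t a * e).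
    by rewrite -txl mulrBl -!mulrA opprB addrC subrK.
  by rewrite tte mulr0 sub0r te mulrA de => /eqP; rewrite oppr_eq0 => /eqP.
by rewrite -xte te0 mulr0.
Qed.

Lemma slope_unit c d z : adj arr c d -> slope arr A c d * z = 0 -> z = 0.
Proof.
rewrite /adj /slope; case: (boolP (arr c d)) => [cd _|_ /= ->].
  by rewrite (negPf (arrN cd)) subr0 mul1r.
by rewrite sub0r mulN1r => /eqP; rewrite oppr_eq0 => /eqP.
Qed.

Lemma braid_es s c d : ((size s).+3 <= n)%N ->
  (t (size s).+1 * t (size s) * t (size s).+1 - t (size s) * t (size s).+1 * t (size s)) * es (s ++ [:: c; d; c])
  = slope arr A c d * es (s ++ [:: c; d; c]).
Proof.
move=> sn; rewrite (klr_braid R) //; set a := size s.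
have sz : size (s ++ [:: c; d; c]) = a.+3 by rewrite size_cat /= addn3.
have E b b' : (slope arr A b b' * (eps a b * eps a.+1 b' * eps a.+2 b)) * es (s ++ [:: c; d; c])
   = if [&& c == b, d == b' & c == b] then slope arr A b b' * es (s ++ [:: c; d; c]) else 0.
  have n0 : nth i0 (s ++ [:: c; d; c]) a = c by rewrite nth_cat ltnn subnn.
  have n1 : nth i0 (s ++ [:: c; d; c]) a.+1 = d by rewrite nth_cat ltnNge leqnSn subSnn.
  have n2 : nth i0 (s ++ [:: c; d; c]) a.+2 = c.
    by rewrite nth_cat ltnNge leqW ?leqnSn // subSn ?leqnSn // subSnn.
  rewrite -!mulrA /es !(eps_pre R) ?sz // n2.
  case cb: (c == b); rewrite ?mulr0 ?andbF //= (eps_pre R) // ?n1; try lia.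
  case: (d == b'); rewrite ?mulr0 //= (eps_pre R) // ?n0; try lia.
  by rewrite cb.
rewrite mulr_suml (bigD1 c) //= mulr_suml (bigD1 d) //= E !eqxx /= !big1 ?addr0 //.
  by move=> b /negPf bc; rewrite mulr_suml big1 // => b' _; rewrite E eq_sym bc.
by move=> b /negPf bd; rewrite E eqxx eq_sym bd.
Qed.

(** Both sides of the braid relation vanish on s c d c, because they pass through
    words containing c c, but their difference is the slope, which is 1 or -1. *)
Lemma es_cdc k s c d : killed k -> ((size s).+3 <= k.+1)%N -> ((size s).+3 <= n)%N ->
  adj arr c d -> es (s ++ [:: c; d; c]) = 0.
Proof.
move=> kl sk sn cd; apply: (slope_unit cd); rewrite -braid_es //.
have t0 : t (size s) * es (s ++ [:: c; d; c]) = 0.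
  rewrite t_es; last by rewrite size_cat /=; lia.
  rewrite -[[:: d; c; c]]/([:: d] ++ [:: c; c]) catA (es_cc _ kl) ?mul0r // size_cat /=; lia.
have t1 : t (size s).+1 * es (s ++ [:: c; d; c]) = 0.
  have -> : (size s).+1 = size (s ++ [:: c]) by rewrite size_cat addn1.
  rewrite -[[:: c; d; c]]/([:: c] ++ [:: d; c]) catA t_es; last by rewrite !size_cat /=; lia.
  rewrite -catA -[[:: c] ++ [:: c; d]]/([:: c; c] ++ [:: d]) catA es_prefix ?mul0r //.
  by apply: (es_cc _ kl); lia.
by rewrite mulrBl -!mulrA t0 t1 !mulr0 subrr.
Qed.

Variables (f g : I -> I).
Hypothesis adjE : forall c d, adj arr c d = (d == f c) || (d == g c).
Hypotheses (fK : cancel f g) (gK : cancel g f).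
Hypothesis inj : forall i k l, (k <= n)%N -> (l <= n)%N -> iter k f i = iter l f i -> k = l.
Hypothesis far : forall i k, (0 < k < n)%N -> (0 < L i)%N -> L (iter k f i) = 0%N.
Hypothesis L1 : forall i, (L i <= 1)%N.

Lemma cyc_eps0 c : (0 < n)%N -> x 0 ^+ L c * eps 0 c = 0.
Proof. by move=> n0; apply: (cyc_eps R). Qed.

(** The combinatorial statement applied to the nonzero words of length at most
    k + 1, for which its hypotheses follow from the vanishing of the dots on words
    of length at most k. *)
Lemma adj_exchange k s c d : killed k -> (k < n)%N -> ((size s).+2 <= k.+1)%N -> adj arr c d ->
  es (s ++ [:: c; d]) = 0 \/ es (s ++ [:: d; c]) = 0.
Proof.
move=> kl kn sk cd.
pose V (s : seq I) := (size s <= k.+1)%N /\ es s != 0.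
have Vp s1 r : V (s1 ++ r) -> V s1.
  move=> [sz nz]; split; first by move: sz; rewrite size_cat; lia.
  by apply: contraNneq nz => s0; rewrite es_prefix.
have Vs s1 c1 d1 r : c1 != d1 -> ~~ adj arr c1 d1 -> V (s1 ++ c1 :: d1 :: r) -> V (s1 ++ d1 :: c1 :: r).
  move=> cd1 cdN [sz nz]; split; first by move: sz; rewrite !size_cat.
  by apply: contraNneq nz => s0; rewrite es_far //; move: sz; rewrite !size_cat /=; lia.
have Vcc s1 c1 : ~ V (s1 ++ [:: c1; c1]).
  by rewrite /V size_cat /= => -[sz]; rewrite (es_cc _ kl) ?eqxx //; lia.
have Vcdc s1 c1 d1 : adj arr c1 d1 -> ~ V (s1 ++ [:: c1; d1; c1]).
  by move=> cd1; rewrite /V size_cat /= => -[sz]; rewrite (es_cdc kl) ?eqxx //; lia.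
have Vst c1 : V [:: c1] -> (0 < L c1)%N.
  move=> [_ nz]; rewrite lt0n; apply: contraNneq nz => L0.
  have := cyc_eps0 c1; rewrite L0 expr0 mul1r => e0.
  by rewrite -[[:: c1]]cat0s es_rcons e0 ?mulr0 //; lia.
have adjC a b : adj arr a b = adj arr b a by rewrite /adj orbC.
have V2 c1 d1 : es (s ++ [:: c1; d1]) <> 0 -> V (s ++ [:: c1; d1]).
  by move=> nz; split; [rewrite size_cat /=; lia|apply/eqP].
have main := @no_exchange I V (adj arr) L Vp Vs Vcc Vcdc Vst adjC f g n s.
have [|/eqP n1] := eqVneq (es (s ++ [:: c; d])) 0; first by left.
have [|/eqP n2] := eqVneq (es (s ++ [:: d; c])) 0; first by right.
exfalso; move: (cd); rewrite adjE => /orP[/eqP E|/eqP E]; rewrite E in n1 n2.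
  by apply: (main c) => //; [lia|apply: V2|apply: V2].
have cE : c = f (g c) by rewrite gK.
apply: (main (g c)) => //; rewrite ?gK; [lia|exact: V2|exact: V2].
Qed.

(** Induction on the length, for the dot on the last letter c, preceded by d.  If
    c = d the word is 0.  If they are adjacent, t^2 = 0 by the exchange lemma,
    and t^2 is the difference of the two dots up to sign, of which the first one
    vanishes.  Otherwise t^2 = 1 and x_(a+1) = x_(a+1) t^2 = t x_a t = 0. *)
Lemma killed_all k : (k <= n)%N -> killed k.
Proof.
elim: k => [|k IH] kn; first by move=> s p; case: s.
have kl : killed k by apply: IH; lia.
move=> s p; rewrite leq_eqVlt ltnS => /orP[/eqP sk|sk] ps; last exact: kl.
case: (lastP s) sk ps => // s' c; rewrite size_rcons -cats1 => -[sk] ps.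
move: ps; rewrite sk ltnS leq_eqVlt => /orP[/eqP pk|pk]; last first.
  by apply: x_prefix; apply: kl; lia.
case: (lastP s') sk => [|s'' d]; rewrite ?size_rcons => sk.
  rewrite pk -sk /= -[[:: c]]cat0s es_rcons /es pre0 mul1r.
  have := cyc_eps0 c (ltac:(lia)); have := L1 c; case: (L c) => [|[|]] //.
  by rewrite expr0 mul1r => _ ->; rewrite mulr0.
set a := size s'' in sk.
rewrite -cats1 -catA /= pk -sk.
have xa b s2 : x a * es (s'' ++ b :: s2) = 0.
  by rewrite -cat_rcons; apply: x_prefix; apply: kl; rewrite size_rcons; lia.
have sn b b' : (size (s'' ++ [:: b; b']) <= n)%N by rewrite size_cat /=; lia.
have an : (a.+1 < n)%N by lia.
have [->|dc] := eqVneq d c; first by rewrite (es_cc _ kl) ?mulr0 //; lia.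
have tt0 : es (s'' ++ [:: c; d]) = 0 -> t a * (t a * es (s'' ++ [:: d; c])) = 0.
  by move=> E; rewrite t_es // E mul0r mulr0.
have [adc|ndc] := boolP (adj arr d c).
  case: (adj_exchange kl kn (s := s'') (c := d) (d := c)) => [|//|->|/tt0]; [lia|by rewrite mulr0|].
  rewrite tt_es // /Q; move: adc; rewrite /adj; case: (arr d c) => /= [_|->].
    by rewrite mulrBl xa sub0r => /eqP; rewrite oppr_eq0 => /eqP.
  by rewrite mulrBl xa subr0.
have tt1 : t a * (t a * es (s'' ++ [:: d; c])) = es (s'' ++ [:: d; c]).
  move: ndc; rewrite tt_es // /adj negb_or /Q => /andP[/negPf-> /negPf->].
  by rewrite (negPf dc) mul1r.
rewrite -tt1; have txl := klr_txl R an.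
have -> : x a.+1 * (t a * (t a * es (s'' ++ [:: d; c])))
    = (\sum_b eps a b * eps a.+1 b) * (t a * es (s'' ++ [:: d; c])) + t a * (x a * (t a * es (s'' ++ [:: d; c]))).
  by rewrite -txl mulrBl -!mulrA subrK.
rewrite t_es // [x a * _]mulrA xa mul0r mulr0 addr0 mulrA es_two // mulrA (sum_two R) //.
by rewrite eq_sym (negPf dc) !mul0r.
Qed.

Lemma es_mkseq w : es (mkseq w n) = pre eps n w.
Proof. by rewrite /es size_mkseq; apply: eq_pre => p pn; rewrite nth_mkseq. Qed.

Lemma mkseq_split (w : nat -> I) a k : (a + k <= n)%N ->
  exists r, mkseq w n = mkseq w a ++ map w (iota a k) ++ r.
Proof.
move=> an; exists (map w (iota (a + k) (n - (a + k)))).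
rewrite /mkseq -!map_cat; congr (map _ _).
by rewrite -iotaD -[X in iota X _]add0n -iotaD; congr iota; lia.
Qed.

Lemma split2 (w : nat -> I) a : (a.+1 < n)%N ->
  exists r, mkseq w n = mkseq w a ++ w a :: w a.+1 :: r.
Proof. by move=> an; have [|r E] := @mkseq_split w a 2; [lia|exists r; rewrite E]. Qed.

Lemma pre_equal w a : (a.+1 < n)%N -> w a = w a.+1 -> pre eps n w = 0.
Proof.
move=> an E; rewrite -es_mkseq; have [r ->] := split2 w an.
rewrite -E -[w a :: w a :: r]/([:: w a; w a] ++ r) catA es_prefix //.
by apply: (es_cc _ (killed_all (leqnn n))); rewrite size_mkseq; lia.
Qed.

(** Every crossing is 0 or invertible on the idempotent of a word. *)
Lemma t_pre_cases w a : (a.+1 < n)%N ->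
  t a * pre eps n w = 0 \/ t a * (t a * pre eps n w) = pre eps n w.
Proof.
move=> an; rewrite -es_mkseq; have [r E] := split2 w an.
have sz : (size (mkseq w a ++ w a :: w a.+1 :: r) <= n)%N by rewrite -E size_mkseq.
have sza : size (mkseq w a) = a by rewrite size_mkseq.
have [e1|ne] := eqVneq (w a) (w a.+1).
  by left; rewrite es_mkseq (pre_equal an e1) mulr0.
rewrite E; have [ad|nad] := boolP (adj arr (w a) (w a.+1)).
  left; have [|kn] := ltnP a.+1 n.-1.+1; last by lia.
  have kl : killed a.+1 by apply: killed_all; lia.
  case: (adj_exchange (s := mkseq w a) kl an _ ad) => [|e1|e1]; first by rewrite sza.
    by rewrite -[_ :: _ :: r]/([:: w a; w a.+1] ++ r) catA es_prefix ?mulr0.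
  rewrite -[X in t X]sza t_es //.
  by rewrite -[w a.+1 :: _]/([:: w a.+1; w a] ++ r) catA es_prefix ?mul0r.
right; have := tt_es sz; rewrite sza => ->.
move: nad; rewrite /adj negb_or /Q => /andP[/negPf-> /negPf->].
by rewrite (negPf ne) mul1r.
Qed.

Lemma eq_on_words u v : (forall w, u * pre eps n w = v * pre eps n w) -> u = v.
Proof.
move=> uv; rewrite -[u]mulr1 -[v]mulr1 -(pre_sum R i0) !mulr_sumr.
by apply: eq_bigr => w _.
Qed.

Lemma x_zero p : (p < n)%N -> x p = 0.
Proof.
move=> pn; apply: eq_on_words => w; rewrite mul0r -es_mkseq.
by apply: (killed_all (leqnn n)); rewrite size_mkseq.
Qed.

Lemma braid_exact a : (a.+2 < n)%N -> t a.+1 * t a * t a.+1 = t a * t a.+1 * t a.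
Proof.
move=> an; apply/eqP; rewrite -subr_eq0; apply/eqP/eq_on_words => w.
rewrite mul0r (klr_braid R) // mulr_suml big1 // => c _; rewrite mulr_suml big1 // => d _.
rewrite -!mulrA (eps_pre R) //; case: eqP => [w2|]; last by rewrite !mulr0.
rewrite (eps_pre R) //; last by lia. case: eqP => [w1|]; last by rewrite !mulr0.
rewrite (eps_pre R) //; last by lia. case: eqP => [w0|]; last by rewrite !mulr0.
have [cd|cd] := boolP (adj arr c d); last first.
  by move: cd; rewrite /adj negb_or /slope => /andP[/negPf-> /negPf->]; rewrite subrr mul0r.
rewrite -es_mkseq; have [|r ->] := @mkseq_split w a 3; first by lia.
rewrite /= w0 w1 w2 -[_ :: _ :: _ :: r]/([:: c; d; c] ++ r) catA es_prefix ?mulr0 //.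
apply: (es_cdc (killed_all (leqnn n))) => //; rewrite size_mkseq; lia.
Qed.

End WordIdempotents.

(** * Semisimplicity from words and crossings *)

(** From here on the dots vanish, the crossings satisfy the exact braid relations,
    and each crossing is 0 or invertible on a given word.  So the idempotents of two
    words are related by at most one element up to a scalar, and the nonzero
    idempotents generate simple left ideals. *)
Section Semisimplicity.
Variables (K : fieldType) (I : finType) (arr : rel I) (i0 : I) (A : pzRingType) (n : nat).
Variables (eps : nat -> I -> A) (x t : nat -> A) (kappa : {rmorphism K -> A}).
Hypothesis R : klr arr n eps x t.
Hypothesis kappaC : forall c z, kappa c * z = z * kappa c.
Local Notation e := (pre eps n).
Hypothesis equal0 : forall w a, (a.+1 < n)%N -> w a = w a.+1 -> e w = 0.
Hypothesis t_cases : forall w a, (a.+1 < n)%N -> t a * e w = 0 \/ t a * (t a * e w) = e w.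
Hypothesis x0 : forall p, (p < n)%N -> x p = 0.
Hypothesis braid : forall a, (a.+2 < n)%N -> t a.+1 * t a * t a.+1 = t a * t a.+1 * t a.

Definition tl (l : seq nat) : A := \prod_(a <- l) t a.
Fixpoint act (l : seq nat) (w : nat -> I) : nat -> I :=
  if l is a :: l' then act l' w \o swp a else w.
Definition below m := all (fun a => a.+1 < m)%N.

Lemma tl_cat l l' : tl (l ++ l') = tl l * tl l'. Proof. exact: big_cat. Qed.
Lemma tl_cons a l : tl (a :: l) = t a * tl l. Proof. exact: big_cons. Qed.
Lemma tl_nil : tl [::] = 1. Proof. exact: big_nil. Qed.
Lemma tl_rcons l a : tl (rcons l a) = tl l * t a.
Proof. by rewrite -cats1 tl_cat /tl big_seq1. Qed.

Lemma t_e a w : (a.+1 < n)%N -> t a * e w = e (w \o swp a) * t a.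
Proof. by move=> an; rewrite (t_pre R) ?an. Qed.

Lemma tl_e l w : below n l -> tl l * e w = e (act l w) * tl l.
Proof.
elim: l => [|a l IH] /=; first by rewrite tl_nil mul1r mulr1.
by case/andP=> an ln; rewrite tl_cons -mulrA IH // mulrA t_e // -mulrA.
Qed.

Lemma below_le m m' l : (m <= m')%N -> below m l -> below m' l.
Proof. by move=> mm /allP h; apply/allP => a /h /leq_trans; apply. Qed.

Lemma act_above m l w p : below m l -> (m <= p)%N -> act l w p = w p.
Proof.
move=> + mp; elim: l w => //= a l IH w /andP[am lm].
by rewrite swp_id ?IH //; lia.
Qed.

Lemma e_orth u w : e u != 0 -> e u * e w != 0 -> forall p, (p < n)%N -> u p = w p.
Proof.
move=> _ uw p pn; apply/eqP; apply: contraNT uw => upw; apply/eqP.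
exact: (pre_orth R (leqnn n) pn).
Qed.

Lemma tl_inverse l w : below n l -> tl l * e w = 0 \/ exists b, b * (tl l * e w) = e w.
Proof.
elim: l w => [|a l IH] w /=; first by right; exists 1; rewrite tl_nil !mul1r.
case/andP=> an ln; rewrite tl_cons -mulrA; case: (IH w ln) => [->|[b E]]; first by left; rewrite mulr0.
case: (t_cases (act l w) an) => h; first by left; rewrite tl_e // mulrA h mul0r.
right; exists (b * t a); rewrite -[RHS]E -mulrA; congr (_ * _).
by rewrite tl_e // !mulrA -[t a * t a * _]mulrA h.
Qed.

(** The crossings t_(m-1), ..., t_j, which carry the letter at position j to
    position m. *)
Definition cyc m j := rev (iota j (m - j)).

Lemma cyc_nil m : cyc m m = [::]. Proof. by rewrite /cyc subnn. Qed.
Lemma cycS m j : (j < m)%N -> cyc m j = rcons (cyc m j.+1) j.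
Proof. by move=> jm; rewrite /cyc -[(m - j)%N]prednK ?subn_gt0 // /= rev_cons; congr (rcons (rev (iota _ _)) _); lia. Qed.
Lemma cyc_cons m j : (j <= m)%N -> cyc m.+1 j = m :: cyc m j.
Proof. by move=> jm; rewrite /cyc subSn // -addn1 iotaD rev_cat /= subnKC. Qed.
Lemma cyc_below m j : below m.+1 (cyc m j).
Proof. by apply/allP => a; rewrite mem_rev mem_iota; lia. Qed.

Lemma t_far a l : (forall b, b \in l -> (a.+1 < b)%N || (b.+1 < a)%N) -> below n l -> (a.+1 < n)%N ->
  t a * tl l = tl l * t a.
Proof.
elim: l => [|b l IH] far /=; first by rewrite tl_nil mulr1 mul1r.
case/andP=> bn ln an; rewrite tl_cons mulrA -[RHS]mulrA -IH //; last first.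
  by move=> d dl; apply: far; rewrite inE dl orbT.
rewrite [RHS]mulrA; congr (_ * _); case/orP: (far b (mem_head _ _)) => h.
  exact: (klr_tC R).
by symmetry; apply: (klr_tC R).
Qed.

Lemma cyc_t m j a : (j < a < m)%N -> (m < n)%N -> tl (cyc m j) * t a = t a.-1 * tl (cyc m j).
Proof.
case/andP; move: {2}(a - j)%N (leqnn (a - j)) => d; elim: d j => [|d IH] j; first by lia.
move=> jd ja am mn; rewrite cycS ?tl_rcons; last by lia.
have [aj|aj] := eqVneq a j.+1; last first.
  have -> : tl (cyc m j.+1) * t j * t a = tl (cyc m j.+1) * t a * t j.
    by rewrite -!mulrA (klr_tC R) //; lia.
  by rewrite IH ?mulrA //; lia.
rewrite aj /= cycS ?tl_rcons; last by lia.
have c2 : t j * tl (cyc m j.+2) = tl (cyc m j.+2) * t j.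
  apply: t_far; try lia; first by move=> b; rewrite mem_rev mem_iota; lia.
  by apply: below_le (cyc_below _ _); lia.
transitivity (tl (cyc m j.+2) * (t j.+1 * t j * t j.+1)); first by rewrite !mulrA.
by rewrite braid ?[RHS]mulrA ?[t j * (_ * _)]mulrA ?c2 ?mulrA //; lia.
Qed.

Lemma act_cyc m j w : (j <= m)%N -> act (cyc m j) w m = w j.
Proof.
elim: m w => [|m IH] w; first by rewrite leqn0 => /eqP->; rewrite cyc_nil.
rewrite leq_eqVlt ltnS => /orP[/eqP->|jm]; first by rewrite cyc_nil.
by rewrite cyc_cons //= swp_r IH.
Qed.

(** A strand cannot cross another one of the same colour. *)
Lemma cyc_vanish m j w i : (m < n)%N -> (j < i <= m)%N -> tl (cyc m j) * e w != 0 -> w i != w j.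
Proof.
elim: m w i => [|m IH] w i mn; first by lia.
case/andP=> ji im; rewrite cyc_cons; last by lia.
have bl : below n (cyc m j) by apply: below_le (cyc_below m j); lia.
rewrite tl_cons -mulrA => nz; have nz' : tl (cyc m j) * e w != 0.
  by apply: contraNneq nz => ->; rewrite mulr0.
have [im'|im'] := leqP i m; first by apply: IH => //; lia.
have -> : i = m.+1 by lia.
apply: contraNneq nz => E; rewrite tl_e // (equal0 mn) ?mul0r ?mulr0 //.
by rewrite act_cyc ?(act_above _ (cyc_below m j)) //; lia.
Qed.

(** Normal form with respect to the last position: a product of crossings is a
    product of crossings that avoid the position m, after one cycle. *)
Lemma cyc_form m l w : (m < n)%N -> below m.+1 l ->
  tl l * e w = 0 \/ exists j l', [/\ (j <= m)%N, below m l' &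
    tl l * e w = tl l' * (tl (cyc m j) * e w)].
Proof.
move=> mn; elim/last_ind: l w => [|l a IH] w.
  by move=> _; right; exists m, [::]; rewrite cyc_nil tl_nil !mul1r.
rewrite /below all_rcons => /andP[am lm]; have an : (a.+1 < n)%N by lia.
have E0 : tl (rcons l a) * e w = tl l * e (w \o swp a) * t a.
  by rewrite tl_rcons -mulrA t_e // mulrA.
case: (IH (w \o swp a) lm) => [z|[j [l' [jm l'm E]]]]; first by left; rewrite E0 z mul0r.
have E1 : tl (rcons l a) * e w = tl l' * (tl (cyc m j) * t a * e w).
  by rewrite E0 E -!mulrA t_e.
rewrite E1; have [aj|aj] := ltnP a.+1 j.
  right; exists j, (rcons l' a); rewrite /below all_rcons -/(below m l') l'm andbT tl_rcons; split=> //.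
    by lia.
  rewrite -t_far ?mulrA //; first by move=> b; rewrite mem_rev mem_iota; lia.
  by apply: below_le (cyc_below _ _).
have [ja|ja] := ltnP j a.
  right; exists j, (rcons l' a.-1); rewrite /below all_rcons -/(below m l') l'm andbT tl_rcons.
  split=> //; first by lia.
  by rewrite cyc_t ?mulrA //; lia.
have [ej|nj] := eqVneq a j.
  rewrite ej cycS ?tl_rcons -?ej; last by lia.
  rewrite -[_ * t a * t a]mulrA -[tl (cyc m a.+1) * _ * _]mulrA -[t a * t a * _]mulrA.
  case: (t_cases w an) => ->; first by left; rewrite !mulr0.
  by right; exists a.+1, l'.
have -> : j = a.+1 by lia.
right; exists a, l'; split=> //; first by lia.
by rewrite [cyc m a]cycS ?tl_rcons //; lia.
Qed.

(** Two nonzero products of crossings between the same words agree.  In the normal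
    forms the position j is determined by the words: it is the last position,
    up to m, of the letter u_m in w, since strands of the same colour cannot
    cross.  The rest follows by induction on the number of positions. *)
Lemma uniqueness m u w l l' : (m <= n)%N -> below m l -> below m l' ->
  e u * (tl l * e w) != 0 -> e u * (tl l' * e w) != 0 ->
  e u * (tl l * e w) = e u * (tl l' * e w).
Proof.
elim: m u w l l' => [|m IH] u w l l' mn.
  by case: l => [|//] _; case: l' => [|//] _.
move=> bl bl' nz nz'.
have form l1 : below m.+1 l1 -> e u * (tl l1 * e w) != 0 ->
    exists j l2, [/\ (j <= m)%N, below m l2, tl l1 * e w = tl l2 * (tl (cyc m j) * e w),
      u m = w j & forall i, (j < i <= m)%N -> w i != w j].
  move=> b1 nz1; case: (cyc_form w mn b1) => [z|[j [l2 [jm b2 E]]]].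
    by rewrite z mulr0 eqxx in nz1.
  have bn : below n l2 by apply: below_le b2; lia.
  have bc : below n (cyc m j) by apply: below_le (cyc_below m j); lia.
  exists j, l2; split=> //.
    have uw : e u * e (act l2 (act (cyc m j) w)) != 0.
      apply: contraNneq nz1 => z; rewrite E (tl_e _ bc) [tl l2 * _]mulrA (tl_e _ bn).
      by rewrite !mulrA z !mul0r.
    have unz : e u != 0 by apply: contraNneq uw => ->; rewrite mul0r.
    by rewrite (e_orth unz uw mn) (act_above _ b2) // act_cyc.
  move=> i ji; apply: (cyc_vanish mn ji); apply: contraNneq nz1 => z.
  by rewrite E z !mulr0.
have [j [l2 [jm b2 E uj last_j]]] := form l bl nz.
have [j' [l2' [jm' b2' E' uj' last_j']]] := form l' bl' nz'.
have jj : j = j'.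
  have [h|h|//] := ltngtP j j'.
    by have := last_j j'; rewrite -uj -uj' eqxx h jm' => /(_ isT).
  by have := last_j' j; rewrite -uj -uj' eqxx h jm => /(_ isT).
subst j'; have bc : below n (cyc m j) by apply: below_le (cyc_below m j); lia.
rewrite E E' (tl_e _ bc) in nz nz' *; rewrite !mulrA -![e u * _ * e _]mulrA in nz nz' *.
congr (_ * _); apply: IH => //; first by lia.
  by apply: contraNneq nz => ->; rewrite mul0r.
by apply: contraNneq nz' => ->; rewrite mul0r.
Qed.

(** Between any two words z is a scalar multiple of one product of crossings; by
    uniqueness, such elements are closed under addition. *)
Definition monomial z := forall u w : nat -> I,
  exists c l, below n l /\ e u * z * e w = kappa c * (e u * (tl l * e w)).

Lemma monomial_zero z u w : e u * z * e w = 0 ->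
  exists c l, below n l /\ e u * z * e w = kappa c * (e u * (tl l * e w)).
Proof. by move=> ->; exists 0, [::]; rewrite rmorph0 mul0r. Qed.

Lemma monomialB z z' : monomial z -> monomial z' -> monomial (z - z').
Proof.
move=> mz mz' u w; have [c [l [bl E]]] := mz u w; have [c' [l' [bl' E']]] := mz' u w.
rewrite mulrBr mulrBl E E'.
have [z0|nz] := eqVneq (e u * (tl l * e w)) 0.
  by exists (- c'), l'; rewrite z0 mulr0 sub0r rmorphN mulNr.
have [z0|nz'] := eqVneq (e u * (tl l' * e w)) 0.
  by exists c, l; rewrite z0 mulr0 subr0.
by exists (c - c'), l; rewrite (uniqueness (leqnn n) bl bl' nz nz') rmorphB mulrBl.
Qed.

Lemma monomial_sum (J : finType) (F : J -> A) : (forall j, monomial (F j)) -> monomial (\sum_j F j).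
Proof.
move=> mF; have m0 : monomial 0 by move=> u w; apply: monomial_zero; rewrite mulr0 mul0r.
apply: (big_ind monomial) => // a b ma mb.
by rewrite -[b]opprK -[- b]sub0r; apply: monomialB => //; apply: monomialB.
Qed.

Lemma monomial_word z z' v : monomial z -> monomial z' -> monomial (z * e v * z').
Proof.
move=> mz mz' u w; have [c [l [bl E]]] := mz u v; have [c' [l' [bl' E']]] := mz' v w.
have EE : e u * (z * e v * z') * e w = kappa c * (kappa c' * (e u * (tl l * (e v * (tl l' * e w))))).
  have -> : e u * (z * e v * z') * e w = (e u * z * e v) * (e v * z' * e w).
    by rewrite !mulrA -[_ * e v * e v]mulrA (pre_id R).
  rewrite E E' mulrA -[kappa c * _ * kappa c']mulrA -[_ * kappa c']kappaC -!mulrA.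
  by rewrite [e v * (e v * _)]mulrA (pre_id R).
have [z0|nz] := eqVneq (e v * e (act l' w)) 0.
  by rewrite EE; exists 0, [::]; rewrite rmorph0 mul0r tl_e // [e v * _]mulrA z0 mul0r !mulr0.
exists (c * c'), (l ++ l'); split; first by rewrite /below all_cat; apply/andP.
rewrite EE rmorphM -!mulrA tl_cat -[tl l * tl l' * _]mulrA; congr (_ * (_ * (_ * (_ * _)))).
have vE : e v = e (act l' w).
  have vn : e v != 0 by apply: contraNneq nz => ->; rewrite mul0r.
  by apply: eq_pre; apply: (e_orth vn nz).
by rewrite tl_e // mulrA vE (pre_id R).
Qed.

Lemma word_sum z : z = \sum_(i : word I n) z * e (letters i0 i).
Proof. by rewrite -mulr_sumr (pre_sum R i0) mulr1. Qed.

Lemma monomial1 : monomial 1.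
Proof. by move=> u w; exists 1, [::]; rewrite rmorph1 tl_nil !mulr1 !mul1r. Qed.

Lemma monomial_all z : generated n kappa eps x t z -> monomial z.
Proof.
elim=> [p d pn|p pn|a an|c||z1 z2 _ m1 _ m2|z1 z2 _ m1 _ m2].
- move=> u w; rewrite -mulrA (eps_pre R) //; case: eqP => _.
    by exists 1, [::]; rewrite rmorph1 tl_nil !mul1r.
  by exists 0, [::]; rewrite rmorph0 mul0r mulr0.
- by move=> u w; apply: monomial_zero; rewrite x0 // mulr0 mul0r.
- by move=> u w; exists 1, [:: a]; rewrite /below /= an rmorph1 mul1r /tl big_seq1 mulrA.
- by move=> u w; exists c, [::]; rewrite tl_nil mul1r -kappaC mulrA.
- exact: monomial1.
- exact: monomialB.
rewrite [z1]word_sum mulr_suml; apply: monomial_sum => i.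
exact: monomial_word.
Qed.

Hypothesis gen : forall z, generated n kappa eps x t z.

(** Let z be a nonzero element of the left ideal generated by e w, and u a word with
    e u z nonzero.  Then e u z is a scalar times a product of crossings, which is
    invertible on e w, so z generates e w. *)
Lemma simple_word w : e w != 0 -> simple_submod (fun z : A^o => z * e w == z).
Proof.
move=> nz; split.
- split=> [|c u v /eqP hu /eqP hv]; apply/eqP; first by rewrite mul0r.
  by rewrite mulrDl hv -[c *: u]/(c * u) -mulrA hu.
- by exists (e w); rewrite ?unfold_in //=; apply/eqP; rewrite (pre_id R).
move=> N [N0 NZ] NL; have [all0|/existsNP[z /not_implyP[zN z0]]] := pselect (forall z, z \in N -> z = 0); first by left.
right=> y /eqP yw; have zw : z * e w = z by apply/eqP: (NL z zN).
have NM (b v : A^o) : v \in N -> b * v \in N by move=> vN; rewrite -[b * v]addr0; apply: NZ.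
have [u uz] : exists u, e u * z != 0.
  apply: contrapT => no; apply: z0; rewrite -[z]mul1r -(pre_sum R i0) mulr_suml big1 // => i _.
  by apply: contrapT => h; apply: no; exists (letters i0 i); apply/eqP.
have [c [l [bl E]]] := monomial_all (gen z) u w; rewrite -mulrA zw in E.
have c0 : c != 0 by apply: contraNneq uz => c0; rewrite E c0 rmorph0 mul0r.
have Mnz : e u * (tl l * e w) != 0 by apply: contraNneq uz => M0; rewrite E M0 mulr0.
have [b Eb] : exists b, b * (e u * (tl l * e w)) = e w.
  case: (tl_inverse w bl) => [M0|[b Eb]]; first by rewrite M0 mulr0 eqxx in Mnz.
  exists b; have uE : e u = e (act l w).
    have nz' : e u * e (act l w) != 0.
      by apply: contraNneq Mnz => h; rewrite tl_e // mulrA h mul0r.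
    have un : e u != 0 by apply: contraNneq nz' => ->; rewrite mul0r.
    by apply: eq_pre; apply: (e_orth un nz').
  by rewrite (tl_e w bl) [e u * (_ * _)]mulrA uE (pre_id R) // -(tl_e w bl).
have : e w \in N.
  have -> : e w = b * kappa c^-1 * e u * z.
    rewrite -!mulrA E [kappa _ * (kappa _ * _)]mulrA -rmorphM mulVf // rmorph1 mul1r.
    by rewrite Eb.
  exact: NM.
by move=> /(NM y); rewrite yw.
Qed.

Lemma semisimple_words : semisimple A.
Proof.
pose S := [set i : word I n | e (letters i0 i) != 0].
pose E (j : 'I_#|S|) := e (letters i0 (enum_val j)).
have E_orth j k : E j * E k = if j == k then E j else 0.
  case: eqP => [->|/eqP jk]; first by rewrite (pre_id R).
  by apply: (pre_letters_orth i0 R); apply: contra jk => /eqP/enum_val_inj->.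
have E_sum z : z = \sum_j z * E j.
  rewrite {1}[z]word_sum (bigID (mem S)) /= [X in _ + X]big1 ?addr0; last first.
    by move=> i; rewrite inE negbK => /eqP->; rewrite mulr0.
  by rewrite big_enum_val.
exists #|S|, (fun j z => z * E j == z); split.
  by move=> j; apply: simple_word; have := enum_valP j; rewrite inE.
move=> z; exists [ffun j => z * E j]; split.
  split=> [j|]; last by rewrite [LHS]E_sum; apply: eq_bigr => j _; rewrite ffunE.
  by rewrite ffunE unfold_in; apply/eqP; rewrite -mulrA E_orth eqxx.
move=> h [hE zE]; apply/ffunP => j; rewrite ffunE zE mulr_suml (bigD1 j) //=.
have hj k : h k * E k = h k by apply/eqP; exact: hE.
rewrite hj big1 ?addr0 // => k /negPf kj.
by rewrite -hj -mulrA E_orth kj mulr0.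
Qed.

End Semisimplicity.

(** * The cyclic quiver and its weights *)

Section CyclicQuiver.
Variables (e : nat) (arr : rel 'I_e.+1).
Hypothesis he : (1 < e)%N.
Hypothesis harr : A1_quiver arr.

Lemma A1_irreflexive i : ~~ arr i i.
Proof. by apply/negP => a; have := proj2 harr i i (proj1 harr i i a); rewrite addbb. Qed.

Lemma A1_antisymmetric i j : arr i j -> ~~ arr j i.
Proof. by move=> a; have := proj2 harr i j (proj1 harr i j a); rewrite a. Qed.

Lemma A1_adj c d : adj arr c d = (d == ordS c) || (d == ord_pred c).
Proof.
have -> : (d == ord_pred c) = (c == ordS d).
  by apply/eqP/eqP => ->; rewrite ?ord_predK ?ordSK.
rewrite -/(A1_edge c d); apply/idP/idP => [/orP[/(proj1 harr)//|/(proj1 harr)]|/(proj2 harr)].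
  by rewrite /A1_edge orbC.
by rewrite /adj; case: (arr c d).
Qed.

Lemma iter_ordS k (i : 'I_e.+1) : iter k (@ordS e.+1) i = ((i + k) %% e.+1)%N :> nat.
Proof.
elim: k => [|k IH] /=; first by rewrite addn0 modn_small.
by rewrite IH addnS -addn1 modnDml addn1.
Qed.

Lemma iter_ordS_inj (i : 'I_e.+1) k l : (k <= e)%N -> (l <= e)%N ->
  iter k (@ordS e.+1) i = iter l (@ordS e.+1) i -> k = l.
Proof.
move=> ke le /(congr1 val) /=; rewrite !iter_ordS => /eqP.
by rewrite eqn_modDl !modn_small // => /eqP.
Qed.

Lemma A1_degree d : (\sum_c adj arr c d = 2)%N.
Proof.
have fg : ordS d != ord_pred d.
  apply/eqP => E; have : iter 2 (@ordS e.+1) d = iter 0 (@ordS e.+1) d by rewrite /= E ord_predK.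
  by move/(iter_ordS_inj he (leq0n _)).
rewrite (bigD1 (ordS d)) //= (bigD1 (ord_pred d)) 1?eq_sym //= big1 => [|c /andP[c1 c2]].
  by rewrite !A1_adj ordSK ord_predK !eqxx ?orbT.
have -> : adj arr c d = adj arr d c by rewrite /adj orbC.
by rewrite A1_adj (negPf c1) (negPf c2).
Qed.

End CyclicQuiver.

Section Weight.
Variables (e m : nat) (i_ : 'I_m -> 'I_e.+1).
Local Notation Lambda := (\sum_(s < m) fund_weight (i_ s) : weight 'I_e.+1).

Lemma weightE c : Lambda c = (\sum_(s < m) (i_ s == c))%N.
Proof.
rewrite -[LHS]/((\sum_(s < m) fund_weight (i_ s) : {ffun 'I_e.+1 -> nat}) c).
by rewrite sum_ffunE; apply: eq_bigr => s _; rewrite ffunE eq_sym.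
Qed.

Lemma weight_pos c : (0 < Lambda c)%N -> exists s, i_ s = c.
Proof.
rewrite weightE; case: (boolP [exists s, i_ s == c]) => [/existsP[s /eqP sc]|/existsPn no].
  by exists s.
by rewrite big1 // => s _; have := no s; case: eqP.
Qed.

Lemma weight_ge1 s : (0 < Lambda (i_ s))%N.
Proof. by rewrite weightE (bigD1 s) //= eqxx. Qed.

Lemma weight_ge2 s s' : s != s' -> i_ s = i_ s' -> (1 < Lambda (i_ s))%N.
Proof. by move=> ss E; rewrite weightE (bigD1 s) //= (bigD1 s') 1?eq_sym //= -E !eqxx. Qed.

Lemma weight_le1 c : (forall s s', s != s' -> i_ s != i_ s') -> (Lambda c <= 1)%N.
Proof.
move=> inj; have [->//|/weight_pos[s <-]] := posnP (Lambda c).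
rewrite weightE (bigD1 s) //= eqxx big1 // => s' ss.
by have := inj s' s ss; case: eqP.
Qed.

End Weight.

Section Main.
Variables (K : fieldType) (e : nat) (arr : rel 'I_e.+1).
Hypothesis he : (1 < e)%N.
Hypothesis harr : A1_quiver arr.
Let arrI := A1_irreflexive harr.
Let arrN := A1_antisymmetric harr.

Section Obstruction.
Variable Lambda : weight 'I_e.+1.
Local Notation C N := (cyclotomic_quiver_hecke K arr (ltn0Sn N) Lambda).

Lemma regular_smaller i N d : (0 < Lambda i)%N -> (d <= N)%N ->
  von_neumann_regular (C N) -> von_neumann_regular (C d).
Proof.
move=> Li; elim: N => [|N IH]; first by rewrite leqn0 => /eqP->.
rewrite leq_eqVlt ltnS => /orP[/eqP->//|dN reg]; apply: IH => //.
apply: (regular_descent ord0 arrI arrN) reg; first exact: A1_degree.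
by rewrite (bigD1 i) //= addn_gt0 Li.
Qed.

Lemma string_neighbour (i : 'I_e.+1) d :
  adj arr (iter d.+1 (@ordS e.+1) i) (iter d (@ordS e.+1) i).
Proof. by rewrite (A1_adj harr) /= ordSK eqxx orbT. Qed.

Lemma string_sum (i : 'I_e.+1) d :
  (0 < \sum_(p < d.+1) adj arr (iter d.+1 (@ordS e.+1) i) (iter p (@ordS e.+1) i))%N.
Proof. by rewrite big_ord_recr /= -iterS string_neighbour addn1. Qed.

(** The last letter of a walk around the whole cycle has two neighbours in it, its
    predecessor and the first letter. *)
Lemma full_string_sum (i : 'I_e.+1) :
  (1 < \sum_(p < e) adj arr (iter e (@ordS e.+1) i) (iter p (@ordS e.+1) i))%N.
Proof.
have e1 : (e.-1 < e)%N by lia. have e0 : (0 < e)%N by lia.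
rewrite (bigD1 (Ordinal e1)) //= (bigD1 (Ordinal e0)) /=; last first.
  by apply/eqP => /(congr1 val) /=; lia.
have -> : adj arr (iter e (@ordS e.+1) i) (iter e.-1 (@ordS e.+1) i).
  by rewrite -[X in iter X _ i]prednK // string_neighbour.
have -> : adj arr (iter e (@ordS e.+1) i) i.
  rewrite (A1_adj harr); apply/orP; left; apply/eqP/val_inj.
  by apply: (etrans _ (esym (iter_ordS e.+1 i))); rewrite modnDr modn_small.
by [].
Qed.

(** The words i, i + 1, ..., i + d without repetitions.  The first letter can be
    added because it lies in the support of the weight, and each later one because
    its predecessor is a neighbour; the last one has exponent bound at least 2. *)
Lemma string_obstruction i d N : (0 < Lambda i)%N -> (d <= N)%N -> (d <= e)%N ->
  let w k := iter k (@ordS e.+1) i in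
  (2 <= Lambda (w d) + \sum_(p < d) adj arr (w d) (w p))%N -> ~ von_neumann_regular (C N).
Proof.
move=> Li dN de w two /(regular_smaller Li dN).
have distinct p q : (p < q)%N -> (q <= e)%N -> (w p == w q) = false.
  by move=> pq qe; apply/eqP => /(iter_ordS_inj (leq_trans (ltnW pq) qe) qe); lia.
have none q : (q <= e)%N -> (\sum_(p < q) (w p == w q) = 0)%N.
  by move=> qe; rewrite big1 // => p _; rewrite distinct.
have adm q k : (q <= e)%N -> (Lambda (w q) + \sum_(p < q) adj arr (w q) (w p) = k.+1)%N ->
    admissible arr Lambda w q k.
  by move=> qe E; rewrite /admissible none // E muln0 add0n.
apply: (not_regular ord0 arrI arrN (w := w)
  (j := (Lambda (w d) + \sum_(p < d) adj arr (w d) (w p)).-2)).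
- move=> q qd; exists (Lambda (w q) + \sum_(p < q) adj arr (w q) (w p)).-1; apply: adm; first by lia.
  case: q qd => [|q] qd; first by rewrite big_ord0 addn0 prednK.
  by have := string_sum i q; rewrite /w; lia.
- by apply: adm => //; move: two; lia.
by move=> p pd; rewrite distinct.
Qed.

End Obstruction.
Lemma good_semisimple n (hn : (0 < n)%N) (Lambda : weight 'I_e.+1) : (n <= e)%N ->
  (forall i k, (0 < k < n)%N -> (0 < Lambda i)%N -> Lambda (iter k (@ordS e.+1) i) = 0%N) ->
  (forall i, (Lambda i <= 1)%N) ->
  semisimple (cyclotomic_quiver_hecke K arr hn Lambda).
Proof.
move=> ne far L1; have R := cyclotomic_klr K ord0 arrN hn Lambda.
have cyc (_ : (0 < n)%N) := cyclotomic_relation K arr ord0 hn Lambda.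
have inj (i : 'I_e.+1) k l : (k <= n)%N -> (l <= n)%N ->
    iter k (@ordS e.+1) i = iter l (@ordS e.+1) i -> k = l.
  by move=> kn ln; apply: iter_ordS_inj; lia.
have adjE := A1_adj harr.
apply: (semisimple_words ord0 (kappa := @cqh_scalar K _ arr n hn Lambda) R).
- exact: cqh_scalar_central.
- by move=> w a an; apply: (pre_equal ord0 arrI arrN R cyc adjE (@ordSK _) (@ord_predK _) inj far L1 an).
- by move=> w a an; apply: (t_pre_cases ord0 arrI arrN R cyc adjE (@ordSK _) (@ord_predK _) inj far L1 w an).
- by move=> p pn; apply: (x_zero ord0 arrI arrN R cyc adjE (@ordSK _) (@ord_predK _) inj far L1 pn).
- by move=> a an; apply: (braid_exact ord0 arrI arrN R cyc adjE (@ordSK _) (@ord_predK _) inj far L1 an).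
- exact: cyclotomic_generated.
Qed.

End Main.

Theorem corollary8p3 (K : closedFieldType) (e n m : nat)
    (arr : rel 'I_e.+1) (i_ : 'I_m -> 'I_e.+1)
    (he : (1 < e)%N) (hn : (0 < n)%N) (hm : (0 < m)%N)
    (hK2 : 2%N \notin [pchar K])
    (hKe : forall p : nat, p \in [pchar K] -> ~~ (p %| e.+1)%N)
    (harr : A1_quiver arr) :
  semisimple (cyclotomic_quiver_hecke K arr hn (\sum_(s < m) fund_weight (i_ s)))
  <->
  (n <= e)%N /\
  (forall s1 s2 : 'I_m, s1 != s2 ->
     n%:Z <= `|(i_ s1)%:Z - (i_ s2)%:Z| <= e%:Z + 1 - n%:Z).
Proof.
set Lambda := \sum_(s < m) fund_weight (i_ s).
split; last first.
  move=> [ne dist]; apply: good_semisimple => // [i k kn|i].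
    move=> /weight_pos[s1 s1i]; apply/eqP; rewrite -leqn0 leqNgt; apply/negP => /weight_pos[s2 s2i].
    have v2 : (i_ s2 = ((i_ s1 + k) %% e.+1)%N :> nat) by rewrite s2i s1i iter_ordS.
    have lt1 := ltn_ord (i_ s1).
    have [small|large] := ltnP (i_ s1 + k) e.+1.
      rewrite modn_small // in v2.
      have ss : s1 != s2 by apply/eqP => ss; move: v2; rewrite -ss; lia.
      by have := dist _ _ ss; rewrite v2; lia.
    rewrite -(subnK large) modnDr modn_small in v2; last by lia.
    have ss : s1 != s2 by apply/eqP => ss; move: v2; rewrite -ss; lia.
    by have := dist _ _ ss; rewrite v2; lia.
  apply: weight_le1 => s s' ss; apply/eqP => E; have := dist _ _ ss; rewrite E; lia.
move=> /semisimple_regular; case: n hn => // n' hn; rewrite (bool_irrelevance hn (ltn0Sn n')) => reg.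
have obstruction := string_obstruction he harr.
have s0 : 'I_m := Ordinal hm.
have ne : (n'.+1 <= e)%N.
  rewrite leqNgt; apply/negP => en.
  apply: (obstruction _ Lambda (i_ s0) e n' (weight_ge1 i_ s0) en (leqnn e) _ reg).
  exact: leq_trans (full_string_sum he harr _) (leq_addl _ _).
split=> // s1 s2 ss; apply: contrapT => bad.
(* If i_s' lies at distance d < n after i_s, the word from i_s to i_s' ends with a
   letter of the support that has a neighbour in it, or, for d = 0, with a letter
   of multiplicity at least 2. *)
have conflict s s' d : s != s' -> (d < n'.+1)%N -> iter d (@ordS e.+1) (i_ s) = i_ s' -> False.
  move=> ss' dn E; apply: (obstruction _ Lambda (i_ s) d n' (weight_ge1 i_ s) dn _ _ reg).
    exact: ltnW (leq_trans dn ne).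
  rewrite E -/Lambda; case: d dn E => [|d] dn E.
    by apply: leq_trans (leq_addr _ _); rewrite /Lambda -E; apply: weight_ge2 ss' E.
  rewrite -E; apply: (@leq_add 1 1); last exact: string_sum.
  by rewrite E; apply: weight_ge1.
have ordered s s' : s != s' -> (i_ s <= i_ s')%N ->
    (n'.+1 <= i_ s' - i_ s)%N /\ (i_ s' - i_ s + n'.+1 <= e.+1)%N.
  move=> ss' le; have lt := ltn_ord (i_ s'); split; rewrite leqNgt; apply/negP => h.
    apply: (conflict s s' (i_ s' - i_ s)%N) => //; apply: val_inj => /=.
    by rewrite iter_ordS subnKC // modn_small.
  apply: (conflict s' s (e.+1 - (i_ s' - i_ s))%N); [by rewrite eq_sym|lia|].
  apply: val_inj => /=; rewrite iter_ordS (_ : (i_ s' + _ = i_ s + e.+1)%N); last by lia.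
  by rewrite modnDr modn_small.
apply: bad; have [le|/ltnW le] := leqP (i_ s1) (i_ s2).
  have := ordered _ _ ss le; lia.
have := ordered s2 s1; rewrite eq_sym => /(_ ss le); lia.
Qed.
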